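(* Let $n\ge 1$ be an integer and let $0<\alpha<n$ be real. Let $u\in L^{\frac{2n}{n-\alpha}}_{loc}(\mathbb{R}^n)$ be a positive function satisfying $$u(x)=\int_{\mathbb{R}^n}\frac{u(y)^{\frac{n+\alpha}{n-\alpha}}}{|x-y|^{n-\alpha}}\,dy\qquad\text{for all }x\in\mathbb{R}^n.$$ Then $u\in C^\infty(\mathbb{R}^n)$.
   Context: The function $u$ is Lebesgue measurable and defined at every point of $\mathbb{R}^n$, with values a priori in $(0,\infty]$; the integral equation is required to hold pointwise everywhere. *)

(* Defs.v *)
From HB Require Import structures.
From mathcomp Require Import all_boot all_order all_algebra.
From mathcomp Require Import all_classical all_reals all_analysis.
From mathcomp Require Import measurable_realfun.

Set Implicit Arguments.
Unset Strict Implicit.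
Unset Printing Implicit Defensive.

Import Order.TTheory GRing.Theory Num.Theory.
Import numFieldNormedType.Exports.

Local Open Scope classical_set_scope.
Local Open Scope ring_scope.

(* R^n is 'rV[R]_n. The library's norm on it is the sup norm; it induces the
   usual topology, but |x - y| in an integral kernel is the Euclidean norm. *)
Definition enorm (R : realType) (n : nat) (x : 'rV[R]_n) : R :=
  Num.sqrt (\sum_(i < n) x ord0 i ^+ 2).

Section lebesgue_measure_on_Rn.
Context (R : realType) (n : nat).
Implicit Types (A : set 'rV[R]_n) (I : 'rV[R]_n * 'rV[R]_n).

(* The half-open box with lower corner I.1 and upper corner I.2; it is empty,
   with volume 0, when I.2 ord0 i <= I.1 ord0 i for some i. *)
Definition box I : set 'rV[R]_n :=
  [set x | forall i, I.1 ord0 i < x ord0 i <= I.2 ord0 i].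

Definition box_volume I : R :=
  \prod_(i < n) Num.max 0 (I.2 ord0 i - I.1 ord0 i).

(* C ranges over the countable families of boxes; a family may be finite or
   empty, so that the empty set is also null in dimension 0. *)
Definition box_cover A : set (set ('rV[R]_n * 'rV[R]_n)) :=
  [set C | countable C /\ A `<=` \bigcup_(I in C) box I].

Definition lebesgue_outer A : \bar R :=
  ereal_inf [set \esum_(I in C) (box_volume I)%:E | C in box_cover A].

Let box_volume_ge0 I : (0 <= (box_volume I)%:E)%E.
Proof. by rewrite lee_fin; apply: prodr_ge0 => i _; rewrite le_max lexx. Qed.

Let lebesgue_outer_ge0 A : (0 <= lebesgue_outer A)%E.
Proof. by apply: le_ereal_inf_tmp => _ [C _ <-]; exact: esum_ge0. Qed.

Let lebesgue_outer0 : lebesgue_outer set0 = 0%E.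
Proof.
apply/eqP; rewrite eq_le lebesgue_outer_ge0 andbT.
apply: ereal_inf_lbound; exists set0; last by rewrite esum_set0.
by split; [exact: countable0|exact: sub0set].
Qed.

Let le_lebesgue_outer :
  {homo lebesgue_outer : A B / A `<=` B >-> (A <= B)%E}.
Proof.
move=> A B AB; apply/ereal_inf_le_tmp => _ [C [cC BC] <-].
by exists C => //; split => //; exact: subset_trans BC.
Qed.

Let lebesgue_outer_sigma_subadditive : sigma_subadditive lebesgue_outer.
Proof.
move=> A; have [[i ioo]|] := pselect (exists i, lebesgue_outer (A i) = +oo%E).
  by rewrite (eseries_pinfty _ _ ioo) ?leey// => m _; rewrite -ltNye
    (lt_le_trans _ (lebesgue_outer_ge0 _)).
rewrite -forallNE => Aoo.
suff add2e (e : {posnum R}) : (lebesgue_outer (\bigcup_m A m) <=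
    \sum_(i <oo) lebesgue_outer (A i) + e%:num%:E)%E.
  by apply/lee_addgt0Pr => _/posnumP[].
rewrite (le_trans _ (epsilon_trick _ _ _))//.
pose P m C := box_cover (A m) C /\ (\esum_(I in C) (box_volume I)%:E <=
  lebesgue_outer (A m) + (e%:num / (2 ^ m.+1)%:R)%:E)%E.
have [G PG] : {G & forall m, P m (G m)}.
  apply: (@choice _ _ P) => m; rewrite /P.
  have fA : lebesgue_outer (A m) \is a fin_num.
    by rewrite ge0_fin_numE// ltey; apply/eqP/Aoo.
  have e0 : 0 < e%:num / (2 ^ m.+1)%:R by [].
  have [_ [C CA <-] /ltW CE] := lb_ereal_inf_adherent e0 fA.
  by exists C.
apply: (@le_trans _ _ (\esum_(I in \bigcup_m G m) (box_volume I)%:E)).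
  apply: ereal_inf_lbound; exists (\bigcup_m G m) => //; split.
    by apply: bigcup_countable => // m _; exact: (PG m).1.1.
  move=> x [m _ Amx]; have [I GI xI] := (PG m).1.2 x Amx.
  by exists I => //; exists m.
rewrite seqDU_bigcup_eq esum_bigcupT; [|exact: trivIset_seqDU|by []].
rewrite -nneseries_esumT; last by move=> m; exact: esum_ge0.
apply: lee_nneseries => [m _ _|m _]; first exact: esum_ge0.
apply: (le_trans _ (PG m).2); apply: ereal_sup_le.
move=> _ [F [fF FG] <-]; exists F => //; split => //.
exact: subset_trans FG (@subset_seqDU _ _ m).
Qed.

HB.instance Definition _ := isOuterMeasure.Build R 'rV[R]_n lebesgue_outer
  lebesgue_outer0 lebesgue_outer_ge0 le_lebesgue_outer
  lebesgue_outer_sigma_subadditive.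

(* R^n with the sigma-algebra of Lebesgue measurable sets, that is, the sets
   satisfying Caratheodory's criterion (larger than the Borel sigma-algebra). *)
Definition lebesgue_space := caratheodory_type lebesgue_outer.

HB.instance Definition _ := Measurable.on lebesgue_space.

Definition lebesgue_Rn : set lebesgue_space -> \bar R := lebesgue_outer.

HB.instance Definition _ := isMeasure.Build _ lebesgue_space R lebesgue_Rn
  (@caratheodory_measure0 _ _ lebesgue_outer)
  (@caratheodory_measure_ge0 _ _ lebesgue_outer)
  (@caratheodory_measure_sigma_additive _ _ lebesgue_outer).

(* Here f : lebesgue_space -> _ only makes measurable_fun use the Lebesgue
   sigma-algebra; compactness is that of 'rV[R]_n. *)
Definition Lploc (p : R) (f : 'rV[R]_n -> \bar R) :=
  measurable_fun [set: lebesgue_space] (f : lebesgue_space -> \bar R) /\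
  forall K : set 'rV[R]_n, compact K ->
    (\int[lebesgue_Rn]_(x in K) (`|f x| `^ p) < +oo)%E.

End lebesgue_measure_on_Rn.

Arguments lebesgue_Rn R n : clear implicits.

Section smooth_functions.
Context (R : realType) (n : nat).
Implicit Type f : 'rV[R]_n -> R.

Definition basis_vector (i : 'I_n) : 'rV[R]_n := delta_mx ord0 i.

Fixpoint Ck (k : nat) f : Prop :=
  if k is k'.+1 then
    [/\ continuous f,
        forall (i : 'I_n) x, derivable f x (basis_vector i) &
        forall i : 'I_n, Ck k' (fun x => 'D_(basis_vector i) f x)]
  else continuous f.

Definition Cinfty f := forall k, Ck k f.

End smooth_functions.

(* Main.v *)
Require Import Defs.
From HB Require Import structures.
From mathcomp Require Import all_boot all_order all_algebra.
From mathcomp Require Import all_classical all_reals all_analysis.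
From mathcomp Require Import measurable_realfun.
From mathcomp Require Import ring lra.
Import Order.TTheory GRing.Theory Num.Theory.
Import numFieldNormedType.Exports.
Local Open Scope classical_set_scope.
Local Open Scope ring_scope.

Set Implicit Arguments.
Unset Strict Implicit.
Unset Printing Implicit Defensive.

(** The kernel [|z|^(alpha-n)] is split as [k1 + k2], with [k1] supported in the
unit ball and [k2 = phi (sqn z)] as smooth as needed: [phi t] is [t^(-s)] for
[t >= 1], continued by a Taylor polynomial at [1]. Finiteness of [u] at one
point makes [u^p] integrable against [(1 + |y|)^(alpha-n)], so convolution with
[k2] is harmless. Local boundedness of [u] comes from an iteration over level
sets [E_j = {u > T_j}], taken in balls that grow slightly with [j] while [T_j]
grows geometrically: with [Y_j] the integral of [u^p] over [E_j], smallness of the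
local [L^(2n/(n-alpha))] mass on high level sets gives
[T_j Y_j <= 3/4 T_(j+1) Y_(j+1)] while [T_j Y_j] stays bounded, so [Y_0 = 0].
Convolution with [k1] gains a fixed Hoelder exponent [beta] on locally bounded
functions. Since it commutes with translations, the mixed differences of
[k1 * g] are [O(|h|^beta |k|^c)] when [g] is locally [c]-Hoelder, so [k1 * g]
is Hoelder of exponent [beta + c] if [beta + c < 1], and differentiable with a
Hoelder derivative of exponent [beta + c - 1] if [beta + c > 1]. Iterating on
[u = k1 * u^p + k2 * u^p] gives derivatives of all orders. *)

(** * Sums over images of countable families *)

Section esum_image.
Local Open Scope ereal_scope.

(** The exponent [2n/(n-alpha)] is critical: the Hardy-Littlewood-Sobolev inequality returns [u] to
    the space it came from, and under the scaling of the equation every power of the level cancels.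
    Smallness can come only from the tail of the local integral of [u^(2n/(n-alpha))], and one
    threshold has to serve all levels at once. As no global integrability is assumed, the estimate
    on a ball needs a slightly larger one; the gaps are summable, the constants they cost grow
    geometrically, and the levels are made to grow at least as fast. A weak-type inequality is
    enough for the iteration; it comes from Tonelli and the integral of the kernel over a set of
    given measure. In the regularity part the obstacle is that for [alpha <= 1] the gradient of the
    kernel is not integrable at the origin: no derivative can be put on [k1], and its gain is a
    fractional exponent read off from differences. In real powers [0^(-s)] is [0], so a kernel
    written as a negative power vanishes on the diagonal instead of being infinite there; this only
    changes null sets. *)

Lemma subset_esum (R : realType) (T : choiceType) (A B : set T) (a : T -> \bar R) :
  A `<=` B -> \esum_(i in A) a i <= \esum_(i in B) a i.
Proof.
move=> AB; apply: ereal_sup_le => _ [F [fF FA] <-]; exists F => //; split => //.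
exact: subset_trans AB.
Qed.

(** [f] may identify indices, so only an inequality holds: choosing one preimage [g j] of each value
    turns the left sum into a sum over a subset of [C]. *)
Lemma esum_image_le (R : realType) (T T' : choiceType) (C : set T)
    (f : T -> T') (a : T' -> \bar R) : (forall t, 0 <= a t) ->
  \esum_(j in f @` C) a j <= \esum_(i in C) a (f i).
Proof.
move=> a0; have [C0|/set0P[t0 _]] := eqVneq C set0.
  by rewrite C0 image_set0 !esum_set0.
have /choice[g Pg] : forall j, exists i, (f @` C) j -> C i /\ f i = j.
  move=> j; have [[i Ci <-]|nj] := pselect ((f @` C) j).
    by exists i => _.
  by exists t0 => /nj.
rewrite (_ : \esum_(j in f @` C) a j = \esum_(j in f @` C) a (f (g j))).
  rewrite -(esum_image (f @` C) g (fun i => a (f i))).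
    by apply: subset_esum => _ [j /Pg[Cj _] <-].
  move=> j k; rewrite !inE => /Pg[_ fj] /Pg[_ fk] gjk.
  by rewrite -fj -fk gjk.
by apply: eq_esum => j /Pg[_ ->].
Qed.

End esum_image.

(** * Half-spaces and translations for the Lebesgue outer measure *)

Section lebesgue_outer_theory.
Context (R : realType) (n : nat).
Implicit Types (A : set 'rV[R]_n) (I : 'rV[R]_n * 'rV[R]_n) (h : 'rV[R]_n).

Lemma box_volume_ge0 I : 0 <= box_volume I.
Proof. by apply: prodr_ge0 => i _; rewrite le_max lexx. Qed.

(** Meant for an [f] that trims boxes: [f I] only has to contain the part of [box I] lying in [A],
    so a cover of [B] becomes a cheaper cover of [A]. *)
Lemma lebesgue_outer_cover_image A B (f : 'rV[R]_n * 'rV[R]_n -> 'rV[R]_n * 'rV[R]_n) C :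
  (forall I x, box I x -> A x -> box (f I) x) -> box_cover B C -> A `<=` B ->
  (lebesgue_outer A <= \esum_(I in C) (box_volume (f I))%:E)%E.
Proof.
move=> fA [cC BC] AB.
apply: (le_trans (y := \esum_(I in f @` C) (box_volume I)%:E)%E).
  apply: ereal_inf_lbound; exists (f @` C) => //; split.
    exact: (sub_countable (card_image_le _ _)).
  move=> x Ax; have [I CI xI] := BC _ (AB _ Ax).
  by exists (f I); [exists I | exact: fA].
by apply: (@esum_image_le _ _ _ _ _ (fun J => (box_volume J)%:E)) => J; rewrite lee_fin box_volume_ge0.
Qed.

Lemma lebesgue_outer_box I : (lebesgue_outer (box I) <= (box_volume I)%:E)%E.
Proof.
rewrite -(@esum_set1 _ _ I (fun I => (box_volume I)%:E)) ?lee_fin ?box_volume_ge0//.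
apply: ereal_inf_lbound; exists [set I] => //; split => //.
by move=> x; exists I.
Qed.

Definition upd (x : 'rV[R]_n) (i : 'I_n) (a : R) : 'rV[R]_n :=
  \row_j (if j == i then a else x ord0 j).

Lemma upd_eq x i a : upd x i a ord0 i = a.
Proof. by rewrite mxE eqxx. Qed.

Lemma upd_neq x i a j : j != i -> upd x i a ord0 j = x ord0 j.
Proof. by rewrite mxE => /negbTE ->. Qed.

(** The truncation at [0] in [box_volume] keeps the identity true when the hyperplane misses the
    box: one piece then has volume [0] and the other the volume of [I]. *)
Lemma box_volume_split i (a : R) I :
  box_volume (I.1, upd I.2 i (Num.min (I.2 ord0 i) a)) +
  box_volume (upd I.1 i (Num.max (I.1 ord0 i) a), I.2) = box_volume I.
Proof.
rewrite /box_volume (bigD1 i)//= (bigD1 i isT (F := fun j => Num.max 0 (I.2 _ _ - upd _ _ _ _ _)))//=.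
rewrite [RHS](bigD1 i)//= !upd_eq.
rewrite (eq_bigr (fun j => Num.max 0 (I.2 ord0 j - I.1 ord0 j))); last first.
  by move=> j ji; rewrite upd_neq.
rewrite [X in _ + _ * X](eq_bigr (fun j => Num.max 0 (I.2 ord0 j - I.1 ord0 j))); last first.
  by move=> j ji; rewrite upd_neq.
rewrite -mulrDl; congr (_ * _).
move: (I.1 ord0 i) (I.2 ord0 i) => b c.
have [ab|ba] := leP a b; have [cb|bc] := leP c b; have [ac|ca] := leP a c;
  rewrite ?(max_l ab) ?(max_r (ltW ba)) ?(min_r ac) ?(min_l (ltW ca)) //;
  repeat match goal with |- context [Num.max 0 ?x] => have [?|?] := leP 0 x end; lra.
Qed.

(** The hyperplane cuts each box of a cover of [X] into two boxes without loss of volume, and these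
    cover the two halves of [X]. Half-open boxes match the sides [<= a] and [> a] exactly. *)
Lemma halfspace_measurable i (a : R) :
  measurable ([set x | x ord0 i <= a] : set (lebesgue_space R n)).
Proof.
apply: le_caratheodory_measurable => X.
apply: le_ereal_inf_tmp => _ [C XC <-].
pose f I := (I.1, upd I.2 i (Num.min (I.2 ord0 i) a)).
pose g I := (upd I.1 i (Num.max (I.1 ord0 i) a), I.2).
have vol0 I : (0 <= (box_volume I)%:E)%E by rewrite lee_fin box_volume_ge0.
rewrite (_ : \esum_(I in C) _ = \esum_(I in C)
    ((box_volume (f I))%:E + (box_volume (g I))%:E))%E; last first.
  by apply: eq_esum => I _; rewrite -EFinD box_volume_split.
rewrite esumD//; apply: leeD.
  apply: (@lebesgue_outer_cover_image _ _ _ C _ XC); last by move=> x [].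
  move=> I x Ix [_ /= xa] j /=; have [->|ji] := eqVneq j i.
    by rewrite upd_eq le_min xa andbT; exact: Ix.
  by rewrite upd_neq//; exact: Ix.
apply: (@lebesgue_outer_cover_image _ _ _ C _ XC); last by move=> x [].
move=> I x Ix [_ /= /negP]; rewrite -ltNge => xa j /=; have [->|ji] := eqVneq j i.
  by rewrite upd_eq gt_max xa andbT; exact: Ix.
by rewrite upd_neq//; exact: Ix.
Qed.

Definition translate h (x : 'rV[R]_n) : 'rV[R]_n := x + h.

Lemma lebesgue_outer_shift_le h A :
  (lebesgue_outer (translate h @^-1` A) <= lebesgue_outer A)%E.
Proof.
apply: le_ereal_inf_tmp => _ [C [cC AC] <-].
pose f I := (I.1 - h, I.2 - h).
apply: (le_trans (y := \esum_(I in C) (box_volume (f I))%:E)%E).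
  apply: (le_trans (y := \esum_(I in f @` C) (box_volume I)%:E)%E).
    apply: ereal_inf_lbound; exists (f @` C) => //; split; first exact: (sub_countable (card_image_le _ _)).
    move=> x /AC[I CI xI]; exists (f I); first by exists I.
    move=> j; have := xI j; rewrite /= /translate !mxE ltrBlDr lerBrDr//.
  apply: (@esum_image_le _ _ _ _ _ (fun J => (box_volume J)%:E)) => J.
  by rewrite lee_fin box_volume_ge0.
apply: le_esum => I _; rewrite lee_fin le_eqVlt; apply/orP; left; apply/eqP.
by apply: eq_bigr => i _ /=; rewrite !mxE; congr Num.max; ring.
Qed.

Lemma lebesgue_outer_shift h A :
  lebesgue_outer (translate h @^-1` A) = lebesgue_outer A.
Proof.
apply/eqP; rewrite eq_le lebesgue_outer_shift_le/=.
rewrite {1}(_ : A = translate (- h) @^-1` (translate h @^-1` A)).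
  exact: lebesgue_outer_shift_le.
by apply/seteqP; split => x; rewrite /= /translate subrK.
Qed.

(** Caratheodory's criterion for the preimage, tested on [X], is the criterion for [A] tested on a
    translate of [X], because the outer measure is translation invariant. *)
Lemma measurable_shift h : measurable_fun [set: lebesgue_space R n]
  (translate h : lebesgue_space R n -> lebesgue_space R n).
Proof.
move=> _ A mA; rewrite setTI.
change (caratheodory_measurable (@lebesgue_outer R n) (translate h @^-1` A)) => X.
set t := translate h.
have tK B : t @^-1` (translate (- h) @^-1` B) = B.
  by apply/seteqP; split => x; rewrite /t /= /translate addrK.
have cA : caratheodory_measurable (@lebesgue_outer R n) A := mA.
have := cA (translate (- h) @^-1` X).
rewrite -(@lebesgue_outer_shift h (translate (- h) @^-1` X)).
rewrite -(@lebesgue_outer_shift h (_ `&` A)).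
rewrite -(@lebesgue_outer_shift h (_ `&` ~` A)).
by rewrite !preimage_setI preimage_setC !tK.
Qed.

End lebesgue_outer_theory.

Section sup_norm.
Context (R : realType) (n : nat).
Implicit Types x z : 'rV[R]_n.

Lemma coord_le_norm x i : `|x ord0 i| <= `|x|.
Proof.
rewrite [leRHS]/Num.norm /= mx_normrE.
exact: (le_bigmax _ (fun ij : 'I_1 * 'I_n => `|x ij.1 ij.2|) (ord0, i)).
Qed.

Lemma norm_le_coord x e : 0 <= e -> (forall i, `|x ord0 i| <= e) -> `|x| <= e.
Proof.
move=> e0 xe; rewrite [leLHS]/Num.norm /= mx_normrE; apply: bigmax_le => //.
by move=> [i j] _ /=; rewrite (ord1 i).
Qed.

Lemma norm_lt_coord x e : 0 < e -> (forall i, `|x ord0 i| < e) -> `|x| < e.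
Proof.
move=> e0 xe; rewrite [ltLHS]/Num.norm /= mx_normrE; apply: bigmax_lt => //.
by move=> [i j] _ /=; rewrite (ord1 i).
Qed.

End sup_norm.

(** * Measurability of open sets, measure of balls and points *)

Section lebesgue_Rn_theory.
Context (R : realType) (n : nat).
Notation T := (lebesgue_space R n).
Notation mu := (lebesgue_Rn R n).

Lemma measurable_coord (i : 'I_n) :
  measurable_fun [set: T] ((fun x => x ord0 i) : T -> R).
Proof.
move=> mD; apply: (measurability _ (RGenOInfty.measurableE R)) => //.
move=> /= _ [_ [a ->] <-]; apply: measurableI => //.
rewrite (_ : _ @^-1` _ = ~` [set x : T | x ord0 i <= a]).
  by apply: measurableC; exact: halfspace_measurable.
by apply/seteqP; split => x /=; rewrite in_itv/= andbT; [rewrite ltNge => /negP | move/negP; rewrite -ltNge].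
Qed.

(** An open set is the union of the cubes with rational centre and radius [1/(m+1)] that it
    contains; there are countably many, and each is cut out by coordinates. *)
Lemma open_measurable_Rn (U : set 'rV[R]_n) : open U -> measurable (U : set T).
Proof.
move=> oU.
pose c (q : 'rV[rat]_n * nat) : set T :=
  \bigcap_(i in [set: 'I_n]) [set x | `|x ord0 i - ratr (q.1 ord0 i)| < q.2.+1%:R^-1].
have cE q x : c q x <-> forall i, `|x ord0 i - ratr (q.1 ord0 i)| < q.2.+1%:R^-1.
  by rewrite /c; split => [H i|H i _]; [exact: (H i)|exact: H].
have mc q : measurable (c q).
  apply: fin_bigcap_measurable => [|i _]; first exact: finite_finset.
  have := measurable_coord i measurableT (measurable_itv (`](ratr (q.1 ord0 i) - q.2.+1%:R^-1), (ratr (q.1 ord0 i) + q.2.+1%:R^-1)[)).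
  rewrite setTI; congr measurable; apply/seteqP; split => x /=.
    by rewrite in_itv/= ltr_distl.
  by rewrite ltr_distl in_itv.
pose d q : set T := [set x | c q x /\ c q `<=` U].
have md q : measurable (d q).
  have [cU|cU] := pselect (c q `<=` U).
    by rewrite (_ : d q = c q); [exact: mc|apply/seteqP; split => x // [//]].
  by rewrite (_ : d q = set0); [exact: measurable0|apply/seteqP; split => x // []].
rewrite (_ : U = \bigcup_q d q); first exact: countable_bigcupT_measurable.
apply/seteqP; split => [x Ux|x [q _ [cx cU]]]; last exact: cU.
have : nbhs x U by exact: open_nbhs_nbhs.
rewrite -nbhs_ballE => -[e /= e0 xeU].
have [m me] : exists m : nat, m.+1%:R^-1 < e / 2.
  have := near_infty_natSinv_lt (PosNum (divr_gt0 e0 (ltr0Sn _ 1))).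
  by move=> [m _ /(_ m (leqnn m)) H]; exists m.
have m0 : 0 < m.+1%:R^-1 :> R by rewrite invr_gt0.
have /choice[q Hq] : forall i, exists q, `|x ord0 i - ratr q| < m.+1%:R^-1.
  move=> i; have [|q] := @rat_in_itvoo R (x ord0 i - m.+1%:R^-1) (x ord0 i + m.+1%:R^-1); first by rewrite ltrBlDr -addrA ltrDl addr_gt0.
  by rewrite in_itv/= => qx; exists q; rewrite ltr_distlC.
exists (\row_i q i, m) => //; split.
  by apply/cE => i; rewrite mxE.
move=> y /cE /= Hy; apply: xeU.
rewrite -ball_normE /= ; apply: norm_lt_coord => // i.
rewrite !mxE (le_lt_trans (ler_distD (ratr (q i)) _ _))// (splitr e) ltrD//.
  exact: lt_trans (Hq i) me.
by have := Hy i; rewrite mxE distrC => /lt_trans; exact.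
Qed.

Lemma continuous_measurable_Rn (f : 'rV[R]_n -> R) :
  continuous f -> measurable_fun [set: T] (f : T -> R).
Proof.
move=> cf mD; apply: (measurability _ (RGenOInfty.measurableE R)) => //.
move=> /= _ [_ [a ->] <-]; apply: measurableI => //.
by apply: open_measurable_Rn; apply: open_comp => // x _; exact: cf.
Qed.

Lemma measurable_ball_Rn (x : 'rV[R]_n) r :
  measurable ([set y | `|x - y| < r] : set T).
Proof.
apply: open_measurable_Rn; have [r0|r0] := ltP 0 r.
  by have := @ball_open R 'rV[R]_n x r; rewrite -ball_normE; exact.
rewrite (_ : [set y | _] = set0); first exact: open0.
by apply/seteqP; split => // y /= /lt_le_trans /(_ r0); rewrite normr_lt0.
Qed.

Lemma measurable_norm_le r : measurable ([set y : 'rV[R]_n | `|y| <= r] : set T).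
Proof.
have mn : measurable_fun [set: T] ((fun y : 'rV[R]_n => `|y|) : T -> R).
  by apply: continuous_measurable_Rn => x; exact: norm_continuous.
have := mn measurableT _ (measurable_itv (`]-oo, r])).
by rewrite setTI; congr measurable; apply/seteqP; split => x /=; rewrite in_itv.
Qed.

(** The ball is that of the sup norm, hence an open cube, which fits in a half-open box of side
    [2r]. *)
Lemma lebesgue_Rn_ball (x : 'rV[R]_n) r : 0 < r ->
  (mu [set y : 'rV[R]_n | (`|x - y| < r)%R] <= ((2 * r) ^+ n)%:E)%E.
Proof.
move=> r0; pose I := (x - const_mx r, x + const_mx r).
apply: (@le_trans _ _ (mu (box I))).
  apply: le_outer_measure => y /= xyr i; rewrite !mxE.
  have := le_lt_trans (coord_le_norm (x - y) i) xyr; rewrite !mxE ltr_norml => /andP[? ?].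
  by apply/andP; split; lra.
apply: (le_trans (lebesgue_outer_box _)); rewrite lee_fin /box_volume.
rewrite (eq_bigr (fun=> 2 * r)) ?prodr_const ?card_ord//.
by move=> i _; rewrite /= !mxE max_r; lra.
Qed.

Lemma lebesgue_Rn_sigma_finite : sigma_finite [set: T] mu.
Proof.
exists (fun m => [set y : 'rV[R]_n | `|0 - y| < m.+1%:R]).
  apply/seteqP; split => // x _; exists (Num.truncn `|x|) => //=.
  by rewrite sub0r normrN truncnS_gt.
move=> m; split; first exact: measurable_ball_Rn.
by rewrite (le_lt_trans (lebesgue_Rn_ball _ _))// ltry.
Qed.

HB.instance Definition _ := Measure_isSigmaFinite.Build _ T R mu
  lebesgue_Rn_sigma_finite.

Lemma lebesgue_Rn_set1 (x : 'rV[R]_n) : (0 < n)%N -> mu [set x] = 0%E.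
Proof.
move=> n0; apply/eqP; rewrite eq_le measure_ge0 andbT.
apply/lee_addgt0Pr => e e0; rewrite add0e.
have r0 : 0 < Num.min e 1 / 2 by rewrite divr_gt0// lt_min e0 ltr01.
apply: (@le_trans _ _ (mu [set y : 'rV[R]_n | (`|x - y| < Num.min e 1 / 2)%R])).
  by apply: le_outer_measure => y /= ->; rewrite subrr normr0.
apply: (le_trans (lebesgue_Rn_ball x r0)); rewrite lee_fin.
rewrite mulrC divfK//.
apply: (@le_trans _ _ (Num.min e 1 ^+ 1)); last by rewrite expr1 ge_min lexx.
by apply: ler_wiXn2l => //; rewrite ?ge_min ?lexx ?orbT// le_min ltW//= ler01.
Qed.

End lebesgue_Rn_theory.

(** * Real powers and geometric growth *)

Section powR_extra.
Context (R : realType).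
Implicit Types a b x y s t : R.

Lemma ler_powRN s x y : 0 <= s -> 0 < x -> x <= y -> y `^ (- s) <= x `^ (- s).
Proof.
move=> s0 x0 xy; have y0 := lt_le_trans x0 xy.
rewrite !powRN lef_pV2 ?posrE ?powR_gt0//.
by apply: ge0_ler_powR => //; rewrite nnegrE ltW.
Qed.

Lemma powRDr x s t : 0 < x -> x `^ (s + t) = x `^ s * x `^ t.
Proof. by move=> x0; rewrite powRD// (gt_eqF x0) implybT. Qed.

Lemma powR_exprl x m s : 0 <= x -> (x ^+ m) `^ s = (x `^ s) ^+ m.
Proof. by move=> x0; rewrite -(powR_mulrn m x0) powRAC powR_mulrn// powR_ge0. Qed.

Lemma powR_lt1 x s : 0 < x -> x < 1 -> 0 < s -> x `^ s < 1.
Proof.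
move=> x0 x1 s0; rewrite -(powRr0 x) /powR (gt_eqF x0) ltr_expR mul0r.
by rewrite pmulr_rlt0// ln_lt0// x0.
Qed.

(** Bernoulli's inequality. *)
Lemma exprn_unbounded x a : 1 < x -> exists m, a < x ^+ m.
Proof.
move=> x1; pose d := x - 1; have d0 : 0 < d by rewrite subr_gt0.
have bern m : 1 + m%:R * d <= x ^+ m.
  elim: m => [|m IH]; first by rewrite expr0 mul0r addr0.
  rewrite exprS; apply: (@le_trans _ _ (x * (1 + m%:R * d))).
    have h : 0 <= m%:R * d * d by rewrite !mulr_ge0// ltW.
    by rewrite -natr1 (_ : x = 1 + d); [nra|rewrite /d subrKC].
  by rewrite ler_pM2l// (lt_trans _ x1).
exists (Num.truncn (a / d)).+1; apply: lt_le_trans (bern _).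
have := truncnS_gt (a / d); rewrite ltr_pdivrMr// => /lt_trans; apply.
by rewrite ltrDr.
Qed.

End powR_extra.

(** The sets [A j] may overlap: it suffices that the sum of [c j] times the indicator of [A j]
    dominates [f], since its terms integrate to at most a geometric series. *)
Lemma ge0_integral_le_geometric d (T : measurableType d) (R : realType)
    (mu : {measure set T -> \bar R}) (D : set T) (f : T -> \bar R)
    (A : nat -> set T) (c : nat -> R) (a q : R) :
  measurable D -> measurable_fun D f -> (forall y, D y -> 0 <= f y)%E ->
  (forall j, measurable (A j)) -> (forall j, 0 <= c j) ->
  0 <= a -> 0 < q -> q < 1 ->
  (forall j, (c j)%:E * mu (A j) <= (a * q ^+ j)%:E)%E ->
  (forall y, D y -> exists2 j, A j y & (f y <= (c j)%:E)%E) ->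
  (\int[mu]_(y in D) f y <= (a / (1 - q))%:E)%E.
Proof.
move=> mD mf f0 mA c0 a0 q0 q1 cA fA.
have mc j : measurable_fun D (fun y => (c j * \1_(A j) y)%:E).
  by apply/measurable_EFinP; apply: measurable_funM => //; exact: measurable_indic.
have c1 j y : (0 <= (c j * \1_(A j) y)%:E)%E by rewrite lee_fin mulr_ge0.
apply: (@le_trans _ _ (\int[mu]_(y in D) (\sum_(j <oo) (c j * \1_(A j) y)%:E))%E).
  apply: ge0_le_integral => //.
    by apply: ge0_emeasurable_sum => // *; exact: c1.
  move=> y Dy; have [j Aj fj] := fA y Dy.
  have fj' : (f y <= (c j * \1_(A j) y)%:E)%E by rewrite indicE mem_set// mulr1.
  apply: (le_trans fj').
  rewrite (nneseries_split 0 j.+1)// add0n big_nat_recr//=.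
  rewrite -[leLHS]adde0 leeD//; last by exact: nneseries_ge0.
  by rewrite -[leLHS]add0e leeD//; exact: sume_ge0.
rewrite integral_nneseries//.
apply: lime_le; first by apply: is_cvg_nneseries => j _ _; exact: integral_ge0.
apply: nearW => m.
apply: (@le_trans _ _ (\sum_(0 <= j < m) (a * q ^+ j)%:E)%E).
  apply: lee_sum => j _; apply: le_trans (cA j).
  under eq_integral do rewrite EFinM.
  rewrite ge0_integralZl_EFin//; last exact/measurable_EFinP/measurable_indic.
  rewrite integral_indic// lee_wpmul2l//; first by rewrite lee_fin.
  by apply: le_measure; rewrite ?inE//; exact: measurableI.
rewrite sumEFin lee_fin; have := @geometric_le_lim R m a q a0 q0.
by rewrite /series/= /geometric/= ger0_norm ?(ltW q0)//; exact.
Qed.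

(** * Integrals of powers of the distance, inside and outside a ball *)

Section riesz_integrals.
Context (R : realType) (n : nat).
Notation T := (lebesgue_space R n).
Notation mu := (lebesgue_Rn R n).

Lemma measurable_normB (x : 'rV[R]_n) :
  measurable_fun [set: T] ((fun y : 'rV[R]_n => `|x - y|) : T -> R).
Proof.
apply: continuous_measurable_Rn => y.
apply: (@continuous_comp _ _ _ (fun z : 'rV[R]_n => x - z) Num.norm); last exact: norm_continuous.
by apply: continuousB; [exact: cst_continuous|move=> ?; exact: cvg_id].
Qed.

Lemma measurable_normB_powR (x : 'rV[R]_n) s :
  measurable_fun [set: T] ((fun y : 'rV[R]_n => `|x - y| `^ s) : T -> R).
Proof. exact: measurableT_comp (measurable_powR _) (measurable_normB x). Qed.

(** Dyadic shells: the ball of radius [r / 2^j] carries the value of the kernel at the inner radius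
    [r / 2^(j+1)]. Measure times value is of order [2^(-(n - s) j)], summable because [s < n]. *)
Lemma integral_riesz_near s : 0 <= s -> s < n%:R ->
  exists2 C, 0 < C & forall (x : 'rV[R]_n) r, 0 < r ->
    (\int[mu]_(y in [set y : 'rV[R]_n | (`|x - y| < r)%R]) (`|x - y| `^ (- s))%:E
      <= (C * r `^ (n%:R - s))%:E)%E.
Proof.
move=> s0 sn; pose b : R := 2^-1.
have b0 : 0 < b by rewrite /b.
have b1 : b < 1 by rewrite /b; lra.
pose q := b `^ (n%:R - s).
have q0 : 0 < q by rewrite powR_gt0.
have q1 : q < 1 by rewrite powR_lt1// subr_gt0.
pose C := b `^ (- s) * 2 ^+ n.
have C0 : 0 < C by rewrite mulr_gt0 ?powR_gt0// exprn_gt0.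
exists (C / (1 - q)); first by rewrite divr_gt0// subr_gt0.
move=> x r r0.
rewrite mulrAC.
apply: (@ge0_integral_le_geometric _ T R mu _ _
  (fun j => [set y : 'rV[R]_n | `|x - y| < r * b ^+ j] : set T)
  (fun j => (r * b ^+ j.+1) `^ (- s))).
- exact: measurable_ball_Rn.
- apply: measurable_funTS; apply/measurable_EFinP; exact: measurable_normB_powR.
- by move=> y _; rewrite lee_fin powR_ge0.
- by move=> j; exact: measurable_ball_Rn.
- by move=> j; exact: powR_ge0.
- by rewrite mulr_ge0 ?powR_ge0// ltW.
- exact: q0.
- exact: q1.
- move=> j; have rj0 : 0 < r * b ^+ j by rewrite mulr_gt0// exprn_gt0.
  apply: (@le_trans _ _ (((r * b ^+ j.+1) `^ (- s))%:E * ((2 * (r * b ^+ j)) ^+ n)%:E)%E).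
    by rewrite lee_wpmul2l ?lee_fin ?powR_ge0//; exact: lebesgue_Rn_ball.
  rewrite -EFinM lee_fin le_eqVlt; apply/orP; left; apply/eqP.
  rewrite powRM ?exprn_ge0// ?ltW// powR_exprl ?ltW//.
  rewrite /C /q addrC !powRDr// !powR_mulrn ?ltW// !exprMn -!exprM mulnC exprM exprS.
  ring.
(* At the singularity itself the power is [0], or [1] when [s = 0], so the point [x] can be put in
   shell [0]. *)
move=> y /= xyr; have [->|/eqP xy] := eqVneq x y.
  exists 0%N; first by rewrite /= subrr normr0 mulr_gt0// exprn_gt0.
  rewrite subrr normr0 lee_fin; have [->|s0'] := eqVneq s 0.
    by rewrite oppr0 !powRr0.
  by rewrite powR0 ?oppr_eq0// powR_ge0.
have z0 : 0 < `|x - y| by rewrite normr_gt0 subr_eq0; exact/eqP.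
have exm : exists m, r * b ^+ m <= `|x - y|.
  have [|m rm] := @exprn_unbounded R 2 (r / `|x - y|); first lra.
  exists m; rewrite /b exprVn ler_pdivrMr ?exprn_gt0// mulrC -ler_pdivrMr//.
  exact: ltW.
have [[|m] Hm minm] := ex_minnP exm.
  by move: Hm; rewrite expr0 mulr1 leNgt xyr.
exists m => /=.
  by rewrite ltNge; apply/negP => /minm; rewrite ltnn.
by rewrite lee_fin ler_powRN// mulr_gt0// exprn_gt0.
Qed.

(** The same shells going outwards; convergence now comes from [n < s]. *)
Lemma integral_riesz_far s : n%:R < s ->
  exists2 C, 0 < C & forall (x : 'rV[R]_n) r, 0 < r ->
    (\int[mu]_(y in [set y : 'rV[R]_n | (r <= `|x - y|)%R]) (`|x - y| `^ (- s))%:E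
      <= (C * r `^ (n%:R - s))%:E)%E.
Proof.
move=> ns; have s0 : 0 <= s by rewrite (le_trans _ (ltW ns)).
pose q : R := 2^-1 `^ (s - n%:R).
have h0 : 0 < 2^-1 :> R by [].
have q0 : 0 < q by rewrite powR_gt0.
have q1 : q < 1 by rewrite powR_lt1// ?subr_gt0//; lra.
pose C : R := 4 ^+ n.
have C0 : 0 < C by rewrite exprn_gt0.
exists (C / (1 - q)); first by rewrite divr_gt0// subr_gt0.
move=> x r r0; rewrite mulrAC.
apply: (@ge0_integral_le_geometric _ T R mu _ _
  (fun j => [set y : 'rV[R]_n | `|x - y| < r * 2 ^+ j.+1] : set T)
  (fun j => (r * 2 ^+ j) `^ (- s))).
- rewrite (_ : [set y | _] = ~` [set y : 'rV[R]_n | `|x - y| < r]).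
    by apply: measurableC; exact: measurable_ball_Rn.
  by apply/seteqP; split => y /=; [rewrite leNgt => /negP | move/negP; rewrite -leNgt].
- apply: measurable_funTS; apply/measurable_EFinP; exact: measurable_normB_powR.
- by move=> y _; rewrite lee_fin powR_ge0.
- by move=> j; exact: measurable_ball_Rn.
- by move=> j; exact: powR_ge0.
- by rewrite mulr_ge0 ?powR_ge0// ltW.
- exact: q0.
- exact: q1.
- move=> j; have rj0 : 0 < r * 2 ^+ j.+1 by rewrite mulr_gt0// exprn_gt0.
  apply: (@le_trans _ _ (((r * 2 ^+ j) `^ (- s))%:E * ((2 * (r * 2 ^+ j.+1)) ^+ n)%:E)%E).
    by rewrite lee_wpmul2l ?lee_fin ?powR_ge0//; exact: lebesgue_Rn_ball.
  rewrite -EFinM lee_fin le_eqVlt; apply/orP; left; apply/eqP.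
  rewrite powRM ?exprn_ge0// ?ltW// powR_exprl//.
  rewrite /C (_ : q = 2 `^ (- s) * 2 ^+ n); last first.
    by rewrite /q -powR_inv1// -powRrM mulN1r opprB addrC powRDr// powR_mulrn.
  rewrite addrC powRDr// powR_mulrn ?ltW//.
  rewrite exprMn (_ : 4 = 2 * 2 :> R); last by lra.
  rewrite exprS !exprMn -!exprM [(j * n)%N]mulnC; ring.
move=> y /= rxy.
have z0 : 0 < `|x - y| by rewrite (lt_le_trans r0).
have exm : exists m, `|x - y| < r * 2 ^+ m.
  have [|m rm] := @exprn_unbounded R 2 (`|x - y| / r); first lra.
  by exists m; rewrite mulrC -ltr_pdivrMr.
have [[|m] Hm minm] := ex_minnP exm.
  by move: Hm; rewrite expr0 mulr1 ltNge rxy.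
exists m => //=.
rewrite lee_fin ler_powRN// ?mulr_gt0// ?exprn_gt0// leNgt.
by apply/negP => /minm; rewrite ltnn.
Qed.

Lemma integral_translate (h : 'rV[R]_n) (f : T -> \bar R) :
  measurable_fun [set: T] f ->
  (\int[mu]_x f (translate h x) = \int[mu]_x f x)%E.
Proof.
move=> mf; have ge0case (g : T -> \bar R) : measurable_fun [set: T] g ->
    (forall x, 0 <= g x)%E -> (\int[mu]_x g (translate h x) = \int[mu]_x g x)%E.
  move=> mg g0; have mh := @measurable_shift R n h.
  have := ge0_integral_pushforward mh mu measurableT mg (fun y _ => g0 y).
  rewrite preimage_setT => <-; apply: eq_measure_integral => A mA _.
  exact: lebesgue_outer_shift.
rewrite integralE [RHS]integralE; congr (_ - _)%E.
  rewrite -(ge0case _ (measurable_funepos mf) (funepos_ge0 f)).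
  by apply: eq_integral => x _; rewrite !funeposE.
rewrite -(ge0case _ (measurable_funeneg mf) (funeneg_ge0 f)).
by apply: eq_integral => x _; rewrite !funenegE.
Qed.

End riesz_integrals.

(** * Comparison of the Euclidean norm with the sup norm *)

Section euclidean_norm.
Context (R : realType) (n : nat).
Notation T := (lebesgue_space R n).
Notation mu := (lebesgue_Rn R n).
Implicit Types z : 'rV[R]_n.

Definition sqn z : R := \sum_(i < n) z ord0 i ^+ 2.

Lemma sqn_ge0 z : 0 <= sqn z.
Proof. by apply: sumr_ge0 => i _; exact: sqr_ge0. Qed.

Lemma enorm_ge0 z : 0 <= enorm z.
Proof. exact: sqrtr_ge0. Qed.

Lemma enorm_powR z a : enorm z `^ a = sqn z `^ (a / 2).
Proof. by rewrite /enorm -powR12_sqrt ?sqn_ge0// mulrC powRrM. Qed.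

Lemma sqr_norm_le_sqn z : `|z| ^+ 2 <= sqn z.
Proof.
rewrite -(sqr_sqrtr (sqn_ge0 z)) ler_pXn2r ?nnegrE ?sqrtr_ge0//.
apply: norm_le_coord => [|i]; first exact: sqrtr_ge0.
rewrite -(ler_pXn2r (n := 2)) ?nnegrE ?sqrtr_ge0// sqr_sqrtr ?sqn_ge0//.
rewrite real_normK ?num_real// /sqn (bigD1 i)//= lerDl.
by apply: sumr_ge0 => j _; exact: sqr_ge0.
Qed.

Lemma sqn_le_sqr_norm z : sqn z <= n%:R * `|z| ^+ 2.
Proof.
rewrite (_ : n%:R * _ = \sum_(i < n) `|z| ^+ 2); last first.
  by rewrite sumr_const card_ord mulr_natl.
apply: ler_sum => i _; rewrite -(real_normK (num_real (z ord0 i))).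
by rewrite ler_pXn2r ?nnegrE//; exact: coord_le_norm.
Qed.

Lemma norm_le_enorm z : `|z| <= enorm z.
Proof.
rewrite -(ler_pXn2r (n := 2)) ?nnegrE ?enorm_ge0//.
by rewrite /enorm sqr_sqrtr ?sqn_ge0// sqr_norm_le_sqn.
Qed.

Lemma enorm_le_norm z : enorm z <= n%:R * `|z|.
Proof.
rewrite -(ler_pXn2r (n := 2)) ?nnegrE ?enorm_ge0 ?mulr_ge0//.
rewrite /enorm sqr_sqrtr ?sqn_ge0// (le_trans (sqn_le_sqr_norm z))//.
rewrite exprMn ler_wpM2r ?sqr_ge0// -natrX ler_nat.
by case: (n) => // m; rewrite leq_pmulr.
Qed.

Lemma enorm_eq0 z : (enorm z == 0) = (z == 0).
Proof.
apply/eqP/eqP => [z0|->].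
  apply/eqP; rewrite -normr_le0; have := norm_le_enorm z; by rewrite z0.
apply/eqP; rewrite eq_le enorm_ge0 andbT (le_trans (enorm_le_norm 0))//.
by rewrite normr0 mulr0.
Qed.

Lemma enormN z : enorm (- z) = enorm z.
Proof.
by rewrite /enorm; congr Num.sqrt; apply: eq_bigr => i _; rewrite mxE sqrrN.
Qed.

(** At [z = 0] both sides are the same power of [0]; elsewhere the sup norm is the smaller one. This
    transfers the integrals over cubes to the Euclidean kernel. *)
Lemma enorm_powRN_le z s : 0 < s -> enorm z `^ (- s) <= `|z| `^ (- s).
Proof.
move=> s0; have [->|z0] := eqVneq z 0.
  by rewrite (eqP (_ : enorm 0 == 0)) ?enorm_eq0// normr0.
by rewrite ler_powRN ?norm_le_enorm ?normr_gt0// ltW.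
Qed.

Lemma measurable_sqnB : measurable_fun [set: T * T]
  ((fun xy => sqn ((xy.1 : 'rV[R]_n) - xy.2)) : T * T -> R).
Proof.
rewrite /sqn; apply: measurable_sum => i.
under eq_fun do rewrite !mxE.
apply: (measurableT_comp (@exprn_measurable _ _ 2)).
by apply: measurable_funB; apply: (measurableT_comp (measurable_coord i)).
Qed.

Lemma measurable_enorm_powR a : measurable_fun [set: T * T]
  ((fun xy => enorm ((xy.1 : 'rV[R]_n) - xy.2) `^ a) : T * T -> R).
Proof.
under eq_fun do rewrite enorm_powR.
exact: measurableT_comp (measurable_powR _) measurable_sqnB.
Qed.

Lemma measurable_enorm_powRr (x : 'rV[R]_n) a : measurable_fun [set: T]
  ((fun y : 'rV[R]_n => enorm (x - y) `^ a) : T -> R).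
Proof.
have := measurableT_comp (measurable_enorm_powR a) (@measurable_pair1 _ _ T T x).
by [].
Qed.

End euclidean_norm.

Section ge0_integral_pieces.
Local Open Scope ereal_scope.
Context d (T : measurableType d) (R : realType) (mu : {measure set T -> \bar R}).
Implicit Types (D A : set T) (f g : T -> \bar R).

Lemma ge0_integral_setID D A f : measurable D -> measurable A ->
  measurable_fun [set: T] f -> (forall x, 0 <= f x) ->
  \int[mu]_(x in D) f x =
  \int[mu]_(x in D `&` A) f x + \int[mu]_(x in D `&` ~` A) f x.
Proof.
move=> mD mA mf f0; have mCA := measurableC mA.
rewrite -{1}[D](setIT D) -(setUv A) setIUr ge0_integral_setU//.
- exact: measurableI.
- exact: measurableI.
- exact: measurable_funTS.
- apply/disj_set2P; rewrite setIACA setICr setI0//.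
Qed.

Lemma ge0_le_integral_subset A D f g : measurable A -> measurable D -> A `<=` D ->
  measurable_fun [set: T] f -> measurable_fun [set: T] g ->
  (forall x, 0 <= f x) -> (forall x, 0 <= g x) -> (forall x, A x -> f x <= g x) ->
  \int[mu]_(x in A) f x <= \int[mu]_(x in D) g x.
Proof.
move=> mA mD AD mf mg f0 g0 fg.
apply: (@le_trans _ _ (\int[mu]_(x in A) g x)).
  by apply: ge0_le_integral => //; exact: measurable_funTS.
by apply: ge0_subset_integral => //; exact: measurable_funTS.
Qed.

End ge0_integral_pieces.

(** * Local boundedness of solutions; here [s] is [n - alpha], and [q] is the critical exponent *)

Section integral_equation.
Context (R : realType) (n : nat).
Notation T := (lebesgue_space R n).
Notation mu := (lebesgue_Rn R n).
Context (s : R) (u : T -> \bar R).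
Hypothesis n0 : (0 < n)%N.
Hypothesis s0 : 0 < s.
Hypothesis sn : s < n%:R.
Notation q := (2 * n%:R / s).
Notation p := (q - 1).
Hypothesis mu_ : measurable_fun [set: T] u.
Hypothesis u_gt0 : (forall x, 0 < u x)%E.
Hypothesis u_loc : forall r, (\int[mu]_(y in [set y : 'rV[R]_n | (`|y| <= r)%R]) (u y `^ q) < +oo)%E.
Notation ker := (fun x y => (enorm ((x : 'rV[R]_n) - y) `^ (- s))).
Hypothesis u_eq : (forall x : 'rV[R]_n, u x = \int[mu]_y (u y `^ p * (ker x y)%:E))%E.
Notation wt := (fun y : 'rV[R]_n => (1 + `|y|) `^ (- s)).

Let n_gt0 : 0 < n%:R :> R. Proof. by rewrite ltr0n. Qed.
Let q_gt2 : 2 < q.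
Proof. by rewrite ltr_pdivlMr// ltr_pM2l. Qed.
Let p_gt1 : 1 < p.
Proof. have := q_gt2; lra. Qed.

Let mup a : measurable_fun [set: T] (fun y => (u y `^ a)%E).
Proof. exact: measurableT_comp (measurable_poweR _) mu_. Qed.

Let mker x : measurable_fun [set: T] (fun y => (ker x y)%:E).
Proof. by apply/measurable_EFinP; exact: measurable_enorm_powRr. Qed.

Let mF x : measurable_fun [set: T] (fun y => u y `^ p * (ker x y)%:E)%E.
Proof. by apply: emeasurable_funM; [exact: mup|exact: mker]. Qed.

Let mball r : measurable ([set y : 'rV[R]_n | `|y| <= r] : set T).
Proof. exact: measurable_norm_le. Qed.

(** If [u] were infinite everywhere, finiteness of the local integrals would make every ball null,
    hence the whole space, and the equation would give [u 0 = 0]. *)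
Lemma exists_finite : exists x0, (u x0 < +oo)%E.
Proof.
apply/not_existsP => nfin.
have uy x : u x = +oo%E by apply/eqP; rewrite -leye_eq leNgt; exact/negP.
have ball0 r : mu [set y : 'rV[R]_n | `|y| <= r] = 0%E.
  have := u_loc r; rewrite (eq_integral (cst +oo%E)); last first.
    by move=> y _; rewrite uy poweRyr// gt_eqF// (lt_trans _ q_gt2).
  rewrite integral_cst; last exact: mball.
  have := measure_ge0 mu [set y : 'rV[R]_n | `|y| <= r].
  by rewrite le_eqVlt => /predU1P[->//|H]; rewrite (gt0_mulye H) ltxx.
have T0 : mu [set: T] = 0%E.
  apply/eqP; rewrite eq_le measure_ge0 andbT.
  have -> : [set: T] = \bigcup_m [set y : 'rV[R]_n | `|y| <= m%:R].
    apply/seteqP; split => // y _; exists (Num.truncn `|y|).+1 => //=.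
    by rewrite ltW// truncnS_gt.
  apply: (le_trans (outer_measure_sigma_subadditive _ _)).
  by rewrite eseries0// => i _ _; exact: ball0.
have := u_gt0 0; rewrite u_eq null_set_integral ?ltxx//.
Qed.

Let mw : measurable_fun [set: T] (fun y => (wt y)%:E).
Proof.
apply/measurable_EFinP; apply: (measurableT_comp (measurable_powR _)).
apply: measurable_funD; first exact: measurable_cst.
have := @measurable_normB R n 0.
by apply: eq_measurable_fun => y _; rewrite sub0r normrN.
Qed.

(** The equation at a point [x0] of finiteness bounds the integral, since
    [enorm (x0 - y) <= n (1 + |x0|) (1 + |y|)] makes the kernel dominate the weight up to the
    constant [c]. *)
Lemma weighted_integral_lty : (\int[mu]_y (u y `^ p * (wt y)%:E) < +oo)%E.
Proof.
have [x0 ux0] := exists_finite.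
pose c := (n%:R * (1 + `|x0 : 'rV[R]_n|)) `^ s.
have c0 : 0 <= c by exact: powR_ge0.
apply: (@le_lt_trans _ _ (c%:E * u x0)%E); last first.
  by rewrite lte_mul_pinfty ?lee_fin// .
rewrite (u_eq x0) -ge0_integralZl_EFin//; last first.
  by move=> y _; rewrite mule_ge0 ?poweR_ge0// lee_fin powR_ge0.
apply: ae_ge0_le_integral; first exact: measurableT.
- by move=> y _; rewrite mule_ge0 ?poweR_ge0// lee_fin powR_ge0.
- by apply: emeasurable_funM; [exact: mup|exact: mw].
- by move=> y _; rewrite !mule_ge0 ?poweR_ge0// lee_fin powR_ge0.
- by apply: emeasurable_funM; [exact: measurable_cst|exact: mF].
(* The comparison fails at [y = x0], where the kernel is [0] by convention, so it is only claimed
   off this null set. *)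
exists [set x0]; split; [|exact: lebesgue_Rn_set1|].
  have -> : [set x0] = ([set y : 'rV[R]_n | `|x0 - y| <= 0] : set T).
    apply/seteqP; split => y /= => [->|]; first by rewrite subrr normr0.
    by rewrite normr_le0 subr_eq0 => /eqP ->.
  rewrite (_ : [set y | _] = ~` [set y : 'rV[R]_n | 0 < `|(x0 : 'rV[R]_n) - y|]); last first.
    by apply/seteqP; split => y /=; [rewrite leNgt => /negP|move/negP; rewrite -leNgt].
  apply: measurableC; have := measurable_normB (x0 : 'rV[R]_n) measurableT (measurable_itv `]0, +oo[).
  by rewrite setTI; congr measurable; apply/seteqP; split => y /=; rewrite in_itv/= andbT.
move=> y /=; apply: contra_notP => /eqP yx0 _.
rewrite muleCA lee_wpmul2l ?poweR_ge0// -EFinM lee_fin.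
have z0 : 0 < `|(x0 : 'rV[R]_n) - y| by rewrite normr_gt0 subr_eq0 eq_sym.
have e0 : 0 < enorm ((x0 : 'rV[R]_n) - y) by rewrite (lt_le_trans z0)// norm_le_enorm.
have y1 : 0 < 1 + `|y : 'rV[R]_n| by rewrite ltr_pwDl.
have x1 : 0 < n%:R * (1 + `|x0 : 'rV[R]_n|) by rewrite mulr_gt0// ltr_pwDl.
rewrite /c !powRN ler_pdivlMr ?powR_gt0// mulrC ler_pdivrMr ?powR_gt0//.
rewrite -powRM ?(ltW x1) ?(ltW y1)//; apply: ge0_ler_powR; rewrite ?nnegrE ?mulr_ge0 ?(ltW s0) ?(ltW x1) ?(ltW y1) ?(ltW e0)//.
apply: (le_trans (enorm_le_norm _)); rewrite -mulrA ler_pM2l//.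
apply: (le_trans (ler_normB _ _)).
have := normr_ge0 (x0 : 'rV[R]_n); have := normr_ge0 (y : 'rV[R]_n); nra.
Qed.

(** [rho] and then [a] are chosen to turn the first two bounds into equalities. Criticality enters
    here: [(p - 1) n / (n - s) = q], so [rho^(-n)] is a multiple of [t^q], [a] one of [t^p] and
    [a^(1/p)] one of [t]; the third bound then fixes [e] independently of [t]. *)
Lemma level_constants (C1 C2 K : R) : 0 < C1 -> 0 < C2 -> 0 < K ->
  exists2 e, 0 < e & forall t, 0 < t -> exists rho a : R,
    [/\ 0 < rho, 0 < a, C1 * (K * t) `^ p * rho `^ (n%:R - s) <= t / 16,
        C2 * rho `^ (n%:R - 2 * n%:R) / a <= t / 16 & a `^ p^-1 * e <= t / 16].
Proof.
move=> C10 C20 K0; have pp : 0 < p by have := p_gt1; lra.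
have ns0 : 0 < n%:R - s by rewrite subr_gt0.
pose b := 16 * C1 * K `^ p; have b0 : 0 < b by rewrite !mulr_gt0 ?powR_gt0.
pose c := 16 * C2 * b `^ (n%:R / (n%:R - s)).
have c0 : 0 < c by rewrite !mulr_gt0 ?powR_gt0.
exists (16 * c `^ p^-1)^-1; first by rewrite invr_gt0 mulr_gt0 ?powR_gt0.
move=> t t0; have Kt0 : 0 < K * t by rewrite mulr_gt0.
pose rho := (b * t `^ (p - 1)) `^ (- (n%:R - s)^-1).
have bt0 : 0 < b * t `^ (p - 1) by rewrite mulr_gt0 ?powR_gt0.
exists rho, (c * t `^ p); split.
- by rewrite powR_gt0.
- by rewrite mulr_gt0 ?powR_gt0.
- rewrite /rho -powRrM mulNr mulVf ?gt_eqF// powR_inv1 ?(ltW bt0)//.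
  rewrite powRM ?(ltW K0) ?(ltW t0)// (@powRB _ t p 1); last by rewrite (gt_eqF t0) implybT.
  rewrite powRr1 ?(ltW t0)// /b le_eqVlt; apply/orP; left; apply/eqP.
  have := powR_gt0 p K0; have := powR_gt0 p t0; move: (K `^ p) (t `^ p) => x y x0 y0.
  by field; rewrite ?gt_eqF.
- have -> : rho `^ (n%:R - 2 * n%:R) = b `^ (n%:R / (n%:R - s)) * t `^ q.
    rewrite /rho -powRrM (_ : - _ * _ = n%:R / (n%:R - s)); last by field; rewrite gt_eqF.
    rewrite powRM ?(ltW b0) ?powR_ge0// -powRrM; congr (_ * t `^ _).
    by field; rewrite !gt_eqF.
  have -> : t `^ q = t `^ p * t.
    by rewrite -[q in LHS](subrK 1) powRDr// powRr1// ltW.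
  rewrite /c le_eqVlt; apply/orP; left; apply/eqP.
  have := powR_gt0 (n%:R / (n%:R - s)) b0; have := powR_gt0 p t0.
  move: (b `^ _) (t `^ p) => x y x0 y0.
  by field; rewrite ?gt_eqF.
- rewrite powRM ?(ltW c0) ?powR_ge0// -powRrM mulfV ?gt_eqF// powRr1 ?(ltW t0)//.
  rewrite le_eqVlt; apply/orP; left; apply/eqP.
  have := powR_gt0 p^-1 c0; move: (c `^ _) => x x0.
  by field; rewrite ?gt_eqF.
Qed.

(** Young's inequality with the conjugate exponents [q / p] and [q], the two factors being weighted
    by [a^(1/q)] and its inverse; the coefficients [p / q] and [1 / q] are bounded by [1]. *)
Lemma young_level (v k a : R) : 0 <= v -> 0 <= k -> 0 < a ->
  v `^ p * k <= a `^ p^-1 * v `^ q + a^-1 * k `^ q.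
Proof.
move=> v0 k0 a0; have pp : 0 < p by have := p_gt1; lra.
have qq : 0 < q by have := q_gt2; lra.
have b0 : 0 < a `^ q^-1 by rewrite powR_gt0.
have h : (q / p)^-1 + q^-1 = 1.
  have -> : (q / p)^-1 = p / q by rewrite invf_div.
  by rewrite mulrBl mulfV ?gt_eqF// mul1r subrK.
have := @conjugate_powR R (a `^ q^-1 * v `^ p) ((a `^ q^-1)^-1 * k) (q / p) q.
move=> /(_ (mulr_ge0 (powR_ge0 _ _) (powR_ge0 _ _))).
have -> : a `^ q^-1 * v `^ p * ((a `^ q^-1)^-1 * k) = v `^ p * k.
  by rewrite mulrACA mulfV ?gt_eqF// mul1r.
move=> /(_ (mulr_ge0 (ltW _) k0)) H; apply: (le_trans (H _ _ qq h)).
- by rewrite invr_gt0.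
- by rewrite divr_gt0.
apply: lerD.
  have qp0 : 0 < q / p by rewrite divr_gt0.
  rewrite ler_pdivrMr//. rewrite (powRM _ (powR_ge0 _ _) (powR_ge0 _ _)) -!powRrM.
  have -> : q^-1 * (q / p) = p^-1 by rewrite mulrA mulVf ?gt_eqF// mul1r.
  have -> : p * (q / p) = q by rewrite mulrCA mulfV ?gt_eqF// mulr1.
  rewrite ler_peMr ?mulr_ge0 ?powR_ge0// ler_pdivlMr// mul1r.
  by rewrite lerBlDr lerDl.
rewrite ler_pdivrMr// -powRN powRM ?powR_ge0// -powRrM mulNr mulVf ?gt_eqF//.
rewrite powR_inv1 ?(ltW a0)// ler_peMr ?mulr_ge0 ?powR_ge0 ?invr_ge0 ?(ltW a0)//.
by have := q_gt2; lra.
Qed.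

Let mU a : measurable ([set y | (a%:E < u y)%E] : set T).
Proof.
have := emeasurable_fun_o_infty measurableT mu_ a%:E.
by rewrite setTI.
Qed.

Let F_ge0 x y : (0 <= u y `^ p * (ker x y)%:E)%E.
Proof. by rewrite mule_ge0 ?poweR_ge0// lee_fin powR_ge0. Qed.

Let mriesz (x : 'rV[R]_n) a b : measurable_fun [set: T] (fun y : T => (a * `|x - y| `^ b)%:E).
Proof.
apply/measurable_EFinP; apply: measurable_funM; first exact: measurable_cst.
exact: measurable_normB_powR.
Qed.

(** It suffices that [d (1 + |y|) <= (2 + r1) (|y| - r1)]: at [|y| = r1 + d] this is [d <= 1], and
    the right side grows faster in [|y|]. *)
Lemma ker_far (r1 d : R) (x y : 'rV[R]_n) : 0 <= r1 -> 0 < d -> d <= 1 ->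
  `|x| <= r1 -> r1 + d < `|y| -> ker x y <= (d / (2 + r1)) `^ (- s) * wt y.
Proof.
move=> r10 d0 d1 xr yr; apply: (le_trans (enorm_powRN_le _ s0)).
have y1 : 0 < 1 + `|y| by rewrite ltr_pwDl.
have e0 : 0 < d / (2 + r1) by rewrite divr_gt0// ltr_pwDl.
rewrite -powRM ?(ltW y1) ?(ltW e0)//.
apply: ler_powRN; first exact: ltW.
  by rewrite mulr_gt0.
rewrite mulrAC ler_pdivrMr ?ltr_pwDl//.
have := lerB_dist y x; rewrite distrC => H.
have : `|y| - r1 <= `|x - y| by apply: le_trans H; rewrite lerB.
nra.
Qed.

Notation W := (\int[mu]_y (u y `^ p * (wt y)%:E))%E.
Notation hi r1 t := (([set y : 'rV[R]_n | `|y| <= r1] : set T) `&` ([set y | (t%:E < u y)%E] : set T)).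

Let mhi r1 t : measurable (hi r1 t : set T).
Proof. by apply: measurableI; [exact: mball|exact: mU]. Qed.

(** The high set [u > K t] is kept; the rest splits into the outside of the ball, the part
    [u <= tau], and the intermediate levels near to and far from [x]. Near [x] the bound [u <= K t]
    is used. Far from [x] Young's inequality separates [u^q], of small mass, from the kernel to the
    power [q], which is [|x - y|^(-2n)] and integrable at infinity. *)
Lemma level_split (C1 C2 K e r1 d tau t rho a r0 : R) (x : 'rV[R]_n) :
  (forall (x : 'rV[R]_n) r, 0 < r ->
    (\int[mu]_(y in [set y : 'rV[R]_n | (`|x - y| < r)%R]) (`|x - y| `^ (- s))%:E
      <= (C1 * r `^ (n%:R - s))%:E)%E) ->
  (forall (x : 'rV[R]_n) r, 0 < r ->
    (\int[mu]_(y in [set y : 'rV[R]_n | (r <= `|x - y|)%R])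
      (`|x - y| `^ (- (2 * n%:R)))%:E <= (C2 * r `^ (n%:R - 2 * n%:R))%:E)%E) ->
  0 <= r1 -> 0 < d -> d <= 1 -> r1 + d <= r0 -> `|x| <= r1 ->
  0 < t -> 0 < K -> 0 <= tau -> 0 < rho -> 0 < a ->
  (((d / (2 + r1)) `^ (- s))%:E * W <= (t / 16)%:E)%E ->
  C1 * tau `^ p * (2 * r0 + 1) `^ (n%:R - s) <= t / 16 ->
  C1 * (K * t) `^ p * rho `^ (n%:R - s) <= t / 16 ->
  C2 * rho `^ (n%:R - 2 * n%:R) / a <= t / 16 ->
  a `^ p^-1 * e <= t / 16 ->
  (\int[mu]_(y in hi r0 tau) (u y `^ q) <= e%:E)%E ->
  (u x <= (t / 2)%:E +
     \int[mu]_(y in hi (r1 + d)%R (K * t)%R) (u y `^ p * (ker x y)%:E))%E.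
Proof.
move=> near far r10 d0 d1 rr0 xr1 t0 K0 tau0 rho0 a0 ha hc hd he2 he1 hG.
have pp : 0 < p by have := p_gt1; lra.
have qq : 0 < q by have := q_gt2; lra.
have Kt0 : 0 < K * t by rewrite mulr_gt0.
pose F y := (u y `^ p * (ker x y)%:E)%E.
have mFx : measurable_fun [set: T] F by exact: mF.
have F0 y : (0 <= F y)%E by exact: F_ge0.
have kle y : ker x y <= `|x - y| `^ (- s) by exact: enorm_powRN_le.
have FM (c : R) y : 0 <= c -> (u y <= c%:E)%E ->
    (F y <= (c `^ p * `|x - y| `^ (- s))%:E)%E.
  move=> c0 uc; rewrite EFinM; apply: lee_pmul; rewrite ?poweR_ge0 ?lee_fin ?powR_ge0//.
  rewrite -poweR_EFin; apply: gt0_ler_poweR => //; first exact: ltW.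
    by rewrite in_itv/= leey andbT ltW.
  by rewrite in_itv/= leey andbT lee_fin.
pose B : set T := [set y : 'rV[R]_n | `|y| <= r1 + d].
have mB : measurable B by exact: mball.
pose N : set T := [set y : 'rV[R]_n | `|x - y| < rho].
have mN : measurable N by exact: measurable_ball_Rn.
pose U : set T := [set y | ((K * t)%:E < u y)%E].
have mUKt : measurable U by exact: mU.
pose V : set T := [set y | (tau%:E < u y)%E].
have mV : measurable V by exact: mU.
have mCU := measurableC mUKt; have mCV := measurableC mV.
have mCN := measurableC mN; have mCB := measurableC mB.
have mBU := measurableI _ _ mB mCU.
have mBUV := measurableI _ _ mBU mV.
have r00 : 0 < 2 * r0 + 1 by lra.
have uN y (c : R) : ~ (c%:E < u y)%E -> (u y <= c%:E)%E.
  by move=> /negP; rewrite -leNgt.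
rewrite {1}(u_eq x) (@ge0_integral_setID _ _ _ mu setT B F measurableT mB mFx F0) !setTI.
rewrite (@ge0_integral_setID _ _ _ mu B U F mB mUKt mFx F0).
rewrite -addeA addeC leeD//.
(* Young's inequality produces two terms, so there are five contributions of size [t / 16]; three of
   the eight available are spare. *)
have -> : t / 2 = t / 16 + (t / 16 + (t / 16 + (t / 16 + t / 16))) + 3 * (t / 16) by field.
rewrite addeC; apply: (@le_trans _ _ ((t / 16 + (t / 16 + (t / 16 + (t / 16 + t / 16)))))%:E); last first.
  by rewrite lee_fin lerDl mulr_ge0// divr_ge0// ltW.
rewrite EFinD leeD//.
  apply: le_trans ha; rewrite -ge0_integralZl_EFin; last 4 first.
  - exact: measurableT.
  - by move=> y _; rewrite mule_ge0 ?poweR_ge0// lee_fin powR_ge0.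
  - by apply: emeasurable_funM; [exact: mup|exact: mw].
  - exact: powR_ge0.
  apply: ge0_le_integral_subset; [exact: mCB|exact: measurableT|by []|exact: mFx| |exact: F0| | ].
  - by apply: emeasurable_funM; [exact: measurable_cst|apply: emeasurable_funM; [exact: mup|exact: mw]].
  - by move=> y; rewrite !mule_ge0 ?poweR_ge0// lee_fin powR_ge0.
  move=> y /= /negP; rewrite -ltNge => yr; rewrite /F muleCA lee_wpmul2l ?poweR_ge0//.
  by rewrite -EFinM lee_fin; exact: ker_far.
rewrite (@ge0_integral_setID _ _ _ mu _ V F mBU mV mFx F0) addeC EFinD leeD//.
  have tt : 0 <= tau `^ p by exact: powR_ge0.
  apply: (@le_trans _ _ (\int[mu]_(y in [set y : 'rV[R]_n | (`|x - y| < 2 * r0 + 1)%R]) ((tau `^ p * `|x - y| `^ (- s))%:E))%E).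
    apply: ge0_le_integral_subset; [exact: measurableI|exact: measurable_ball_Rn| |exact: mFx|exact: mriesz|exact: F0| | ].
    - move=> y [[/= yB _] _]; apply: (le_lt_trans (ler_normB _ _)).
      apply: (le_lt_trans (lerD xr1 yB)); lra.
    - by move=> y; rewrite lee_fin mulr_ge0 ?powR_ge0.
    - by move=> y [_ /uN uy]; exact: FM.
  under eq_integral do rewrite EFinM.
  rewrite ge0_integralZl_EFin; last 4 first.
  - exact: measurable_ball_Rn.
  - by move=> y _; rewrite lee_fin powR_ge0.
  - by apply: measurable_funTS; apply/measurable_EFinP; exact: measurable_normB_powR.
  - exact: tt.
  apply: (@le_trans _ _ ((tau `^ p)%:E * (C1 * (2 * r0 + 1) `^ (n%:R - s))%:E)%E).
    by rewrite lee_wpmul2l ?lee_fin//; exact: near.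
  by rewrite -EFinM lee_fin mulrCA mulrA.
rewrite (@ge0_integral_setID _ _ _ mu _ N F mBUV mN mFx F0) EFinD leeD//.
  have tt : 0 <= (K * t) `^ p by exact: powR_ge0.
  apply: (@le_trans _ _ (\int[mu]_(y in [set y : 'rV[R]_n | (`|x - y| < rho)%R]) (((K * t) `^ p * `|x - y| `^ (- s))%:E))%E).
    apply: ge0_le_integral_subset; [exact: measurableI|exact: mN| |exact: mFx|exact: mriesz|exact: F0| | ].
    - by move=> y [].
    - by move=> y; rewrite lee_fin mulr_ge0 ?powR_ge0.
    - by move=> y [[[_ /uN uy] _] _]; apply: FM => //; exact: ltW.
  under eq_integral do rewrite EFinM.
  rewrite ge0_integralZl_EFin; last 4 first.
  - exact: mN.
  - by move=> y _; rewrite lee_fin powR_ge0.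
  - by apply: measurable_funTS; apply/measurable_EFinP; exact: measurable_normB_powR.
  - exact: tt.
  apply: (@le_trans _ _ (((K * t) `^ p)%:E * (C1 * rho `^ (n%:R - s))%:E)%E).
    by rewrite lee_wpmul2l ?lee_fin//; exact: near.
  by rewrite -EFinM lee_fin mulrCA mulrA.
have ap0 : 0 <= a `^ p^-1 by exact: powR_ge0.
have ai0 : 0 <= a^-1 by rewrite invr_ge0 ltW.
have mfar : measurable ([set y : 'rV[R]_n | rho <= `|x - y|] : set T).
  rewrite (_ : [set y | _] = ~` N); first exact: mCN.
  by apply/seteqP; split => y /=; [rewrite leNgt => /negP|move/negP; rewrite -leNgt].
pose G1 y : \bar R := ((a `^ p^-1)%:E * u y `^ q)%E.
pose G2 y : \bar R := (a^-1 * `|x - (y : 'rV[R]_n)| `^ (- (2 * n%:R)))%:E.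
have mG1 : measurable_fun [set: T] G1.
  by apply: emeasurable_funM; [exact: measurable_cst|exact: mup].
have mG2 : measurable_fun [set: T] G2 by exact: mriesz.
have G10 y : (0 <= G1 y)%E by rewrite mule_ge0 ?poweR_ge0.
have G20 y : (0 <= G2 y)%E by rewrite lee_fin mulr_ge0 ?powR_ge0.
have mD := measurableI _ _ mBUV mCN.
apply: (@le_trans _ _ (\int[mu]_(y in (B `&` ~` U `&` V) `&` ~` N) (G1 y + G2 y))%E).
  apply: ge0_le_integral_subset; [exact: mD|exact: mD|by []|exact: mFx| |exact: F0| |].
  - exact: emeasurable_funD.
  - by move=> y; rewrite adde_ge0.
  move=> y [[[_ /uN uy] _] yN].
  have [v uv] : exists v, u y = v%:E.
    by exists (fine (u y)); rewrite fineK// ge0_fin_numE ?(ltW (u_gt0 y))// (le_lt_trans uy)// ltry.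
  have v0 : 0 <= v by rewrite -lee_fin -uv ltW.
  rewrite /F /G1 /G2 uv !poweR_EFin -!EFinM -EFinD lee_fin.
  apply: (le_trans (ler_wpM2l (powR_ge0 _ _) (kle y))).
  apply: (le_trans (young_level v0 (powR_ge0 _ _) a0)).
  rewrite lerD2l -powRrM (_ : - s * q = - (2 * n%:R))//.
  by field; rewrite gt_eqF.
rewrite ge0_integralD; last 5 first.
- exact: mD.
- by move=> y _; exact: G10.
- exact: measurable_funTS mG1.
- by move=> y _; exact: G20.
- exact: measurable_funTS mG2.
rewrite addeC EFinD leeD//.
  apply: (@le_trans _ _ (\int[mu]_(y in [set y : 'rV[R]_n | (rho <= `|x - y|)%R]) (G2 y))%E).
    apply: ge0_le_integral_subset; [exact: mD|exact: mfar| |exact: mG2|exact: mG2|exact: G20|exact: G20|by []].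
    by move=> y [_ /= /negP]; rewrite -leNgt.
  rewrite /G2; under eq_integral do rewrite EFinM.
  rewrite ge0_integralZl_EFin; last 4 first.
  - exact: mfar.
  - by move=> y _; rewrite lee_fin powR_ge0.
  - by apply: measurable_funTS; apply/measurable_EFinP; exact: measurable_normB_powR.
  - exact: ai0.
  apply: (@le_trans _ _ ((a^-1)%:E * (C2 * rho `^ (n%:R - 2 * n%:R))%:E)%E).
    by rewrite lee_wpmul2l ?lee_fin//; exact: far.
  by rewrite -EFinM lee_fin mulrC.
apply: (@le_trans _ _ (\int[mu]_(y in hi r0 tau) (G1 y))%E).
  apply: ge0_le_integral_subset; [exact: mD|exact: mhi| |exact: mG1|exact: mG1|exact: G10|exact: G10|by []].
  by move=> y [[[/= yB _] yV] _]; split => //=; exact: le_trans yB rr0.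
rewrite /G1 ge0_integralZl_EFin; last 4 first.
- exact: mhi.
- by move=> y _; exact: poweR_ge0.
- exact: measurable_funTS (mup _).
- exact: ap0.
apply: (@le_trans _ _ ((a `^ p^-1)%:E * e%:E)%E).
  by rewrite lee_wpmul2l ?lee_fin.
by rewrite -EFinM lee_fin.
Qed.

(** Dominated convergence with majorant [u^q]: its integrability makes [u] finite almost everywhere,
    and at such a point the truncations to [u > m] vanish for large [m]. *)
Lemma tail_integral_small r e : 0 < e ->
  exists2 tau, 0 <= tau & (\int[mu]_(y in hi r tau) (u y `^ q) <= e%:E)%E.
Proof.
move=> e0; have qq : 0 < q by have := q_gt2; lra.
pose D : set T := [set y : 'rV[R]_n | `|y| <= r].
have mD : measurable D by exact: mball.
pose f m : T -> \bar R := (fun y => (u y `^ q)%E) \_ [set y | (m%:R%:E < u y)%E].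
have iq : mu.-integrable D (fun y => (u y `^ q)%E).
  apply/integrableP; split; first exact: measurable_funTS (mup _).
  under eq_integral do rewrite gee0_abs ?poweR_ge0//.
  exact: u_loc.
have [|||||_ _] := @dominated_convergence _ T R mu D mD f (cst 0%E) (fun y => (u y `^ q)%E).
- move=> m; apply: measurable_funTS; apply/(measurable_restrictT _ (mU _)).
  exact: measurable_funTS (mup _).
- exact: measurable_cst.
- apply: filterS (integrable_ae mD iq) => y fy Dy.
  have [v uv] : exists v, u y = v%:E.
    exists (fine (u y)); rewrite fineK// ge0_fin_numE ?(ltW (u_gt0 y))//.
    apply: (@lty_poweRy _ _ q); first by rewrite gt_eqF.
    by rewrite -ge0_fin_numE ?poweR_ge0// fy.
  apply: cvg_near_cst; exists (Num.truncn v).+1 => // m /= vm.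
  rewrite /f patchE; case: ifPn => //; rewrite inE /= uv lte_fin => mv.
  have := truncnS_gt v; have : (Num.truncn v).+1%:R <= m%:R :> R by rewrite ler_nat.
  by move=> /le_trans /(_ (ltW mv)) /le_lt_trans h /h; rewrite ltxx.
- exact: iq.
- apply: aeW => y m Dy; rewrite /f patchE; case: ifPn => _.
    by rewrite gee0_abs// poweR_ge0.
  by rewrite abse0 poweR_ge0.
rewrite integral0 => H.
have := H [set x | (x < e%:E)%E].
move=> /(_ _)[]; first by apply: open_nbhs_nbhs; split; [exact: open_ereal_lt_ereal|rewrite /= lte_fin].
move=> m _ /(_ m (leqnn m)) /= Hm; exists m%:R => //.
by rewrite integral_mkcondr; exact: ltW.
Qed.

Lemma ge0_integral_indic (D : set T) (f : T -> \bar R) :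
  (\int[mu]_(x in D) f x = \int[mu]_x ((\1_D x)%:E * f x))%E.
Proof.
rewrite integral_mkcond; apply: eq_integral => x _; rewrite patchE indicE.
by case: ifPn => _; rewrite ?mul1e ?mul0e.
Qed.

(** A substitute for rearrangement: cut [E] at the radius [rho = m^(1/n)] of a ball of comparable
    measure. Inside, the Riesz integral applies; outside, the kernel is at most [rho^(-s)] and [E]
    has measure [m]. *)
Lemma ker_mass (C1 : R) (E : set T) (m : R) (y : 'rV[R]_n) :
  (forall (x : 'rV[R]_n) r, 0 < r ->
    (\int[mu]_(y in [set y : 'rV[R]_n | (`|x - y| < r)%R]) (`|x - y| `^ (- s))%:E
      <= (C1 * r `^ (n%:R - s))%:E)%E) -> 0 < C1 ->
  measurable E -> 0 <= m -> mu E = m%:E ->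
  (\int[mu]_(x in E) (ker x y)%:E <= ((C1 + 1) * m `^ ((n%:R - s) / n%:R))%:E)%E.
Proof.
move=> near C10 mE m0 muE.
have kE x : ker x y = ker y x by rewrite -enormN opprB.
have mk : measurable_fun [set: T] (fun x => (ker x y)%:E).
  by under eq_fun do rewrite kE; exact: mker.
have k0 x : (0 <= (ker x y)%:E)%E by rewrite lee_fin powR_ge0.
move: m0; rewrite le_eqVlt => /predU1P[m0|m0].
  rewrite (_ : (\int[mu]_(x in E) _)%E = 0%E).
    by rewrite lee_fin mulr_ge0 ?powR_ge0// addr_ge0// ltW.
  apply: null_set_integral; [exact: mE|exact: measurable_funTS mk|].
  by rewrite [LHS]muE -m0.
pose rho := m `^ n%:R^-1.
have rho0 : 0 < rho by rewrite powR_gt0.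
pose N : set T := [set x : 'rV[R]_n | `|y - x| < rho].
have mN : measurable N by exact: measurable_ball_Rn.
rewrite (ge0_integral_setID mu mE mN mk k0).
have -> : (C1 + 1) * m `^ ((n%:R - s) / n%:R) = C1 * rho `^ (n%:R - s) + rho `^ (- s) * m.
  have -> : rho `^ (n%:R - s) = m `^ ((n%:R - s) / n%:R) by rewrite /rho -powRrM mulrC.
  rewrite mulrDl mul1r; congr (_ + _).
  rewrite /rho -powRrM (_ : (n%:R - s) / n%:R = n%:R^-1 * - s + 1).
    by rewrite powRDr// powRr1// ltW.
  by field; rewrite gt_eqF.
rewrite EFinD leeD//.
  apply: le_trans (near y rho rho0).
  apply: ge0_le_integral_subset; [exact: measurableI|exact: mN|by move=> x []|exact: mk| |exact: k0| |].
  - by apply/measurable_EFinP; exact: measurable_normB_powR.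
  - by move=> x; rewrite lee_fin powR_ge0.
  - by move=> x _; rewrite lee_fin kE enorm_powRN_le.
rewrite EFinM -muE -integral_cst//.
apply: ge0_le_integral_subset; [|exact: mE|by move=> x []|exact: mk|exact: measurable_cst|exact: k0| |].
- by apply: measurableI => //; exact: measurableC.
- by move=> x; rewrite lee_fin powR_ge0.
move=> x [_ /= /negP]; rewrite -leNgt => yx; rewrite lee_fin kE.
by apply: (le_trans (enorm_powRN_le _ s0)); apply: ler_powRN => //; exact: ltW.
Qed.

(** Tonelli, after the two domains have been turned into indicator functions. *)
Lemma integral_ker_swap (E E' : set T) : measurable E -> measurable E' ->
  (\int[mu]_(x in E) \int[mu]_(y in E') (u y `^ p * (ker x y)%:E) =
   \int[mu]_(y in E') (u y `^ p * \int[mu]_(x in E) (ker x y)%:E))%E.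
Proof.
move=> mE mE'.
pose f (xy : T * T) := ((\1_E xy.1)%:E *
  ((\1_E' xy.2)%:E * (u xy.2 `^ p * (ker xy.1 xy.2)%:E)))%E.
have f0 xy : (0 <= f xy)%E.
  by rewrite !mule_ge0 ?poweR_ge0// lee_fin powR_ge0.
have mf : measurable_fun [set: T * T] f.
  apply: emeasurable_funM.
    apply/measurable_EFinP.
    exact: (measurableT_comp (measurable_indic mE) measurable_fst).
  apply: emeasurable_funM.
    apply/measurable_EFinP.
    exact: (measurableT_comp (measurable_indic mE') measurable_snd).
  apply: emeasurable_funM; first exact: (measurableT_comp (mup p) measurable_snd).
  by apply/measurable_EFinP; exact: measurable_enorm_powR.
have mk y : measurable_fun [set: T] (fun x => (ker x y)%:E).
  have kE x : ker x y = ker y x by rewrite -enormN opprB.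
  by under eq_fun do rewrite kE; exact: mker.
transitivity (\int[mu]_x \int[mu]_y f (x, y))%E.
  rewrite ge0_integral_indic; apply: eq_integral => x _.
  rewrite [X in (_ * X)%E]ge0_integral_indic -ge0_integralZl_EFin; last 4 first.
  - exact: measurableT.
  - by move=> y _; rewrite !mule_ge0 ?poweR_ge0// lee_fin powR_ge0.
  - by apply: emeasurable_funM; [apply/measurable_EFinP; exact: measurable_indic|exact: mF].
  - by rewrite indicE.
  by [].
rewrite (@fubini_tonelli _ _ T T R mu mu f mf f0).
rewrite [RHS]ge0_integral_indic; apply: eq_integral => y _.
have m1 : measurable_fun [set: T] (fun x => ((\1_E x)%:E * (ker x y)%:E)%E).
  by apply: emeasurable_funM; [apply/measurable_EFinP; exact: measurable_indic|exact: mk].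
have p1 x : (0 <= (\1_E x)%:E * (ker x y)%:E)%E.
  by rewrite mule_ge0// lee_fin powR_ge0.
rewrite [X in (_ * (_ * X))%E]ge0_integral_indic -(ge0_integralZl mu measurableT m1 (fun x _ => p1 x)); last first.
  exact: poweR_ge0.
rewrite -ge0_integralZl_EFin; last 4 first.
- exact: measurableT.
- by move=> x _; rewrite mule_ge0 ?poweR_ge0.
- by apply: emeasurable_funM; [exact: measurable_cst|exact: m1].
- by rewrite indicE.
by apply: eq_integral => x _; rewrite /f /= muleCA; congr (_ * _)%E; rewrite muleCA.
Qed.

(** A weak-type estimate for the potential: integrating the lower bound over [E] and exchanging the
    integrals gives [(t/2) m <= (C1 + 1) m^((n-s)/n) y], and a power of [m] is divided out. *)
Lemma level_step (C1 t m y : R) (E E' : set T) :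
  (forall (x : 'rV[R]_n) r, 0 < r ->
    (\int[mu]_(y in [set y : 'rV[R]_n | (`|x - y| < r)%R]) (`|x - y| `^ (- s))%:E
      <= (C1 * r `^ (n%:R - s))%:E)%E) -> 0 < C1 ->
  measurable E -> measurable E' -> 0 < t -> 0 <= m -> mu E = m%:E ->
  0 <= y -> (\int[mu]_(y in E') (u y `^ p) = y%:E)%E ->
  (forall x, E x -> ((t / 2)%:E <= \int[mu]_(y in E') (u y `^ p * (ker x y)%:E))%E) ->
  m `^ (s / n%:R) * t <= 2 * (C1 + 1) * y.
Proof.
move=> near C10 mE mE' t0 m0 muE y0 yE EH.
have pE0 : 0 <= 2 * (C1 + 1) * y by rewrite !mulr_ge0// addr_ge0// ltW.
move: m0; rewrite le_eqVlt => /predU1P[m0|m0].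
  by rewrite -m0 powR0 ?mul0r// gt_eqF// divr_gt0.
have mH : measurable_fun [set: T]
    (fun x => \int[mu]_(y in E') (u y `^ p * (ker x y)%:E))%E.
  under eq_fun do rewrite ge0_integral_indic.
  apply: (@measurable_fun_fubini_tonelli_F _ _ T T R mu
    (fun xy => ((\1_E' xy.2)%:E * (u xy.2 `^ p * (ker xy.1 xy.2)%:E))%E)) => [|xy]; last first.
    by rewrite !mule_ge0 ?poweR_ge0// lee_fin powR_ge0.
  apply: emeasurable_funM.
    apply/measurable_EFinP.
    exact: (measurableT_comp (measurable_indic mE') measurable_snd).
  apply: emeasurable_funM; first exact: (measurableT_comp (mup p) measurable_snd).
  by apply/measurable_EFinP; exact: measurable_enorm_powR.
have H0 x : (0 <= \int[mu]_(y in E') (u y `^ p * (ker x y)%:E))%E.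
  by apply: integral_ge0 => z _; exact: F_ge0.
have c0 : 0 <= (C1 + 1) * m `^ ((n%:R - s) / n%:R).
  by rewrite mulr_ge0 ?powR_ge0// addr_ge0// ltW.
have : ((t / 2 * m)%:E <= ((C1 + 1) * m `^ ((n%:R - s) / n%:R) * y)%:E)%E.
  rewrite EFinM -muE -integral_cst//.
  apply: (@le_trans _ _ (\int[mu]_(x in E) \int[mu]_(y in E') (u y `^ p * (ker x y)%:E))%E).
    apply: ge0_le_integral_subset; [exact: mE|exact: mE|by []|exact: measurable_cst|exact: mH| |exact: H0|exact: EH].
    by move=> x; rewrite lee_fin divr_ge0// ltW.
  rewrite integral_ker_swap// EFinM -yE -ge0_integralZl_EFin; last 4 first.
  - exact: mE'.
  - by move=> z _; exact: poweR_ge0.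
  - exact: measurable_funTS (mup p).
  - exact: c0.
  have mM : measurable_fun [set: T] (fun z => \int[mu]_(x in E) (ker x z)%:E)%E.
    under eq_fun do rewrite ge0_integral_indic.
    apply: (@measurable_fun_fubini_tonelli_G _ _ T T R mu
      (fun xy => ((\1_E xy.1)%:E * (ker xy.1 xy.2)%:E)%E)) => [|xy]; last first.
      by rewrite !mule_ge0// lee_fin powR_ge0.
    apply: emeasurable_funM.
      apply/measurable_EFinP.
      exact: (measurableT_comp (measurable_indic mE) measurable_fst).
    by apply/measurable_EFinP; exact: measurable_enorm_powR.
  apply: ge0_le_integral_subset; [exact: mE'|exact: mE'|by []| | | | | ].
  - by apply: emeasurable_funM; [exact: mup|exact: mM].
  - by apply: emeasurable_funM; [exact: measurable_cst|exact: mup].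
  - move=> z; rewrite mule_ge0 ?poweR_ge0//.
    by apply: integral_ge0 => x _; rewrite lee_fin powR_ge0.
  - by move=> z; rewrite mule_ge0 ?poweR_ge0.
  - move=> z _; rewrite muleC lee_wpmul2r ?poweR_ge0//.
    exact: ker_mass near C10 mE (ltW m0) muE.
rewrite lee_fin => H.
have mm : m = m `^ (s / n%:R) * m `^ ((n%:R - s) / n%:R).
  rewrite -powRDr// (_ : _ + _ = 1) ?powRr1 ?(ltW m0)//.
  by field; rewrite gt_eqF.
move: H; rewrite {1}mm mulrA [X in _ <= X]mulrAC ler_pM2r ?powR_gt0//.
move: (m `^ (s / n%:R)) => z; nra.
Qed.

(** With [z = K t y'] the bound on [m] becomes a constant times [z^(n/s) t^(-q)]. Since [1 + p = q],
    the powers of [t] cancel in [t (K t)^p m], and the surplus factor [z^(n/s - 1)] is small because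
    [z <= e]: this term is at most [z/4]. The other one, [t y'], is at most [z/2] because
    [K >= 2]. *)
Lemma decay_algebra (C5 K e t m y y' : R) :
  0 <= C5 -> 2 <= K -> 0 < t -> 0 <= m -> 0 <= y' ->
  m `^ (s / n%:R) * t <= C5 * y' -> y <= (K * t) `^ p * m + y' ->
  K * t * y' <= e -> K `^ p * (C5 / K) `^ (n%:R / s) * e `^ (n%:R / s - 1) <= 4^-1 ->
  t * y <= 3 / 4 * (K * t * y').
Proof.
move=> C50 K2 t0 m0 y'0 Hm Hy He Hc.
have K0 : 0 < K by lra.
pose z := K * t * y'; have z0 : 0 <= z by rewrite !mulr_ge0// ltW.
have k1 : 0 < n%:R / s - 1 by rewrite subr_gt0 ltr_pdivlMr// mul1r.
have CK0 : 0 <= C5 / K by rewrite divr_ge0// ltW.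
have mz : m <= (C5 / K) `^ (n%:R / s) * (z `^ (n%:R / s - 1) * z) * t `^ (- q).
  have -> : m = (m `^ (s / n%:R)) `^ (n%:R / s).
    by rewrite -powRrM mulrA divfK ?gt_eqF// mulfV ?gt_eqF// powRr1.
  have -> : z `^ (n%:R / s - 1) * z = z `^ (n%:R / s).
    by rewrite mulrC mulr_powRB1// divr_gt0.
  have -> : t `^ (- q) = (t `^ (- 2)) `^ (n%:R / s).
    by rewrite -powRrM; congr powR; ring.
  rewrite -!powRM ?mulr_ge0 ?powR_ge0 ?invr_ge0 ?(ltW K0) ?(ltW t0)//.
  have ks0 : 0 <= n%:R / s by rewrite divr_ge0// ltW.
  apply: (ge0_ler_powR ks0); rewrite ?nnegrE ?mulr_ge0 ?powR_ge0 ?invr_ge0 ?(ltW K0) ?(ltW t0)//.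
  rewrite powR_invn ?(ltW t0)// -ler_pdivlMr// in Hm *.
  apply: (le_trans Hm); rewrite le_eqVlt; apply/orP; left; apply/eqP.
  by rewrite /z; field; rewrite !gt_eqF.
have zc : K `^ p * ((C5 / K) `^ (n%:R / s) * z `^ (n%:R / s - 1)) <= 4^-1.
  apply: le_trans Hc; rewrite mulrA ler_wpM2l ?mulr_ge0 ?powR_ge0//.
  by apply: ge0_ler_powR; rewrite ?nnegrE ?(ltW k1)// (le_trans z0).
have tp : t * ((K * t) `^ p * m) <= 4^-1 * z.
  have tq : t * t `^ p * t `^ (- q) = 1.
    by rewrite mulr_powRB1 ?(ltW t0)//; [rewrite -powRDr// subrr powRr0|rewrite (lt_trans _ q_gt2)].
  apply: (@le_trans _ _ (t * ((K * t) `^ p * ((C5 / K) `^ (n%:R / s) * (z `^ (n%:R / s - 1) * z) * t `^ (- q))))).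
    by rewrite ler_pM2l//; apply: ler_wpM2l; [exact: powR_ge0|exact: mz].
  rewrite powRM ?(ltW K0) ?(ltW t0)//.
  rewrite (_ : _ * _ = t * t `^ p * t `^ (- q) * (K `^ p * ((C5 / K) `^ (n%:R / s) * z `^ (n%:R / s - 1)) * z)); last by ring.
  by rewrite tq mul1r ler_wpM2r.
have ty' : t * y' <= z / 2.
  have : 0 <= (K - 2) * (t * y') by rewrite !mulr_ge0 ?(ltW t0)// subr_ge0.
  rewrite /z; lra.
have : t * y <= t * ((K * t) `^ p * m + y') by rewrite ler_pM2l.
rewrite mulrDr -/z; lra.
Qed.

(** On the level set [t u^p <= u^q], because [q = p + 1]; points where [u] is infinite are
    allowed. *)
Lemma chebyshev_level (r t e : R) (D : set T) : 0 < t -> measurable D ->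
  hi r t `<=` D -> (\int[mu]_(y in D) (u y `^ q) <= e%:E)%E ->
  (t%:E * \int[mu]_(y in hi r t) (u y `^ p) <= e%:E)%E.
Proof.
move=> t0 mD hD De; apply: le_trans De.
rewrite -ge0_integralZl_EFin; last 4 first.
- exact: mhi.
- by move=> y _; exact: poweR_ge0.
- exact: measurable_funTS (mup p).
- exact: ltW.
apply: ge0_le_integral_subset; [exact: mhi|exact: mD|exact: hD| |exact: mup| | |].
- by apply: emeasurable_funM; [exact: measurable_cst|exact: mup].
- by move=> y; rewrite mule_ge0 ?poweR_ge0// lee_fin ltW.
- by move=> y; exact: poweR_ge0.
move=> y [_ /=]; have := u_gt0 y; case: (u y) => [v v0 tv| |]//.
  rewrite !poweR_EFin -EFinM lee_fin -(@mulr_powRB1 _ v q); last 2 first.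
  - exact: ltW.
  - by rewrite (lt_trans _ q_gt2).
  by rewrite ler_wpM2r ?powR_ge0// ltW.
move=> _ _; rewrite [leRHS]poweRyr ?leey//.
by rewrite gt_eqF// (lt_trans _ q_gt2).
Qed.

Lemma mass_hi_fin r t : mu (hi r t) \is a fin_num.
Proof.
rewrite ge0_fin_numE ?measure_ge0//.
have r1 : 0 < `|r| + 1 by rewrite ltr_wpDl.
apply: (@le_lt_trans _ _ (mu [set y : 'rV[R]_n | (`|0 - y| < `|r| + 1)%R])).
  apply: le_outer_measure => y [/= yr _]; rewrite sub0r normrN.
  by rewrite (le_lt_trans yr)// (le_lt_trans (ler_norm r))// ltrDl.
by rewrite (le_lt_trans (lebesgue_Rn_ball _ r1))// ltry.
Qed.

Lemma mass_split r t r' t' : 0 < t' -> r <= r' ->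
  (\int[mu]_(y in hi r t) (u y `^ p) <=
   (t' `^ p)%:E * mu (hi r t) + \int[mu]_(y in hi r' t') (u y `^ p))%E.
Proof.
move=> t0 rr; have pp : 0 < p by have := p_gt1; lra.
rewrite (@ge0_integral_setID _ _ _ mu _ [set y | (t'%:E < u y)%E] _ (mhi r t) (mU t') (mup p)); last first.
  by move=> y; exact: poweR_ge0.
rewrite addeC leeD//.
  rewrite -integral_cst; last exact: mhi.
  apply: ge0_le_integral_subset; [|exact: mhi|by move=> y []|exact: mup|exact: measurable_cst| | |].
  - by apply: measurableI; [exact: mhi|exact: measurableC (mU t')].
  - by move=> y; exact: poweR_ge0.
  - by move=> y; rewrite lee_fin powR_ge0.
  move=> y [_ /= /negP]; rewrite -leNgt => uy.
  rewrite -poweR_EFin; apply: gt0_ler_poweR => //; first exact: ltW.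
    by rewrite in_itv/= leey andbT ltW.
  by rewrite in_itv/= leey andbT lee_fin ltW.
apply: ge0_le_integral_subset; [|exact: mhi| |exact: mup|exact: mup| | |by []].
- by apply: measurableI; [exact: mhi|exact: mU].
- by move=> y [[/= yr _] yt]; split => //=; exact: le_trans yr rr.
- by move=> y; exact: poweR_ge0.
- by move=> y; exact: poweR_ge0.
Qed.

Lemma essentially_bounded r : 0 <= r ->
  exists2 t, 0 < t & (\int[mu]_(y in hi r t) (u y `^ p) = 0)%E.
Proof.
move=> r0.
have [C1 C10 near] := integral_riesz_near (ltW s0) sn.
have n2 : n%:R < 2 * n%:R :> R by have := n_gt0; lra.
have [C2 C20 far] := @integral_riesz_far R n (2 * n%:R) n2.
(* The ratio [K = 2^n] of successive levels serves two purposes: [K >= 2] for the contraction, and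
   [K >= 2^s] to outgrow the constants caused by the shrinking gaps between balls. *)
have K2 : 2 <= 2 ^+ n :> R.
  by case: (n) n0 => // m _; rewrite exprS ler_peMr// exprn_ege1// ler1n.
have Ks : 2 `^ s <= 2 ^+ n :> R.
  by rewrite -powR_mulrn// ler_powR// ?ler1n// ltW.
move: K2 Ks; set K : R := 2 ^+ n => K2 Ks.
have K0 : 0 < K by rewrite (lt_le_trans _ K2).
have K1 : 1 <= K by rewrite (le_trans _ K2)// ler1n.
have [e0 e00 lev] := level_constants C10 C20 K0.
pose C5 := 2 * (C1 + 1); have C50 : 0 < C5 by rewrite mulr_gt0// addr_gt0.
pose c := K `^ p * (C5 / K) `^ (n%:R / s).
have c0 : 0 < c by rewrite mulr_gt0 ?powR_gt0// divr_gt0.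
have k1 : 0 < n%:R / s - 1 by rewrite subr_gt0 ltr_pdivlMr// mul1r.
(* Solves [c e1^(n/s - 1) = 1/4], the smallness asked for by the contraction. *)
pose e1 := (4 * c)^-1 `^ (n%:R / s - 1)^-1.
have e10 : 0 < e1 by rewrite powR_gt0// invr_gt0 mulr_gt0.
pose e := Num.min e0 e1.
have ep : 0 < e by rewrite lt_min e00.
have ce : c * e `^ (n%:R / s - 1) <= 4^-1.
  apply: (@le_trans _ _ (c * e1 `^ (n%:R / s - 1))).
    rewrite ler_pM2l//; apply: (ge0_ler_powR (ltW k1)); rewrite ?nnegrE ?(ltW ep) ?(ltW e10)//.
    by rewrite /e ge_min lexx orbT.
  rewrite /e1 -powRrM mulVf ?gt_eqF// powRr1; last by rewrite invr_ge0 mulr_ge0// ltW.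
  by rewrite invfM mulrCA mulfV ?gt_eqF// mulr1.
have [tau tau0 htau] := tail_integral_small (r + 1) ep.
have WE : W = (fine W)%:E.
  rewrite fineK// ge0_fin_numE ?weighted_integral_lty//.
  by apply: integral_ge0 => y _; rewrite mule_ge0 ?poweR_ge0// lee_fin powR_ge0.
have W0 : 0 <= fine W.
  apply: fine_ge0; apply: integral_ge0 => y _.
  by rewrite mule_ge0 ?poweR_ge0// lee_fin powR_ge0.
pose a1 := (2 * (3 + r)) `^ s * fine W.
pose a2 := C1 * tau `^ p * (2 * (r + 1) + 1) `^ (n%:R - s).
have a10 : 0 <= a1 by rewrite mulr_ge0 ?powR_ge0.
have a20 : 0 <= a2 by rewrite !mulr_ge0 ?powR_ge0// ltW.
(* The terms [16 a1] and [16 a2] absorb the far and the low parts of the equation; [tau] places all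
   the level sets inside the set where [u^q] has mass at most [e]. *)
pose t0 := 16 * (a1 + a2) + tau + 1.
have t00 : 0 < t0 by rewrite /t0; lra.
pose t j := t0 * K ^+ j.
have Kj j : 1 <= K ^+ j by exact: exprn_ege1.
have tj0 j : 0 < t j by rewrite mulr_gt0// (lt_le_trans _ (Kj j)).
have tj j : t0 <= t j by rewrite ler_peMr// ltW.
have tS j : t j.+1 = K * t j by rewrite /t exprS; ring.
(* The radii start at [r], stay below [r + 1], and the gap after step [j] is [2^(-(j+1))]. *)
pose dd j : R := 2^-1 ^+ j.+1; pose rr j : R := r + 1 - 2^-1 ^+ j.
have dd0 j : 0 < dd j by rewrite exprn_gt0.
have dd1 j : dd j <= 1 by rewrite exprn_ile1// invf_le1// ler1n.
have rS j : rr j.+1 = rr j + dd j by rewrite /rr /dd exprS; field.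
have rr0 j : 0 <= rr j.
  have : 2^-1 ^+ j <= 1 :> R by rewrite exprn_ile1// invf_le1// ler1n.
  by rewrite /rr; lra.
have rr1 j : rr j <= r + 1.
  by rewrite /rr gerBl exprn_ge0.
pose E j : set T := hi (rr j) (t j).
pose y j := fine (\int[mu]_(z in E j) (u z `^ p))%E.
have Ye j : ((t j)%:E * \int[mu]_(z in E j) (u z `^ p) <= e%:E)%E.
  apply: (chebyshev_level (tj0 j) (mhi (r + 1) tau) _ htau).
  move=> z [/= zr zt]; split => /=; first exact: le_trans zr (rr1 j).
  apply: le_lt_trans zt; rewrite lee_fin; apply: le_trans (tj j).
  by rewrite /t0; lra.
have Y0 j : (0 <= \int[mu]_(z in E j) (u z `^ p))%E.
  by apply: integral_ge0 => z _; exact: poweR_ge0.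
have yE j : (\int[mu]_(z in E j) (u z `^ p))%E = (y j)%:E.
  rewrite /y fineK// ge0_fin_numE//; apply: (@le_lt_trans _ _ ((t j)^-1 * e)%:E); last exact: ltry.
  rewrite EFinM -lee_pdivrMl ?invr_gt0// invrK; exact: Ye.
have y0 j : 0 <= y j by exact: fine_ge0.
have ye j : t j * y j <= e by rewrite -lee_fin EFinM -yE.
have step j : t j * y j <= 3 / 4 * (t j.+1 * y j.+1).
  pose m := fine (mu (E j)).
  have mE : mu (E j) = m%:E by rewrite /m fineK//; exact: mass_hi_fin.
  have m0 : 0 <= m by exact: fine_ge0.
  rewrite tS; apply: (@decay_algebra C5 K e (t j) m (y j) (y j.+1)) => //.
  - exact: ltW.
  - apply: (level_step near C10 (mhi _ _) (mhi _ _) (tj0 j) m0 mE (y0 j.+1) (yE j.+1)).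
    move=> x [/= xr xt].
    have [rho [a [rho0 aa hd he2 he1]]] := lev _ (tj0 j).
    have H : (u x <= (t j / 2)%:E + \int[mu]_(z in E j.+1) (u z `^ p * (ker x z)%:E))%E.
      rewrite /E tS rS.
      apply: (level_split near far (rr0 j) (dd0 j) (dd1 j) _ xr (tj0 j) K0 tau0 rho0 aa (e := e0)) hd he2 he1 _.
      - by rewrite -rS.
      - rewrite WE -EFinM lee_fin.
        pose w := 2 * (3 + r) * 2 ^+ j.
        have r3 : 0 < 3 + r by rewrite ltr_wpDr.
        have w0 : 0 < w by rewrite !mulr_gt0// exprn_gt0.
        have wd : w^-1 <= dd j / (2 + rr j).
          have -> : w^-1 = dd j / (3 + r).
            rewrite /w /dd exprVn exprS !invfM; ring.
          rewrite ler_pM2l// lef_pV2 ?posrE//.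
            by have := rr1 j; lra.
          by rewrite ltr_wpDr.
        have wi0 : 0 < w^-1 by rewrite invr_gt0.
        (* The gap costs a factor [2^(s j)], which is covered by the growth [K^j] of the levels. *)
        have h : (dd j / (2 + rr j)) `^ (- s) <= (2 * (3 + r)) `^ s * K ^+ j.
          apply: (le_trans (ler_powRN (ltW s0) wi0 wd)).
          rewrite -powR_inv1 ?(ltW w0)// -powRrM mulrNN mul1r.
          rewrite /w powRM ?powR_exprl ?exprn_ge0 ?mulr_ge0 ?(ltW r3)//.
          rewrite ler_wpM2l ?powR_ge0//.
          by apply: lerXn2r; rewrite ?nnegrE ?powR_ge0// ltW.
        apply: (le_trans (ler_wpM2r W0 h)).
        rewrite mulrAC -/a1 /t [X in _ <= X]mulrAC ler_wpM2r ?(le_trans _ (Kj j))//.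
        by rewrite /t0; lra.
      - rewrite -/a2; apply: (@le_trans _ _ (t0 / 16)); first by rewrite /t0; lra.
        by rewrite ler_wpM2r.
      - by apply: (le_trans htau); rewrite lee_fin /e ge_min lexx.
    have := lt_le_trans xt H.
    by rewrite {1}(splitr (t j)) EFinD lteD2lE// => /ltW.
  - rewrite -lee_fin EFinD EFinM -mE -!yE -tS; apply: mass_split => //.
    by rewrite rS lerDl ltW.
  - by rewrite -tS.
exists t0 => //.
suff : t 0%N * y 0%N <= 0.
  rewrite pmulr_rle0// => y00.
  have := yE 0%N; rewrite (_ : y 0%N = 0); last by apply/eqP; rewrite eq_le y00 y0.
  by rewrite /E /rr /t !expr0 mulr1 addrK.
have Z j : t 0%N * y 0%N <= (3 / 4) ^+ j * e.
  apply: (@le_trans _ _ ((3 / 4) ^+ j * (t j * y j))); last by rewrite ler_pM2l// exprn_gt0.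
  elim: j => [|j IH]; first by rewrite expr0 mul1r.
  by rewrite (le_trans IH)// exprSr -mulrA ler_pM2l// exprn_gt0.
rewrite leNgt; apply/negP => z0.
have [|j] := @exprn_unbounded R (4 / 3) (e / (t 0%N * y 0%N)); first lra.
rewrite ltr_pdivrMr// => Hj; have := Z j.
rewrite leNgt => /negP; apply.
have -> : (3 / 4 : R) ^+ j = ((4 / 3) ^+ j)^-1 by rewrite -exprVn invf_div.
by rewrite mulrC ltr_pdivrMr ?exprn_gt0// mulrC.
Qed.

(** The set where [u > t] in a larger ball is null, so it contributes nothing to the right side of
    the equation at any point: the almost everywhere bound becomes a bound everywhere. *)
Lemma locally_bounded r : 0 <= r ->
  exists C : R, forall x : 'rV[R]_n, `|x| <= r -> (u x <= C%:E)%E.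
Proof.
move=> r0; have r10 : 0 <= r + 1 by rewrite addr_ge0.
have [C1 C10 near] := integral_riesz_near (ltW s0) sn.
have [t t0 ht] := essentially_bounded r10.
have pp : 0 < p by have := p_gt1; lra.
have null : mu (hi (r + 1) t) = 0%E.
  apply/eqP; rewrite eq_le measure_ge0 andbT -(lee_pmul2l (x := (t `^ p)%:E))//; last first.
    by rewrite lte_fin powR_gt0.
  rewrite mule0 -ht -integral_cst; last exact: mhi.
  apply: ge0_le_integral_subset; [exact: mhi|exact: mhi|by []|exact: measurable_cst|exact: mup| | |].
  - by move=> y; rewrite lee_fin powR_ge0.
  - by move=> y; exact: poweR_ge0.
  move=> y [_ /= yt]; rewrite -poweR_EFin; apply: gt0_ler_poweR; first exact: ltW.
  - by rewrite in_itv/= leey andbT lee_fin ltW.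
  - by rewrite in_itv/= leey andbT ltW.
  - exact: ltW.
exists (fine (((1 / (2 + r)) `^ (- s))%:E * W) + t `^ p * (C1 * (2 * r + 2) `^ (n%:R - s))).
move=> x xr.
pose B : set T := [set y : 'rV[R]_n | `|y| <= r + 1].
have mB : measurable B by exact: mball.
have F0 y := F_ge0 x y.
rewrite {1}(u_eq x) (ge0_integral_setID mu measurableT mB (mF x) F0) !setTI.
rewrite (ge0_integral_setID mu mB (mU t) (mF x) F0).
rewrite [X in (X + _ + _)%E]null_set_integral; last 3 first.
- exact: mhi.
- exact: measurable_funTS (mF x).
- exact: null.
rewrite add0e addeC EFinD leeD//.
  rewrite fineK; last first.
    rewrite ge0_fin_numE; last first.
      rewrite mule_ge0 ?lee_fin ?powR_ge0//; apply: integral_ge0 => y _.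
      by rewrite mule_ge0 ?poweR_ge0// lee_fin powR_ge0.
    by rewrite lte_mul_pinfty ?lee_fin ?powR_ge0// weighted_integral_lty.
  rewrite -ge0_integralZl_EFin; last 4 first.
  - exact: measurableT.
  - by move=> y _; rewrite mule_ge0 ?poweR_ge0// lee_fin powR_ge0.
  - by apply: emeasurable_funM; [exact: mup|exact: mw].
  - exact: powR_ge0.
  apply: ge0_le_integral_subset; [exact: measurableC|exact: measurableT|by []|exact: mF| |exact: F0| | ].
  - by apply: emeasurable_funM; [exact: measurable_cst|apply: emeasurable_funM; [exact: mup|exact: mw]].
  - by move=> y; rewrite !mule_ge0 ?poweR_ge0// lee_fin powR_ge0.
  move=> y /= /negP; rewrite -ltNge => yr; rewrite muleCA lee_wpmul2l ?poweR_ge0//.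
  by rewrite -EFinM lee_fin; exact: ker_far.
have tt : 0 <= t `^ p by exact: powR_ge0.
have r20 : 0 < 2 * r + 2 by lra.
apply: (@le_trans _ _ (\int[mu]_(y in [set y : 'rV[R]_n | (`|x - y| < 2 * r + 2)%R]) ((t `^ p * `|x - y| `^ (- s))%:E))%E).
  apply: ge0_le_integral_subset; [|exact: measurable_ball_Rn| |exact: mF|exact: mriesz|exact: F0| | ].
  - by apply: measurableI => //; exact: measurableC.
  - move=> y [/= yB _]; apply: (le_lt_trans (ler_normB _ _)).
    apply: (le_lt_trans (lerD xr yB)); lra.
  - by move=> y; rewrite lee_fin mulr_ge0 ?powR_ge0.
  move=> y [_ /= /negP]; rewrite -leNgt => uy; rewrite EFinM.
  apply: lee_pmul; rewrite ?poweR_ge0 ?lee_fin ?powR_ge0//; last exact: enorm_powRN_le.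
  rewrite -poweR_EFin; apply: gt0_ler_poweR => //; first exact: ltW.
    by rewrite in_itv/= leey andbT ltW.
  by rewrite in_itv/= leey andbT lee_fin ltW.
under eq_integral do rewrite EFinM.
rewrite ge0_integralZl_EFin; last 4 first.
- exact: measurable_ball_Rn.
- by move=> y _; rewrite lee_fin powR_ge0.
- by apply: measurable_funTS; apply/measurable_EFinP; exact: measurable_normB_powR.
- exact: tt.
by rewrite EFinM lee_wpmul2l ?lee_fin//; exact: near.
Qed.

End integral_equation.

(** * Derivatives along lines, mean value and Lipschitz estimates *)

Section lines.
Context (R : realType) (V : normedModType R).
Implicit Types (f : V -> R) (x e : V).

Lemma is_derive_line f x e t d :
  is_derive (x + t *: e) e f d <-> is_derive t (1 : R) (fun a : R => f (x + a *: e)) d.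
Proof.
have E : (fun h : R => h^-1 *: ((f \o shift (x + t *: e)) (h *: e) - f (x + t *: e))) =
  (fun h : R => h^-1 *: (((fun a : R => f (x + a *: e)) \o shift t) (h *: (1 : R)) - f (x + t *: e))).
  apply/funext => h /=; congr (_ *: (f _ - _)).
  by rewrite [h *: (1 : R)]mulr1 scalerDl addrCA.
split=> -[Df fd]; split.
- by move: Df; rewrite /derivable E.
- by rewrite -fd /derive E.
- by move: Df; rewrite /derivable -E.
- by rewrite -fd /derive -E.
Qed.

Lemma is_derive_line0 f x e d :
  is_derive x e f d <-> is_derive (0 : R) (1 : R) (fun a : R => f (x + a *: e)) d.
Proof. by rewrite -is_derive_line scale0r addr0. Qed.

(** A quantitative remainder of order [|t|^(1+s)] identifies the derivative; the convolutions below
    are differentiated in this way. *)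
Lemma is_derive_modulus f x e d C s : 0 < s ->
  (forall t : R, `|t| <= 1 -> `|f (x + t *: e) - f x - t * d| <= C * `|t| `^ s * `|t|) ->
  is_derive x e f d.
Proof.
move=> s0 H.
have C0 : 0 <= C by have := H 1; rewrite normr1 powR1 !mulr1 => /(_ (lexx _)); apply: le_trans.
have cvg : h^-1 *: ((f \o shift x) (h *: e) - f x) @[h --> 0^'] --> d.
  apply/cvgrPdist_le => eps eps0.
  pose dl := Num.min 1 ((eps / (C + 1)) `^ s^-1).
  have dl0 : 0 < dl by rewrite lt_min ltr01 powR_gt0// divr_gt0// ltr_wpDl.
  exists dl => //= h /=; rewrite sub0r normrN => hd h0.
  have hn0 : 0 < `|h| by rewrite normr_gt0.
  have h1 : `|h| <= 1 by rewrite (le_trans (ltW hd))// ge_min lexx.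
  have := H h h1; rewrite [_ *: (_ - _)]mulrC [h *: e + x]addrC -(ler_pdivrMr _ _ hn0) => Hh.
  rewrite distrC; apply: (@le_trans _ _ (C * `|h| `^ s)).
    apply: le_trans Hh; rewrite le_eqVlt; apply/orP; left; apply/eqP.
    rewrite -normfV -normrM; congr `|_|.
    by field.
  apply: (@le_trans _ _ ((C + 1) * (eps / (C + 1)))); last by rewrite mulrC divfK// gt_eqF// ltr_wpDl.
  apply: ler_pM; rewrite ?powR_ge0//; first by rewrite lerDl.
  have E : (eps / (C + 1) : R) = ((eps / (C + 1)) `^ s^-1) `^ s.
    by rewrite -powRrM mulVf ?gt_eqF// powRr1// divr_ge0 ?ltW// ltr_wpDl.
  rewrite [leRHS]E; apply: (ge0_ler_powR (ltW s0)); rewrite ?nnegrE ?powR_ge0//.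
  by rewrite (le_trans (ltW hd))// ge_min lexx orbT.
by split; [apply/cvg_ex; exists d|exact: cvg_lim cvg].
Qed.

End lines.

Section mean_value.
Context (R : realType).
Implicit Types f df : R -> R.

Lemma mean_value f df a b : (forall x, is_derive x (1 : R) f (df x)) ->
  exists2 c, Num.min a b <= c <= Num.max a b & f b - f a = df c * (b - a).
Proof.
move=> fdf; have cf : continuous f.
  by move=> x; apply/differentiable_continuous/derivable1_diffP; case: (fdf x).
have [ab|ba] := leP a b.
  have [c cab fab] := MVT_segment ab (fun x _ => fdf x) (continuous_subspaceT cf).
  by exists c => //; move: cab; rewrite in_itv.
have [c cab fab] := MVT_segment (ltW ba) (fun x _ => fdf x) (continuous_subspaceT cf).
exists c; first by move: cab; rewrite in_itv.
by rewrite -opprB fab -mulrN opprB.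
Qed.

(** The power [c^(p-1)] from the mean value theorem is largest at [b] or at [a] according to the
    sign of [p - 1]; the sum of both values covers the two cases. *)
Lemma ler_powR_lipschitz (p a b x y : R) : 0 < a -> a <= x <= b -> a <= y <= b ->
  `|x `^ p - y `^ p| <= `|p| * (a `^ (p - 1) + b `^ (p - 1)) * `|x - y|.
Proof.
move=> a0; wlog xy : x y / x <= y.
  move=> H xab yab; have [xy|/ltW yx] := leP x y; first exact: H.
  by rewrite distrC [X in _ * X]distrC; exact: H.
move=> /andP[ax xb] /andP[ay yb].
have D z : z \in `]x, y[ -> is_derive z 1 ((@powR R) ^~ p) (p * z `^ (p - 1)).
  by rewrite in_itv/= => /andP[xz _]; apply: is_derive1_powR; rewrite (lt_trans _ xz)// (lt_le_trans a0).
have cf : {within `[x, y], continuous ((@powR R) ^~ p)}.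
  apply: derivable_within_continuous => z; rewrite in_itv/= => /andP[xz _].
  by apply: derivable_powR; rewrite in_itv/= andbT (lt_le_trans a0)// (le_trans ax).
have [c + E] := MVT_segment xy D cf; rewrite in_itv/= => /andP[xc cy].
rewrite distrC E normrM [`|y - x|]distrC ler_wpM2r// normrM ler_wpM2l//.
have c0 : 0 < c by rewrite (lt_le_trans a0)// (le_trans ax).
rewrite ger0_norm ?powR_ge0//; have [p1|/ltW p1] := leP 0 (p - 1).
  rewrite -[leLHS]add0r lerD ?powR_ge0//; apply: (ge0_ler_powR p1); rewrite ?nnegrE ?(ltW c0)//.
    by rewrite (le_trans (ltW c0))// (le_trans cy).
  exact: le_trans cy yb.
rewrite -[leLHS]addr0 lerD ?powR_ge0//.
by rewrite -[p - 1]opprK ler_powRN ?oppr_ge0// (le_trans ax).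
Qed.

End mean_value.

(** * Functions all of whose derivatives up to a given order lie in a class *)

Section regularity.
Context (R : realType) (n : nat).
Notation V := 'rV[R]_n.
Notation e_ i := (@basis_vector R n i).
Implicit Types (f g : V -> R) (P Q : (V -> R) -> Prop).

(** The recursion of [Ck] with continuity replaced by a property [P], so that local Hoelder classes
    and weighted classes of kernels share the sum and product rules. *)
Fixpoint Reg P k f : Prop := if k is k'.+1 then
  [/\ P f, forall i x, derivable f x (e_ i) & forall i, Reg P k' (fun x => 'D_(e_ i) f x)]
  else P f.

Lemma Reg_base P k f : Reg P k f -> P f.
Proof. by case: k => //= k []. Qed.

Lemma RegW P k f : Reg P k.+1 f -> Reg P k f.
Proof.
elim: k f => [|k IH] f; first by case.
by move=> [Pf Df H]; split => // i; exact: IH (H i).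
Qed.

Lemma sub_Reg P Q k f : (forall g, P g -> Q g) -> Reg P k f -> Reg Q k f.
Proof.
move=> PQ; elim: k f => [|k IH] f; first exact: PQ.
by move=> [Pf Df H]; split; [exact: PQ|exact: Df|move=> i; exact: IH (H i)].
Qed.

Lemma RegD P k f g : (forall f g, P f -> P g -> P (fun x => f x + g x)) ->
  Reg P k f -> Reg P k g -> Reg P k (fun x => f x + g x).
Proof.
move=> PD; elim: k f g => [|k IH] f g; first exact: PD.
move=> [Pf Df Hf] [Pg Dg Hg]; split; first exact: PD.
  by move=> i x; apply: derivableD.
move=> i; rewrite (_ : (fun x => _) = (fun x => 'D_(e_ i) f x + 'D_(e_ i) g x)).
  exact: IH (Hf i) (Hg i).
by apply/funext => x; rewrite deriveD.
Qed.

(** Three classes, because the growth orders of two kernels add up in their product. *)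
Lemma RegM P1 P2 P3 k f g :
  (forall f g, P3 f -> P3 g -> P3 (fun x => f x + g x)) ->
  (forall f g, P1 f -> P2 g -> P3 (fun x => f x * g x)) ->
  Reg P1 k f -> Reg P2 k g -> Reg P3 k (fun x => f x * g x).
Proof.
move=> PD PM; elim: k f g => [|k IH] f g; first exact: PM.
move=> [Pf Df Hf] [Pg Dg Hg]; split; first exact: PM.
  by move=> i x; apply: derivableM.
move=> i; rewrite (_ : (fun x => _) =
    (fun x => f x * 'D_(e_ i) g x + 'D_(e_ i) f x * g x)).
  have Wf : Reg P1 k f by apply: RegW; split.
  have Wg : Reg P2 k g by apply: RegW; split.
  by apply: RegD => //; [exact: IH Wf (Hg i)|exact: IH (Hf i) Wg].
by apply/funext => x; rewrite deriveM// [in RHS]addrC [in RHS]mulrC addrC.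
Qed.

End regularity.

(** * Local Hoelder classes *)

Section hoelder.
Context (R : realType) (n : nat).
Notation V := 'rV[R]_n.
Notation e_ i := (@basis_vector R n i).
Implicit Types (f g : V -> R) (s t : R).

(** Only the base point is confined to the ball; the increment may leave it. Exponent [1] means
    locally Lipschitz. *)
Definition LH s f := forall r : R, exists C, forall x : V, `|x| <= r ->
  `|f x| <= C /\ forall h : V, `|h| <= 1 -> `|f (x + h) - f x| <= C * `|h| `^ s.

Lemma LH_bound s f : LH s f -> forall r, exists2 C, 0 <= C & forall x : V, `|x| <= r ->
  `|f x| <= C /\ forall h : V, `|h| <= 1 -> `|f (x + h) - f x| <= C * `|h| `^ s.
Proof.
move=> fs r; have [C HC] := fs r; exists (Num.max C 0); first by rewrite le_max lexx orbT.
move=> x xr; have [fx Hx] := HC x xr; split; first by rewrite le_max fx.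
by move=> h h1; rewrite (le_trans (Hx h h1))// ler_wpM2r ?powR_ge0// le_max lexx.
Qed.

Lemma LH_continuous s f : 0 < s -> LH s f -> continuous f.
Proof.
move=> s0 fs x; have [C C0 HC] := LH_bound fs `|x|.
have [_ Hx] := HC x (lexx _).
apply/(@cvgrPdist_le _ _ _ (nbhs x)) => eps eps0.
have C1 : 0 < C + 1 by rewrite ltr_wpDl.
have e0 : 0 < eps / (C + 1) by rewrite divr_gt0.
pose dl := Num.min 1 ((eps / (C + 1)) `^ s^-1).
have dl0 : 0 < dl by rewrite lt_min ltr01 powR_gt0.
apply/nbhs_ballP; exists dl => //= y; rewrite -ball_normE /= => /ltW.
rewrite distrC => xy.
have [h1 h2] : `|y - x| <= 1 /\ `|y - x| <= (eps / (C + 1)) `^ s^-1.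
  by move: xy; rewrite le_min => /andP.
have := Hx (y - x) h1; rewrite [x + _]addrC subrK distrC => /le_trans; apply.
apply: (@le_trans _ _ ((C + 1) * (eps / (C + 1)))); last by rewrite mulrC divfK// gt_eqF.
apply: ler_pM; rewrite ?powR_ge0//; first by rewrite lerDl.
have E : (eps / (C + 1) : R) = ((eps / (C + 1)) `^ s^-1) `^ s.
  by rewrite -powRrM mulVf ?gt_eqF// powRr1// ltW.
by rewrite [leRHS]E; apply: (ge0_ler_powR (ltW s0)); rewrite ?nnegrE ?powR_ge0.
Qed.

Lemma LH_le s t f : t <= s -> LH s f -> LH t f.
Proof.
move=> ts fs r; have [C C0 HC] := LH_bound fs r; exists (C + C) => x xr.
have [fx Hx] := HC x xr; split; first by rewrite (le_trans fx)// lerDl.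
move=> h h1; have [->|h0] := eqVneq h 0.
  by rewrite addr0 subrr normr0 mulr_ge0 ?powR_ge0// addr_ge0.
apply: (le_trans (Hx h h1)); apply: ler_pM; rewrite ?powR_ge0 ?lerDl//.
by apply: ger_powR => //; rewrite normr_gt0 h0.
Qed.

Lemma LH_add s f g : LH s f -> LH s g -> LH s (fun x => f x + g x).
Proof.
move=> fs gs r; have [C HC] := fs r; have [D HD] := gs r; exists (C + D) => x xr.
have [fx Hf] := HC x xr; have [gx Hg] := HD x xr; split.
  by rewrite (le_trans (ler_normD _ _))// lerD.
move=> h h1; rewrite mulrDl opprD addrACA (le_trans (ler_normD _ _))// lerD//.
  exact: Hf.
exact: Hg.
Qed.

Lemma LH_cst s (c : R) : LH s (fun _ : V => c).
Proof.
move=> r; exists `|c| => x _; split=> // h _.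
by rewrite subrr normr0 mulr_ge0 ?powR_ge0.
Qed.

Lemma LH_mul s f g : LH s f -> LH s g -> LH s (fun x => f x * g x).
Proof.
move=> fs gs r; have [C C0 HC] := LH_bound fs (r + 1); have [D D0 HD] := LH_bound gs (r + 1).
exists (2 * C * D) => x xr.
have xr1 : `|x| <= r + 1 by rewrite (le_trans xr)// lerDl.
have [fx Hf] := HC x xr1; have [gx Hg] := HD x xr1; split.
  rewrite normrM (@le_trans _ _ (C * D))//; first exact: ler_pM.
  by rewrite -mulrA ler_peMl ?mulr_ge0// ler1n.
move=> h h1.
have xh : `|x + h| <= r + 1 by rewrite (le_trans (ler_normD _ _))// lerD.
have [fxh _] := HC _ xh.
have -> : f (x + h) * g (x + h) - f x * g x =
  f (x + h) * (g (x + h) - g x) + (f (x + h) - f x) * g x by ring.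
rewrite (le_trans (ler_normD _ _))// !normrM.
apply: (@le_trans _ _ (C * (D * `|h| `^ s) + C * `|h| `^ s * D)).
  by apply: lerD; apply: ler_pM; rewrite ?Hf ?Hg.
rewrite le_eqVlt; apply/orP; left; apply/eqP; ring.
Qed.

Lemma closed_norm_le (r : R) : closed [set x : V | `|x| <= r].
Proof.
have := @closed_comp V R (fun x => `|x|) [set t | t <= r].
by apply => [x _|]; [exact: norm_continuous|exact: closed_le].
Qed.

Lemma compact_norm_le (r : R) : compact [set x : V | `|x| <= r].
Proof.
apply: bounded_closed_compact; last exact: closed_norm_le.
exists r; split; first exact: num_real.
by move=> M rM x /= xr; rewrite (le_trans xr)// ltW.
Qed.

Lemma continuous_pos_lower_bound f (r : R) : continuous f -> (forall x, 0 < f x) ->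
  exists2 a, 0 < a & forall x : V, `|x| <= r -> a <= f x.
Proof.
move=> cf f0; have [r0|r0] := ltP r 0.
  exists 1 => // x; rewrite leNgt (lt_le_trans r0)//.
have [|c _ Hc] := EVT_min_rV _ (@compact_norm_le r) (continuous_subspaceT cf).
  by exists 0; rewrite /= normr0.
by exists (f c) => // x xr; apply: Hc; rewrite inE.
Qed.

(** On a closed ball, which is compact, [f] stays between two positive constants, and there the
    power function is Lipschitz. *)
Lemma LH_powR s f a : 0 < s -> (forall x, 0 < f x) -> LH s f -> LH s (fun x => f x `^ a).
Proof.
move=> s0 f0 fs r.
have [m m0 Hm] := continuous_pos_lower_bound (r + 1) (LH_continuous s0 fs) f0.
have [C C0 HC] := LH_bound fs (r + 1).
pose L := `|a| * (m `^ (a - 1) + C `^ (a - 1)).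
have L0 : 0 <= L by rewrite mulr_ge0 ?addr_ge0 ?powR_ge0.
have HL x y : m <= x <= C -> m <= y <= C -> `|x `^ a - y `^ a| <= L * `|x - y|.
  exact: ler_powR_lipschitz.
have fb x : `|x| <= r + 1 -> m <= f x <= C.
  by move=> xr; rewrite Hm// (le_trans (ler_norm _))//; have [] := HC x xr.
exists (m `^ a + L * C + L * (C + m)) => x xr.
have xr1 : `|x| <= r + 1 by rewrite (le_trans xr)// lerDl.
have /andP[mx xC] := fb x xr1; have mC := le_trans mx xC.
have h1 : 0 <= L * C by rewrite mulr_ge0.
have h2 : 0 <= L * (C + m) by rewrite mulr_ge0// addr_ge0// ltW.
split.
  have := HL (f x) m (fb x xr1); rewrite lexx mC => /(_ isT) H.
  have -> : f x `^ a = m `^ a + (f x `^ a - m `^ a) by ring.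
  rewrite (le_trans (ler_normD _ _))// ger0_norm ?powR_ge0//.
  rewrite -addrA lerD2l (le_trans H)// (@le_trans _ _ (L * (C + m)))//.
    by rewrite ler_wpM2l// (le_trans (ler_normB _ _))// !gtr0_norm// lerD.
  by rewrite lerDr.
move=> h hh; have xh : `|x + h| <= r + 1 by rewrite (le_trans (ler_normD _ _))// lerD.
apply: (le_trans (HL _ _ (fb _ xh) (fb _ xr1))).
have [_ /(_ h hh) H] := HC x xr1.
apply: (le_trans (ler_wpM2l L0 H)); rewrite mulrA ler_wpM2r ?powR_ge0//.
by have := powR_ge0 m a; lra.
Qed.

Lemma Reg_cst (P : (V -> R) -> Prop) k : (forall c, P (fun=> c)) ->
  forall c, Reg P k (fun=> c).
Proof.
move=> Pc; elim: k => [|k IH] c; first exact: Pc.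
split; [exact: Pc|by move=> i x; exact: derivable_cst|move=> i].
rewrite (_ : (fun x => _) = (fun=> (0 : R))); first exact: (IH 0).
by apply/funext => x; rewrite derive_cst.
Qed.

Lemma is_derive_comp_real (g : R -> R) f (x e : V) d : is_derive (f x) (1 : R) g d ->
  derivable f x e -> is_derive x e (fun y => g (f y)) (d * 'D_e f x).
Proof.
move=> gd /derivableP fd; apply/is_derive_line0.
have := is_derive1_comp (f := g) (g := fun t : R => f (x + t *: e)).
move=> /(_ 0 d ('D_e f x)); apply; first by rewrite scale0r addr0.
exact: (is_derive_line0 f x e _).1 fd.
Qed.

Lemma is_derive_powR_comp f (x e : V) a : 0 < f x -> derivable f x e ->
  is_derive x e (fun y => f y `^ a) (a * f x `^ (a - 1) * 'D_e f x).
Proof. by move=> fx0; apply: (@is_derive_comp_real ((@powR R) ^~ a)); exact: is_derive1_powR. Qed.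

(** The induction keeps [a] free, since the derivative of [f^a] involves [f^(a-1)]. *)
Lemma Reg_powR s k f a : 0 < s -> (forall x, 0 < f x) -> Reg (LH s) k f ->
  Reg (LH s) k (fun x => f x `^ a).
Proof.
move=> s0 f0; elim: k a => [|k IH] a; first exact: LH_powR.
move=> /[dup] fk1 [Pf Df Hf]; split; first exact: LH_powR.
  by move=> i x; have [] := is_derive_powR_comp a (f0 x) (Df i x).
move=> i.
rewrite (_ : (fun x => _) = (fun x => a * f x `^ (a - 1) * 'D_(e_ i) f x)); last first.
  by apply/funext => x; have [_ ->] := is_derive_powR_comp a (f0 x) (Df i x).
apply: (RegM (@LH_add s) (@LH_mul s)); last exact: Hf.
apply: (RegM (@LH_add s) (@LH_mul s)); first exact: (Reg_cst _ (LH_cst s)).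
by apply: IH; exact: RegW.
Qed.

Lemma Reg_Ck s k f : 0 < s -> Reg (LH s) k f -> Ck k f.
Proof.
move=> s0; elim: k f => [|k IH] f; first exact: LH_continuous.
move=> [Pf Df Hf]; split => //; first exact: LH_continuous Pf.
by move=> i; exact: IH (Hf i).
Qed.

End hoelder.

(** * Negative powers continued by their Taylor polynomial at [1] *)

Section taylor_truncation.
Context (R : realType).
Implicit Types s t : R.

(** This is [s (s+1) ... (s+m-1) / m!], the coefficient of [(1 - t)^m] in the expansion of [t^(-s)]
    at [1]. *)
Definition tcoef s m : R := \prod_(i < m) ((s + i%:R) / (i%:R + 1)).

Lemma tcoefS s m : tcoef s m.+1 = tcoef s m * ((s + m%:R) / (m%:R + 1)).
Proof. by rewrite /tcoef big_ord_recr. Qed.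

Lemma tcoef_shift s m : tcoef s m * (s + m%:R) = s * tcoef (s + 1) m.
Proof.
elim: m => [|m IH]; first by rewrite /tcoef !big_ord0; ring.
rewrite !tcoefS [RHS]mulrA -IH; have : 0 <= m%:R :> R by [].
rewrite -natr1; move: (tcoef s m) (m%:R) => c x x0; field.
by rewrite gt_eqF// ltr_wpDl.
Qed.

Lemma tcoef_ge0 s m : 0 <= s -> 0 <= tcoef s m.
Proof. by move=> s0; apply: prodr_ge0 => i _; rewrite divr_ge0 ?addr_ge0. Qed.

Definition tay s N t : R := \sum_(m < N.+1) tcoef s m * (1 - t) ^+ m.

Lemma is_derive_tay s N t :
  is_derive t (1 : R) (tay s N) (- s * \sum_(m < N) tcoef (s + 1) m * (1 - t) ^+ m).
Proof.
elim: N => [|N IH].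
  rewrite big_ord0 mulr0 (_ : tay s 0 = fun=> 1); first exact: is_derive_cst.
  by apply/funext => x; rewrite /tay big_ord1 /tcoef big_ord0 expr0 mulr1.
rewrite (_ : tay s N.+1 = (tay s N \+ fun x => tcoef s N.+1 * (1 - x) ^+ N.+1)%R); last first.
  by apply/funext => x; rewrite /tay big_ord_recr.
rewrite big_ord_recr/= mulrDr.
apply: is_deriveD.
have -> : - s * (tcoef (s + 1) N * (1 - t) ^+ N) =
    tcoef s N.+1 *: ((N.+1%:R * (1 - t) ^+ N) * (0 - 1)).
  rewrite /GRing.scale/= tcoefS -natr1.
  have := tcoef_shift s N; have : 0 <= N%:R :> R by [].
  move: (tcoef s N) (tcoef (s + 1) N) (N%:R) ((1 - t) ^+ N) => c c' x y x0 H.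
  have -> : - s * (c' * y) = - (s * c') * y by ring.
  rewrite -H; field.
  by rewrite gt_eqF// ltr_wpDl.
apply: is_deriveZ.
apply: (is_derive1_comp (f := fun y => y ^+ N.+1) (g := fun x => 1 - x)).
  split; first exact: exprn_derivable.
  by rewrite exp_derive /GRing.scale/= mulr1.
Qed.

Definition phi s N t : R := if t < 1 then tay s N t else t `^ (- s).

Lemma tay1 s N : tay s N 1 = 1.
Proof.
rewrite /tay big_ord_recl /tcoef big_ord0 expr0 big1 ?addr0 ?mulr1// => i _.
by rewrite subrr expr0n /= mulr0.
Qed.

(** The family is stable under differentiation: the exponent goes up by one and the Taylor degree
    down by one, so all derivatives of the truncated kernel are handled by the same estimates. *)
Lemma is_derive_phi s N t :
  is_derive t (1 : R) (phi s N.+1) (- s * phi (s + 1) N t).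
Proof.
have D1 := is_derive_tay s N.+1 t; rewrite -/(tay (s + 1) N t) in D1.
have D2 : 0 < t -> is_derive t (1 : R) ((@powR R) ^~ (- s)) (- s * t `^ (- (s + 1))).
  by move=> t0; have := is_derive1_powR (- s) t0; rewrite opprD; exact.
rewrite {2}/phi; have [t1|t1] := ltP t 1.
  apply: near_eq_is_derive D1.
  by have := lt_nbhsl t1; apply: filterS => x x1; rewrite /phi x1.
have t0 : 0 < t by rewrite (lt_le_trans _ t1).
move: t1; rewrite le_eqVlt => /predU1P[t1|t1]; last first.
  apply: near_eq_is_derive (D2 t0).
  by have := lt_nbhsr t1; apply: filterS => x x1; rewrite /phi ltNge (ltW x1).
(* At the junction both branches have the same value and the same slope, and each difference
   quotient of [phi] is a quotient of one of them. *)
move: D1 (D2 t0); rewrite -t1 tay1 powR1 => -[D1 d1] [D2' d2].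
set d := - s * 1 in d1 d2 *.
have cv1 : h^-1 *: ((tay s N.+1 \o shift 1) (h *: 1) - tay s N.+1 1) @[h --> 0^'] --> d.
  by rewrite -d1; exact: D1.
have cv2 : h^-1 *: (((@powR R ^~ (- s)) \o shift 1) (h *: 1) - 1 `^ (- s)) @[h --> 0^'] --> d.
  by rewrite -d2; exact: D2'.
have cvg : h^-1 *: ((phi s N.+1 \o shift 1) (h *: 1) - phi s N.+1 1) @[h --> 0^'] --> d.
  move=> A nA; have := cv1 A nA; have := cv2 A nA; rewrite /nbhs /=.
  apply: filterS2 => h; rewrite /= /phi ltxx powR1 tay1.
  by case: ifP.
by split; [apply/cvg_ex; exists d|exact: cvg_lim cvg].
Qed.

Definition phi_bound s N : R := 1 + \sum_(m < N.+1) tcoef s m.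

Lemma phi_bound_ge1 s N : 0 <= s -> 1 <= phi_bound s N.
Proof.
by move=> s0; rewrite lerDl; apply: sumr_ge0 => m _; exact: tcoef_ge0.
Qed.

Lemma phi_le s N t : 0 <= s -> 0 <= t -> `|phi s N t| <= phi_bound s N * (Num.max 1 t) `^ (- s).
Proof.
move=> s0 t0; rewrite /phi; case: ltP => t1; last first.
  rewrite ger0_norm ?powR_ge0// ler_peMl ?powR_ge0//; exact: phi_bound_ge1.
rewrite powR1 mulr1 (le_trans (ler_norm_sum _ _ _))//.
rewrite -[leLHS]add0r lerD//; apply: ler_sum => m _.
rewrite normrM ger0_norm ?tcoef_ge0// ler_piMr ?tcoef_ge0//.
by rewrite normrX exprn_ile1// ger0_norm ?subr_ge0 ?(ltW t1)// gerBl.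
Qed.

End taylor_truncation.

(** * Smooth kernels with weighted bounds *)

Section kernel_class.
Context (R : realType) (n : nat).
Notation V := 'rV[R]_n.
Notation e_ i := (@basis_vector R n i).
Implicit Types (K : V -> R) (d s : R).

(** Size and Lipschitz increments up to unit length carry the same weight. Order [-(n - alpha)] is
    the decay that can be integrated against [u^p]. *)
Definition Kd d K := exists C, forall z : V, `|K z| <= C * (1 + `|z|) `^ d /\
  forall h : V, `|h| <= 1 -> `|K (z + h) - K z| <= C * `|h| * (1 + `|z|) `^ d.

Let w_ge1 (z : V) : 1 <= 1 + `|z|. Proof. by rewrite lerDl. Qed.
Let w_gt0 (z : V) : 0 < 1 + `|z|. Proof. by rewrite (lt_le_trans _ (w_ge1 z)). Qed.

Lemma Kd_bound d K : Kd d K -> exists2 C, 0 <= C & forall z : V,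
  `|K z| <= C * (1 + `|z|) `^ d /\
  forall h : V, `|h| <= 1 -> `|K (z + h) - K z| <= C * `|h| * (1 + `|z|) `^ d.
Proof.
move=> [C HC]; exists C => //; have [+ _] := HC 0.
by rewrite normr0 addr0 powR1 mulr1; exact: le_trans.
Qed.

Lemma Kd_add d K L : Kd d K -> Kd d L -> Kd d (fun z => K z + L z).
Proof.
move=> [C HC] [D HD]; exists (C + D) => z; have [Kz HK] := HC z; have [Lz HL] := HD z.
split; first by rewrite mulrDl (le_trans (ler_normD _ _))// lerD.
move=> h h1; rewrite opprD addrACA 2!mulrDl (le_trans (ler_normD _ _))// lerD//.
  exact: HK.
exact: HL.
Qed.

Lemma Kd_le d d' K : d <= d' -> Kd d K -> Kd d' K.
Proof.
move=> dd /Kd_bound[C C0 HC]; exists C => z; have [Kz HK] := HC z.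
have wd : (1 + `|z|) `^ d <= (1 + `|z|) `^ d' by exact: ler_powR.
split; first by rewrite (le_trans Kz)// ler_wpM2l.
by move=> h h1; rewrite (le_trans (HK h h1))// ler_wpM2l// mulr_ge0.
Qed.

(** The factor [3] is [2 + 1]: the value of [L] at the shifted point is bounded by twice its weight
    at [z]. *)
Lemma Kd_mul d d' K L : Kd d K -> Kd d' L -> Kd (d + d') (fun z => K z * L z).
Proof.
move=> /Kd_bound[C C0 HC] /Kd_bound[D D0 HD]; exists (3 * C * D) => z.
have [Kz HK] := HC z; have [Lz HL] := HD z.
rewrite powRDr//; move: ((1 + `|z|) `^ d) ((1 + `|z|) `^ d') (powR_ge0 (1 + `|z|) d)
  (powR_ge0 (1 + `|z|) d') Kz HK Lz HL => a b a0 b0 Kz HK Lz HL.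
have CD0 : 0 <= C * D by rewrite mulr_ge0.
have ab0 : 0 <= a * b by rewrite mulr_ge0.
have CDab : 0 <= C * D * (a * b) by rewrite mulr_ge0.
split.
  rewrite normrM (@le_trans _ _ (C * a * (D * b)))//; first exact: ler_pM.
  have -> : C * a * (D * b) = C * D * (a * b) by ring.
  have -> : 3 * C * D * (a * b) = 3 * (C * D * (a * b)) by ring.
  lra.
move=> h h1; have {}HK := HK h h1; have {}HL := HL h h1.
have Lzh : `|L (z + h)| <= 2 * D * b.
  rewrite -[L (z + h)](subrK (L z)) (le_trans (ler_normD _ _))//.
  have : D * `|h| * b <= D * b by rewrite ler_wpM2r// ler_piMr.
  lra.
have -> : K (z + h) * L (z + h) - K z * L z =
  (K (z + h) - K z) * L (z + h) + K z * (L (z + h) - L z) by ring.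
rewrite (le_trans (ler_normD _ _))// !normrM.
apply: (@le_trans _ _ (C * `|h| * a * (2 * D * b) + C * a * (D * `|h| * b))).
  by apply: lerD; exact: ler_pM.
rewrite le_eqVlt; apply/orP; left; apply/eqP; ring.
Qed.

Lemma Kd_cst d (c : R) : 0 <= d -> Kd d (fun _ : V => c).
Proof.
move=> d0; exists `|c| => z.
have w1 : 1 <= (1 + `|z|) `^ d by have := ler_powR (w_ge1 z) d0; rewrite powRr0.
split; first by rewrite ler_peMr.
by move=> h _; rewrite subrr normr0 !mulr_ge0// ltW// powR_gt0.
Qed.

Lemma Kd_coord i : Kd 1 (fun z : V => z ord0 i).
Proof.
exists 1 => z; rewrite powRr1 ?(ltW (w_gt0 z))// mul1r; split.
  by rewrite (le_trans (coord_le_norm z i))// lerDr.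
move=> h _; rewrite !mxE [_ + _ - _]addrC addKr mul1r (le_trans (coord_le_norm h i))//.
by rewrite ler_peMr.
Qed.

Lemma is_derive_coord i (e x : V) : is_derive x e (fun z : V => z ord0 i) (e ord0 i).
Proof.
apply: (@is_derive_modulus _ _ _ _ _ _ 0 1) => // t _.
by rewrite !mxE [X in X - _](_ : _ = t * e ord0 i) ?subrr ?normr0 ?mul0r//; ring.
Qed.

Lemma Reg_coord k i : Reg (Kd 1) k (fun z : V => z ord0 i).
Proof.
case: k => [|k]; first exact: Kd_coord.
split; first exact: Kd_coord.
  by move=> j x; have [] := is_derive_coord i (e_ j) x.
move=> j; rewrite (_ : (fun x => _) = (fun=> e_ j ord0 i)).
  by apply: Reg_cst => c; exact: Kd_cst.
by apply/funext => x; have [_ ->] := is_derive_coord i (e_ j) x.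
Qed.

Lemma is_derive_sqn i (x : V) : is_derive x (e_ i) (@sqn R n) (2 * x ord0 i).
Proof.
apply: (@is_derive_modulus _ _ _ _ _ _ 1 1) => // t _.
rewrite powRr1// mul1r.
have -> : sqn (x + t *: e_ i) = sqn x + (2 * t * x ord0 i + t ^+ 2).
  rewrite /sqn (bigD1 i)//= [in RHS](bigD1 i)//= !mxE !eqxx /=.
  rewrite (eq_bigr (fun j => x ord0 j ^+ 2)); first by ring.
  by move=> j /negbTE ji; rewrite !mxE ji andbF mulr0 addr0.
rewrite (_ : _ - _ = t ^+ 2); last by ring.
by rewrite normrX expr2.
Qed.

Lemma sqn_modulus (z h : V) : `|h| <= 1 ->
  `|sqn (z + h) - sqn z| <= 2 * n%:R * `|h| * (1 + `|z|).
Proof.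
move=> h1; rewrite /sqn -sumrB (le_trans (ler_norm_sum _ _ _))//.
rewrite (_ : 2 * _ * _ * _ = \sum_(i < n) (2 * `|h| * (1 + `|z|))); last first.
  by rewrite sumr_const card_ord -mulr_natl; ring.
apply: ler_sum => i _; rewrite !mxE.
have -> : (z ord0 i + h ord0 i) ^+ 2 - z ord0 i ^+ 2 = h ord0 i * (2 * z ord0 i + h ord0 i) by ring.
rewrite normrM (_ : 2 * `|h| * (1 + `|z|) = `|h| * (2 * (1 + `|z|))); last by ring.
apply: ler_pM => //; first exact: coord_le_norm.
rewrite (le_trans (ler_normD _ _))// normrM ger0_norm//.
have := coord_le_norm z i; have := coord_le_norm h i; lra.
Qed.

Lemma powRN_sqr_le (w m a : R) : 0 < w -> (w / 3) ^+ 2 <= m -> 0 <= a ->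
  m `^ (- a) <= 9 `^ a * w `^ (- (2 * a)).
Proof.
move=> w0 wm a0; have w3 : 0 < (w / 3) ^+ 2 by rewrite exprn_gt0// divr_gt0.
apply: (le_trans (ler_powRN a0 w3 wm)); rewrite le_eqVlt; apply/orP; left; apply/eqP.
rewrite expr_div_n powRM ?exprn_ge0 ?invr_ge0 ?exprn_ge0 ?(ltW w0)// mulrC; congr (_ * _).
  rewrite -powR_inv1// -powRrM mulrNN mul1r; congr powR; lra.
rewrite powR_exprl ?(ltW w0)// -powR_mulrn ?powR_ge0// -powRrM; congr powR; ring.
Qed.

(** A unit shift changes the weight by a bounded factor: if [|z + h| <= 1] then [1 + |z| <= 3],
    otherwise [1 + |z| <= 2 + |z + h| <= 3 |z + h|]. *)
Lemma max1_sqn_ge (z h : V) : `|h| <= 1 ->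
  ((1 + `|z|) / 3) ^+ 2 <= Num.max 1 (sqn (z + h)).
Proof.
move=> h1.
have zh : `|z| <= `|z + h| + 1.
  by rewrite -{1}(addrK h z) (le_trans (ler_normB _ _))// lerD2l.
have [m1|m1] := leP `|z + h| 1.
  rewrite le_max exprn_ile1 ?divr_ge0 ?(ltW (w_gt0 z))// ler_pdivrMr//; lra.
rewrite le_max; apply/orP; right; apply: le_trans (sqr_norm_le_sqn _).
rewrite ler_pXn2r ?nnegrE ?divr_ge0 ?(ltW (w_gt0 z))// ler_pdivrMr//; lra.
Qed.

(** For increments the mean value theorem gives order [-2(s+1)] from the derivative of [phi] and
    order [1] from the variation of [sqn], one better than needed. *)
Lemma Kd_phi s N : 0 < s -> Kd (- (2 * s)) (fun z : V => phi s N.+1 (sqn z)).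
Proof.
move=> s0; have s1 : 0 <= s + 1 by rewrite addr_ge0// ltW.
pose B := phi_bound s N.+1; pose B' := phi_bound (s + 1) N.
have B1 : 1 <= B by rewrite phi_bound_ge1// ltW.
have B1' : 1 <= B' by rewrite phi_bound_ge1.
pose C1 := B * 9 `^ s; pose C2 := s * B' * 9 `^ (s + 1) * (2 * n%:R).
have C10 : 0 <= C1 by rewrite mulr_ge0 ?powR_ge0// (le_trans _ B1).
have C20 : 0 <= C2 by rewrite !mulr_ge0 ?powR_ge0 ?(ltW s0)// (le_trans _ B1').
exists (C1 + C2) => z; have w0 := w_gt0 z.
split.
  apply: (@le_trans _ _ (C1 * (1 + `|z|) `^ (- (2 * s)))); last by rewrite ler_wpM2r ?powR_ge0// lerDl.
  apply: (le_trans (phi_le _ (ltW s0) (sqn_ge0 z))).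
  rewrite -mulrA ler_wpM2l ?(le_trans _ B1)//.
  apply: powRN_sqr_le => //; last exact: ltW.
  by have := @max1_sqn_ge z 0; rewrite addr0 normr0; apply.
move=> h h1.
apply: (@le_trans _ _ (C2 * `|h| * (1 + `|z|) `^ (- (2 * s)))); last first.
  by rewrite ler_wpM2r ?powR_ge0// ler_wpM2r// lerDr.
have [c /andP[cl cr] ->] := mean_value (sqn z) (sqn (z + h)) (is_derive_phi s N).
have c0 : 0 <= c by apply: le_trans cl; rewrite le_min !sqn_ge0.
have wc : ((1 + `|z|) / 3) ^+ 2 <= Num.max 1 c.
  move: cl; rewrite ge_min => /orP[] cl.
    apply: (@le_trans _ _ (Num.max 1 (sqn (z + 0)))); first by apply: max1_sqn_ge; rewrite normr0.
    by rewrite addr0 ge_max le_max lexx/= le_max cl orbT.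
  apply: (le_trans (max1_sqn_ge z h1)).
  by rewrite ge_max le_max lexx/= le_max cl orbT.
rewrite normrM normrM normrN [`|s|]gtr0_norm//.
apply: (@le_trans _ _ (s * (B' * (9 `^ (s + 1) * (1 + `|z|) `^ (- (2 * (s + 1))))) *
    (2 * n%:R * `|h| * (1 + `|z|)))).
  apply: ler_pM; [by rewrite mulr_ge0 ?(ltW s0)|exact: normr_ge0| |exact: sqn_modulus].
  rewrite ler_pM2l//; apply: (le_trans (phi_le _ s1 c0)).
  by rewrite ler_wpM2l ?(le_trans _ B1')//; exact: powRN_sqr_le.
have ww : (1 + `|z|) `^ (- (2 * (s + 1))) * (1 + `|z|) <= (1 + `|z|) `^ (- (2 * s)).
  rewrite -[X in _ * X]powRr1 ?(ltW w0)// -powRDr// ler_powR//; lra.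
apply: (@le_trans _ _ (C2 * `|h| * ((1 + `|z|) `^ (- (2 * (s + 1))) * (1 + `|z|)))).
  by rewrite le_eqVlt; apply/orP; left; apply/eqP; rewrite /C2; ring.
by rewrite ler_wpM2l// mulr_ge0.
Qed.

(** Each derivative replaces [s] by [s + 1], two orders of decay, and brings a coordinate, one order
    of growth. The degree is [N + 1] rather than [N] because the last derivative must still have
    Lipschitz increments. *)
Lemma Reg_phi s N : 0 < s -> Reg (Kd (- (2 * s))) N (fun z : V => phi s N.+1 (sqn z)).
Proof.
elim: N s => [|N IH] s s0; first exact: Kd_phi.
have D i x : is_derive x (e_ i) (fun z : V => phi s N.+2 (sqn z))
    (- s * phi (s + 1) N.+1 (sqn x) * (2 * x ord0 i)).
  have [dq dqE] := is_derive_sqn i x; rewrite -dqE.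
  exact: is_derive_comp_real (is_derive_phi s N.+1 (sqn x)) dq.
split; first exact: Kd_phi.
  by move=> i x; have [] := D i x.
move=> i; rewrite (_ : (fun x => _) = (fun x : V => (- s * 2) * (phi (s + 1) N.+1 (sqn x) * x ord0 i))); last first.
  by apply/funext => x; have [_ ->] := D i x; ring.
have s1 : 0 < s + 1 by rewrite addr_gt0.
apply: (@RegM _ _ (Kd 0) (Kd (- (2 * s)))); [exact: Kd_add| |by apply: Reg_cst => c; exact: Kd_cst|].
  by move=> f g f0 gs; have := Kd_mul f0 gs; rewrite add0r.
apply: (@RegM _ _ (Kd (- (2 * (s + 1)))) (Kd 1)); [exact: Kd_add| |exact: IH|exact: Reg_coord].
by move=> f g fs g1; apply: Kd_le (Kd_mul fs g1); lra.
Qed.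

End kernel_class.

(** * Pointwise estimates for the compactly supported singular kernel *)

Section singular_part.
Context (R : realType) (n : nat).
Notation V := 'rV[R]_n.
Context (s : R) (N : nat).
Hypothesis s0 : 0 < s.

(** The argument [t] stands for the squared norm, so from here on [s] is half of the exponent of the
    kernel. *)
Definition kap (t : R) : R := t `^ (- s) - phi s N.+1 t.

Definition k1 (z : V) : R := kap (sqn z).

(** Majorant, up to a constant, of what is lost by flattening the kernel inside radius [rho]: the
    singularity itself plus the plateau of height [rho^(-2s)] that replaces it. *)
Definition near_mass (rho : R) (z : V) : R :=
  if `|z| < rho then `|z| `^ (- (2 * s)) + rho `^ (- (2 * s)) else 0.

Let B := phi_bound s N.+1.
Let B_ge1 : 1 <= B. Proof. by rewrite phi_bound_ge1// ltW. Qed.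
Let B_ge0 : 0 <= B. Proof. by rewrite (le_trans _ B_ge1). Qed.

Lemma near_mass_ge0 rho z : 0 <= near_mass rho z.
Proof. by rewrite /near_mass; case: ifP => // _; rewrite addr_ge0 ?powR_ge0. Qed.

Lemma kap_ge1 t : 1 <= t -> kap t = 0.
Proof. by move=> t1; rewrite /kap /phi ltNge t1 subrr. Qed.

Lemma k1_supp (z : V) : 1 <= `|z| -> k1 z = 0.
Proof.
move=> z1; rewrite /k1 kap_ge1// (le_trans _ (sqr_norm_le_sqn z))//.
by rewrite exprn_ege1.
Qed.

Lemma phi_le_bound t : 0 <= t -> `|phi s N.+1 t| <= B.
Proof.
move=> t0; apply: (le_trans (phi_le _ (ltW s0) t0)); rewrite ler_piMr//.
have m1 : 1 <= Num.max 1 t by rewrite le_max lexx.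
by have := ler_powRN (ltW s0) ltr01 m1; rewrite powR1.
Qed.

Lemma sqn_powRN_le (z : V) : sqn z `^ (- s) <= `|z| `^ (- (2 * s)).
Proof.
rewrite (_ : sqn z `^ (- s) = enorm z `^ (- (2 * s))); last first.
  by rewrite enorm_powR; congr powR; field.
by apply: enorm_powRN_le; rewrite mulr_gt0.
Qed.

Lemma k1_bound (z : V) : `|k1 z| <= B * near_mass 1 z.
Proof.
rewrite /near_mass; case: ltP => z1; last by rewrite k1_supp// normr0 mulr0.
rewrite powR1 /k1 /kap (le_trans (ler_normB _ _))// mulrDr mulr1 lerD//.
  rewrite ger0_norm ?powR_ge0// (le_trans (sqn_powRN_le z))//.
  by rewrite ler_peMl ?powR_ge0.
by apply: phi_le_bound; exact: sqn_ge0.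
Qed.

(** The constant is the size of [t^(-s-1)] at [t = rho^2]; the derivative of [phi] is bounded, and
    [rho <= 1] lets the same power absorb it. *)
Lemma kap_lipschitz rho a b : 0 < rho -> rho <= 1 -> rho ^+ 2 <= a -> rho ^+ 2 <= b ->
  `|kap a - kap b| <= s * (2 + phi_bound (s + 1) N) * rho `^ (- (2 * s + 2)) * `|a - b|.
Proof.
move=> r0 r1 ra rb; have r20 : 0 < rho ^+ 2 by rewrite exprn_gt0.
have a0 := lt_le_trans r20 ra; have b0 := lt_le_trans r20 rb.
have E : (rho ^+ 2) `^ (- s - 1) = rho `^ (- (2 * s + 2)).
  by rewrite -powR_mulrn ?(ltW r0)// -powRrM; congr powR; ring.
have rr1 : 1 <= rho `^ (- (2 * s + 2)).
  have s2 : 0 <= 2 * s + 2 by rewrite addr_ge0// mulr_ge0// ltW.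
  by have := ler_powRN s2 r0 r1; rewrite powR1.
rewrite /kap opprD addrACA (le_trans (ler_normD _ _))//.
set r := rho `^ _; set P := phi_bound _ _.
rewrite (_ : s * (2 + P) * r * _ = s * 2 * r * `|a - b| + s * P * r * `|a - b|); last by ring.
rewrite lerD//.
  pose M := Num.max a b.
  have := @ler_powR_lipschitz R (- s) (rho ^+ 2) M a b r20.
  rewrite ra rb /M !le_max !lexx orbT => /(_ isT isT) /le_trans; apply.
  have h : (Num.max a b) `^ (- s - 1) <= (rho ^+ 2) `^ (- s - 1).
    have -> : - s - 1 = - (s + 1) by rewrite opprD.
    apply: ler_powRN; [by rewrite addr_ge0// ltW|exact: r20|by rewrite le_max ra].
  rewrite ler_wpM2r// normrN gtr0_norm// /r -E -!mulrA ler_pM2l//.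
  move: h; set x := Num.max a b `^ _; set y := (rho ^+ 2) `^ _ => h; lra.
have s1 : 0 <= s + 1 by rewrite addr_ge0// ltW.
rewrite opprK -normrN opprD opprK.
have [c /andP[cl _] ->] := mean_value b a (is_derive_phi s N).
have c0 : 0 <= c by apply: le_trans cl; rewrite le_min !ltW.
rewrite normrM ler_wpM2r// normrM normrN (gtr0_norm s0) -mulrA ler_pM2l//.
apply: (le_trans (phi_le _ s1 c0)).
rewrite ler_wpM2l ?(le_trans _ (phi_bound_ge1 _ s1))//.
have m1 : 1 <= Num.max 1 c by rewrite le_max lexx.
by apply: le_trans (rr1 : 1 <= r); have := ler_powRN s1 ltr01 m1; rewrite powR1.
Qed.

Lemma kap_trunc rho (z : V) : 0 < rho -> rho <= 1 ->
  `|kap (sqn z) - kap (Num.max (sqn z) (rho ^+ 2))| <= (2 * B + 1) * near_mass rho z.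
Proof.
move=> r0 r1; have [rz|zr] := leP (rho ^+ 2) (sqn z).
  by rewrite subrr normr0 mulr_ge0 ?near_mass_ge0// addr_ge0// mulr_ge0.
have zrho : `|z| < rho.
  rewrite -(ltr_pXn2r (n := 2)) ?nnegrE ?(ltW r0)//.
  exact: le_lt_trans (sqr_norm_le_sqn z) zr.
rewrite /near_mass zrho; set a := `|z| `^ _; set b := rho `^ _.
have b1 : 1 <= b.
  by have := ler_powRN (mulr_ge0 (ler0n _ 2) (ltW s0)) r0 r1; rewrite powR1.
have k1' : `|kap (sqn z)| <= a + B.
  rewrite /kap (le_trans (ler_normB _ _))// lerD//; last exact: phi_le_bound (sqn_ge0 z).
  by rewrite ger0_norm ?powR_ge0//; exact: sqn_powRN_le.
have k2' : `|kap (rho ^+ 2)| <= b + B.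
  rewrite /kap (le_trans (ler_normB _ _))// lerD//; last exact/phi_le_bound/sqr_ge0.
  rewrite ger0_norm ?powR_ge0// -powR_mulrn ?(ltW r0)// -powRrM /b.
  by rewrite (_ : 2%:R * - s = - (2 * s))//; ring.
have a0 : 0 <= a by exact: powR_ge0.
have : B <= B * b by rewrite ler_peMr.
have : 0 <= B * a by rewrite mulr_ge0.
apply: (fun p q => le_trans (ler_normB _ _) (le_trans (lerD k1' k2') (_ p q))) => p q.
have -> : (2 * B + 1) * (a + b) = 2 * (B * a) + 2 * (B * b) + a + b by ring.
lra.
Qed.

Lemma k1_modulus : exists2 C, 0 <= C & forall (rho : R) (z h : V),
  0 < rho -> rho <= 1 -> `|h| <= 1 ->
  `|k1 (z + h) - k1 z| <= C * near_mass rho (z + h) + C * near_mass rho z +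
     C * rho `^ (- (2 * s + 2)) * `|h| * (if `|z| < 2 then 1 else 0).
Proof.
pose D := s * (2 + phi_bound (s + 1) N).
have s1 : 0 <= s + 1 by rewrite addr_ge0// ltW.
have D0 : 0 <= D.
  by rewrite mulr_ge0 ?(ltW s0)// addr_ge0// (le_trans _ (phi_bound_ge1 _ s1)).
pose C := (2 * B + 1) + D * (6 * n%:R).
have B0 : 0 <= 2 * B + 1 by rewrite addr_ge0// mulr_ge0.
have C0 : 0 <= C by apply: addr_ge0 => //; apply: mulr_ge0 => //; exact: mulr_ge0.
exists C => // rho z h r0 r1 h1.
(* For [|z| >= 2] both points lie outside the unit ball, and both values vanish. *)
have [z2|z2] := ltP `|z| 2; last first.
  have zh1 : 1 <= `|z + h|.
    have := lerB_normD z h; lra.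
  rewrite !k1_supp//; last by rewrite (le_trans _ z2)// ler1n.
  by rewrite subrr normr0 mulr0 addr0 addr_ge0// mulr_ge0// near_mass_ge0.
rewrite mulr1 /k1.
have H1 := kap_trunc (z + h) r0 r1; have H2 := kap_trunc z r0 r1.
set m1 := Num.max (sqn (z + h)) (rho ^+ 2) in H1 *.
set m2 := Num.max (sqn z) (rho ^+ 2) in H2 *.
have H3 : `|kap m1 - kap m2| <= D * rho `^ (- (2 * s + 2)) * (6 * n%:R * `|h|).
  apply: (le_trans (kap_lipschitz r0 r1 _ _)); rewrite ?le_max ?lexx ?orbT//.
  apply: ler_wpM2l; first by apply: mulr_ge0 => //; exact: powR_ge0.
  apply: (@le_trans _ _ `|sqn (z + h) - sqn z|).
    rewrite /m1 /m2; move: (sqn (z + h)) (sqn z) (rho ^+ 2) => x y c.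
    have [xc|cx] := leP x c; have [yc|cy] := leP y c.
    - by rewrite subrr normr0.
    - rewrite !ler0_norm ?subr_le0 ?(ltW cy)//; first lra.
      exact: le_trans xc (ltW cy).
    - rewrite !ger0_norm ?subr_ge0 ?(ltW cx)//; first lra.
      exact: le_trans yc (ltW cx).
    - exact: lexx.
  apply: (le_trans (sqn_modulus _ h1)).
  rewrite (_ : 6 * n%:R * `|h| = 2 * n%:R * `|h| * 3); last by ring.
  by rewrite ler_wpM2l ?mulr_ge0//; lra.
have -> : kap (sqn (z + h)) - kap (sqn z) = (kap (sqn (z + h)) - kap m1) -
  (kap (sqn z) - kap m2) + (kap m1 - kap m2) by ring.
have DC0 : 0 <= D * (6 * n%:R) by apply: mulr_ge0 => //; exact: mulr_ge0.
have BC : 2 * B + 1 <= C by rewrite lerDl.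
have DC : D * (6 * n%:R) <= C by rewrite lerDr.
apply: (le_trans (ler_normD _ _)); apply: lerD.
  apply: (le_trans (ler_normB _ _)); apply: lerD.
    by apply: (le_trans H1); apply: ler_wpM2r BC; exact: near_mass_ge0.
  by apply: (le_trans H2); apply: ler_wpM2r BC; exact: near_mass_ge0.
apply: (le_trans H3).
rewrite (_ : D * _ * _ = D * (6 * n%:R) * rho `^ (- (2 * s + 2)) * `|h|); last by ring.
apply: ler_wpM2r; first exact: normr_ge0.
by apply: ler_wpM2r DC; exact: powR_ge0.
Qed.

End singular_part.

Lemma Rintegral_dominated d (T : measurableType d) (R : realType)
    (mu : {measure set T -> \bar R}) (F G : T -> R) (M : R) :
  measurable_fun [set: T] F -> measurable_fun [set: T] G ->
  (forall y, `|F y| <= G y) -> (\int[mu]_y (G y)%:E <= M%:E)%E ->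
  mu.-integrable [set: T] (EFin \o F) /\ `|\int[mu]_y F y| <= M.
Proof.
move=> mF mG FG GM.
have mF' : measurable_fun [set: T] (EFin \o F) by exact/measurable_EFinP.
have mG' : measurable_fun [set: T] (EFin \o G) by exact/measurable_EFinP.
have H : (\int[mu]_y `|(F y)%:E| <= M%:E)%E.
  apply: le_trans GM; apply: ge0_le_integral.
  - exact: measurableT.
  - by move=> y _.
  - exact: measurableT_comp mF'.
  - exact: mG'.
  - by move=> y _; rewrite abse_EFin lee_fin.
have iF : mu.-integrable [set: T] (EFin \o F).
  by apply/integrableP; split => //; rewrite (le_lt_trans H)// ltry.
split => //; rewrite -lee_fin EFin_normr_Rintegral//.
exact: le_trans (le_abse_integral mu measurableT mF') H.
Qed.

(** * Convolution with a smooth kernel of sufficient decay *)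

Section convolution.
Context (R : realType) (n : nat).
Notation V := 'rV[R]_n.
Notation T := (lebesgue_space R n).
Notation mu := (lebesgue_Rn R n).
Notation e_ i := (@basis_vector R n i).

Definition conv (K g : V -> R) (x : V) : R := \int[mu]_y (K (x - y) * g y).

Lemma measurable_reflect (K : V -> R) (x : V) :
  continuous K -> measurable_fun [set: T] (fun y : T => K (x - y)).
Proof.
move=> cK; apply: continuous_measurable_Rn => y.
apply: (@continuous_comp _ _ _ (fun z : V => x - z) K); last exact: cK.
by apply: continuousB; [exact: cst_continuous|move=> ?; exact: cvg_id].
Qed.

Lemma conv_translate (K g : V -> R) (x h : V) :
  measurable_fun [set: T] (fun y : T => K (x + h - y) * g y) ->
  conv K g (x + h) = conv K (fun y => g (y + h)) x.
Proof.
move=> mF; rewrite /conv /Rintegral; congr fine.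
rewrite -(@integral_translate R n h); last exact/measurable_EFinP.
by apply: eq_integral => y _; rewrite /translate opprD addrACA subrr addr0 addrC.
Qed.

Lemma norm_basis_vector i : `|e_ i| <= 1.
Proof.
by apply: norm_le_coord => // j; rewrite /basis_vector mxE; case: (_ && _);
  rewrite ?normr1 ?normr0.
Qed.

Lemma line_mean_value (K : V -> R) (z e : V) t : (forall x, derivable K x e) ->
  exists2 c, `|c| <= `|t| & K (z + t *: e) - K z = t * 'D_e K (z + c *: e).
Proof.
move=> DK; have D a : is_derive a (1 : R) (fun a => K (z + a *: e)) ('D_e K (z + a *: e)).
  by apply: (is_derive_line K z e a _).1; exact: derivableP.
have [c /andP[c1 c2] E] := mean_value 0 t D.
exists c; last by rewrite mulrC -[X in _ = _ * X]subr0 -E scale0r addr0.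
have [t0|t0] := leP 0 t; move: c1 c2.
  by rewrite min_l// max_r// => c1 c2; rewrite !ger0_norm.
rewrite min_r ?(ltW t0)// max_l ?(ltW t0)// => c1 c2.
by rewrite !ler0_norm ?lerN2// ltW.
Qed.

Section smooth_kernel.
Context (s : R) (f : V -> R).
Hypothesis s0 : 0 <= s.
Hypothesis mf : measurable_fun [set: T] (f : T -> R).
Hypothesis fw : (\int[mu]_y (`|f y| * (1 + `|y : V|) `^ (- s))%:E < +oo)%E.

Let mw : measurable_fun [set: T] (fun y : T => `|f y| * (1 + `|y : V|) `^ (- s)).
Proof.
apply: measurable_funM; first exact: measurableT_comp mf.
apply: (measurableT_comp (measurable_powR _)).
apply: measurable_funD; first exact: measurable_cst.
by apply: continuous_measurable_Rn => x; exact: norm_continuous.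
Qed.

Let W := fine (\int[mu]_y (`|f y| * (1 + `|y : V|) `^ (- s))%:E)%E.

Let WE : (\int[mu]_y (`|f y| * (1 + `|y : V|) `^ (- s))%:E)%E = W%:E.
Proof.
rewrite fineK// ge0_fin_numE//.
by apply: integral_ge0 => y _; rewrite lee_fin mulr_ge0 ?powR_ge0.
Qed.

(** Peetre's inequality [1 + |y| <= (1 + |x|) (1 + |x - y|)], raised to the power [-s]. *)
Lemma weight_shift (r : R) (x y : V) : `|x| <= r ->
  (1 + `|x - y|) `^ (- s) <= (1 + r) `^ s * (1 + `|y|) `^ (- s).
Proof.
move=> xr; have r0 : 0 <= r := le_trans (normr_ge0 x) xr.
have r1 : 0 < 1 + r by rewrite ltr_pwDl.
have y1 : 0 < 1 + `|y| by rewrite ltr_pwDl.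
have -> : (1 + r) `^ s * (1 + `|y|) `^ (- s) = ((1 + `|y|) / (1 + r)) `^ (- s).
  rewrite powRM ?invr_ge0 ?(ltW r1) ?(ltW y1)// mulrC; congr (_ * _).
  by rewrite -powR_inv1 ?(ltW r1)// -powRrM mulrNN mul1r.
apply: ler_powRN => //; first by rewrite divr_gt0.
rewrite ler_pdivrMr//.
have : `|y| <= `|x - y| + `|x|.
  by rewrite -{1}(subKr x y) (le_trans (ler_normB _ _))// addrC.
have := normr_ge0 (x - y); nra.
Qed.

Lemma conv_weighted (K : V -> R) C r (x : V) : 0 <= C -> `|x| <= r ->
  measurable_fun [set: T] (fun y : T => K (x - y)) ->
  (forall z, `|K z| <= C * (1 + `|z|) `^ (- s)) ->
  mu.-integrable [set: T] (EFin \o (fun y => K (x - y) * f y)) /\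
  `|conv K f x| <= C * ((1 + r) `^ s * W).
Proof.
move=> C0 xr mK KC; have mF : measurable_fun [set: T] (fun y : T => K (x - y) * f y).
  exact: measurable_funM.
apply: (@Rintegral_dominated _ T R mu (fun y : V => K (x - y) * f y)
  (fun y : V => C * (1 + r) `^ s * (`|f y| * (1 + `|y|) `^ (- s))) _ mF).
- by apply: measurable_funM; [exact: measurable_cst|exact: mw].
- move=> y; rewrite normrM mulrC mulrCA ler_wpM2l// (le_trans (KC _))//.
  by rewrite -mulrA ler_wpM2l// weight_shift.
under eq_integral do rewrite EFinM.
rewrite ge0_integralZl_EFin; last 4 first.
- exact: measurableT.
- by move=> y _; rewrite lee_fin mulr_ge0 ?powR_ge0.
- exact/measurable_EFinP.
- by rewrite mulr_ge0 ?powR_ge0.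
by rewrite WE -EFinM mulrA.
Qed.

Lemma Kd_continuous d (K : V -> R) : Kd d K -> continuous K.
Proof.
move=> /Kd_bound[C C0 HC]; apply: (@LH_continuous _ _ 1) => // r.
have w2 (x : V) : `|x| <= r -> (1 + `|x|) `^ d <= (2 + r) `^ `|d|.
  move=> xr; apply: (@le_trans _ _ ((1 + `|x|) `^ `|d|)).
    by apply: ler_powR; [rewrite lerDl|exact: ler_norm].
  by apply: ge0_ler_powR; rewrite ?nnegrE ?addr_ge0//; have := normr_ge0 x; lra.
exists (C * (2 + r) `^ `|d|) => x xr; have [Kx HK] := HC x; split.
  by rewrite (le_trans Kx)// ler_wpM2l// w2.
move=> h h1; rewrite powRr1// (le_trans (HK h h1))// mulrAC ler_wpM2r// ler_wpM2l// w2//.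
Qed.

(** All derivatives go to the kernel. The first-order remainder [L] of [K] is bounded by [t^2] times
    the weight, by the mean value theorem and the Lipschitz bound on the derivative, so its
    convolution is the remainder of [conv K f]. *)
Lemma Reg_conv_smooth k (K : V -> R) : Reg (Kd (- s)) k K -> Reg (LH 1) k (conv K f).
Proof.
have base (L : V -> R) : Kd (- s) L -> LH 1 (conv L f).
  move=> LK r; have [C C0 HC] := Kd_bound LK.
  have cL := Kd_continuous LK.
  exists (C * ((1 + r) `^ s * W)) => x xr.
  have iL (z : V) : mu.-integrable [set: T] (EFin \o (fun y => L (z - y) * f y)).
    have [] // := @conv_weighted L C `|z| z C0 (lexx _) (measurable_reflect z cL).
    by move=> y; exact: (HC y).1.
  split.
    have [] // := conv_weighted C0 xr (measurable_reflect x cL).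
    by move=> y; exact: (HC y).1.
  move=> h h1; rewrite powRr1//.
  have mm : measurable_fun [set: T] (fun y : T => (fun z => L (z + h) - L z) (x - y)).
    apply: measurable_funB; last exact: (measurable_reflect x cL).
    under eq_fun do rewrite addrAC.
    exact: (measurable_reflect (x + h) cL).
  have [] := @conv_weighted (fun z => L (z + h) - L z) (C * `|h|) r x _ xr mm.
  - by rewrite mulr_ge0.
  - by move=> z; exact: (HC z).2.
  rewrite (_ : conv _ f x = conv L f (x + h) - conv L f x).
    by move=> _; rewrite mulrAC.
  rewrite /conv -RintegralB//; apply: eq_Rintegral => y _.
  by rewrite mulrBl addrAC.
elim: k K => [|k IH] K; first exact: base.
move=> [KK DK HK]; have D i x : is_derive x (e_ i) (conv K f) (conv (fun z => 'D_(e_ i) K z) f x).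
  have [C C0 HC] := Kd_bound (Reg_base (HK i)).
  have cD := Kd_continuous (Reg_base (HK i)); have cK := Kd_continuous KK.
  have [CK CK0 HCK] := Kd_bound KK.
  apply: (@is_derive_modulus _ _ _ _ _ _ (C * ((1 + `|x|) `^ s * W)) 1) => // t t1.
  rewrite powRr1//.
  pose L z := K (z + t *: e_ i) - K z - t * 'D_(e_ i) K z.
  have ht : `|t *: e_ i| <= `|t|.
    by rewrite normrZ ler_piMr// norm_basis_vector.
  have mL : measurable_fun [set: T] (fun y : T => L (x - y)).
    apply: measurable_funB; last first.
      by apply: measurable_funM; [exact: measurable_cst|exact: (measurable_reflect x cD)].
    apply: measurable_funB; last exact: (measurable_reflect x cK).
    under eq_fun do rewrite addrAC.
    exact: (measurable_reflect (x + t *: e_ i) cK).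
  have [] := @conv_weighted L (C * `|t| * `|t|) `|x| x _ (lexx _) mL.
  - by rewrite !mulr_ge0.
  - move=> z; have [c ct Ec] := line_mean_value z t (DK i).
    rewrite /L Ec -mulrBr normrM.
    have hc : `|c *: e_ i| <= `|t| by rewrite normrZ (le_trans _ ct)// ler_piMr// norm_basis_vector.
    have := (HC z).2 (c *: e_ i) (le_trans hc t1) => H.
    rewrite (_ : C * `|t| * `|t| * _ = `|t| * (C * `|t| * (1 + `|z|) `^ (- s))); last by ring.
    apply: ler_wpM2l => //; apply: (le_trans H).
    by rewrite ler_wpM2r ?powR_ge0// ler_wpM2l.
  have iK (z : V) : mu.-integrable [set: T] (EFin \o (fun y => K (z - y) * f y)).
    have [] // := @conv_weighted K CK `|z| z CK0 (lexx _) (measurable_reflect z cK).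
    by move=> y; exact: (HCK y).1.
  have iD : mu.-integrable [set: T] (EFin \o (fun y => 'D_(e_ i) K (x - y) * f y)).
    have [] // := @conv_weighted (fun z => 'D_(e_ i) K z) C `|x| x C0 (lexx _) (measurable_reflect x cD).
    by move=> y; exact: (HC y).1.
  have itD : mu.-integrable [set: T] (EFin \o (fun y => t * ('D_(e_ i) K (x - y) * f y))).
    by have := integrableZl measurableT t iD; apply: eq_integrable.
  have iKK : mu.-integrable [set: T]
      (EFin \o (fun y => K (x + t *: e_ i - y) * f y - K (x - y) * f y)).
    by have := integrableB measurableT (iK (x + t *: e_ i)) (iK x); apply: eq_integrable.
  rewrite (_ : conv L f x = conv K f (x + t *: e_ i) - conv K f x -
      t * conv (fun z => 'D_(e_ i) K z) f x).
    move=> _ H; apply: (le_trans H); rewrite le_eqVlt; apply/orP; left; apply/eqP; ring.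
  rewrite /conv -RintegralZl// -RintegralB// -RintegralB//; apply: eq_Rintegral => y _.
  by rewrite /L [x + _ - y]addrAC; ring.
split; first exact: base.
  by move=> i x; have [] := D i x.
move=> i; rewrite (_ : (fun x => _) = conv (fun z => 'D_(e_ i) K z) f); first exact: IH (HK i).
by apply/funext => x; have [_ ->] := D i x.
Qed.

End smooth_kernel.

End convolution.

(** * Hoelder gain of the convolution with the singular kernel *)

Section singular_convolution.
Context (R : realType) (n : nat).
Notation V := 'rV[R]_n.
Notation T := (lebesgue_space R n).
Notation mu := (lebesgue_Rn R n).
Notation e_ i := (@basis_vector R n i).
Context (s : R) (N : nat).
Hypothesis s0 : 0 < s.
Hypothesis sn : 2 * s < n%:R.
Notation k1 := (@k1 R n s N).

(* Cutting [k1] off at radius [|h|^(1 / (n + 2))] balances the mass removed,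
   of order [rho^(n - 2 s)], and the gradient left, of order [rho^(-2 s - 2)]. *)
Definition hoelder_gain : R := (n%:R - 2 * s) / (n%:R + 2).
Notation beta := hoelder_gain.

Let n2 : 0 < n%:R + 2 :> R. Proof. by rewrite ltr_wpDl. Qed.

Lemma hoelder_gain_gt0 : 0 < beta.
Proof. by rewrite divr_gt0// subr_gt0. Qed.

Lemma hoelder_gain_lt1 : beta < 1.
Proof.
rewrite /hoelder_gain ltr_pdivrMr// mul1r ltrD2l (lt_trans _ (ltr0Sn R 1))//.
by rewrite oppr_lt0 mulr_gt0.
Qed.

Lemma measurable_k1 (x : V) : measurable_fun [set: T] (fun y : T => k1 (x - y)).
Proof.
apply: measurable_funB.
  apply: (measurableT_comp (measurable_powR _)).
  have := measurableT_comp (@measurable_sqnB R n) (@measurable_pair1 _ _ T T x).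
  by [].
apply: (@measurable_reflect _ _ (fun z => phi s N.+1 (sqn z))).
exact: Kd_continuous (@Kd_phi R n s N s0).
Qed.

Lemma near_mass_restrict rho (x : V) :
  (fun y : V => (near_mass s rho (x - y))%:E) =
  (fun y : V => (`|x - y| `^ (- (2 * s)))%:E + (rho `^ (- (2 * s)))%:E)%E
    \_ [set y : V | `|x - y| < rho].
Proof.
apply/funext => y; rewrite patchE /near_mass; case: ifPn => h.
  by rewrite mem_set.
by rewrite memNset//=; exact/negP.
Qed.

Lemma measurable_near_mass rho (x : V) :
  measurable_fun [set: T] (fun y : T => near_mass s rho (x - y)).
Proof.
suff H : measurable_fun [set: T] (fun y : V => (near_mass s rho (x - y))%:E).
  exact/measurable_EFinP.
rewrite near_mass_restrict; apply/(measurable_restrictT _ (@measurable_ball_Rn R n x rho)).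
apply: measurable_funTS; apply: emeasurable_funD; last exact: measurable_cst.
by apply/measurable_EFinP; exact: measurable_normB_powR.
Qed.

Lemma near_mass_integral : exists2 M, 0 <= M & forall rho (x : V), 0 < rho ->
  (\int[mu]_y (near_mass s rho (x - y))%:E <= (M * rho `^ (n%:R - 2 * s))%:E)%E.
Proof.
have s2 : 0 <= 2 * s by rewrite mulr_ge0// ltW.
have [C C0 HC] := integral_riesz_near s2 sn.
exists (C + 2 ^+ n); first by rewrite addr_ge0 ?exprn_ge0// ltW.
move=> rho x r0; rewrite near_mass_restrict -integral_mkcond.
rewrite ge0_integralD; last 5 first.
- exact: measurable_ball_Rn.
- by move=> y _; rewrite lee_fin powR_ge0.
- by apply: measurable_funTS; apply/measurable_EFinP; exact: measurable_normB_powR.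
- by move=> y _; rewrite lee_fin powR_ge0.
- exact: measurable_cst.
rewrite [(C + _) * _]mulrDl EFinD; apply: leeD; first exact: HC.
rewrite integral_cst; last exact: measurable_ball_Rn.
apply: (@le_trans _ _ ((rho `^ (- (2 * s)))%:E * ((2 * rho) ^+ n)%:E)%E).
  by rewrite lee_wpmul2l ?lee_fin ?powR_ge0//; exact: lebesgue_Rn_ball.
rewrite -EFinM lee_fin exprMn -(powR_mulrn n (ltW r0)) mulrCA -powRDr//.
by rewrite [- _ + _]addrC.
Qed.

Lemma conv_k1_bound : exists2 M, 0 <= M & forall (g : V -> R) (x : V) G,
  measurable_fun [set: T] (g : T -> R) -> 0 <= G ->
  (forall y : V, `|x - y| < 1 -> `|g y| <= G) ->
  mu.-integrable [set: T] (EFin \o (fun y => k1 (x - y) * g y)) /\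
  `|conv k1 g x| <= M * G.
Proof.
have [M M0 HM] := near_mass_integral.
pose B := phi_bound s N.+1.
have B0 : 0 <= B by rewrite (le_trans _ (phi_bound_ge1 _ (ltW s0))).
exists (B * M); first exact: mulr_ge0.
move=> g x G mg G0 gG.
have mF : measurable_fun [set: T] (fun y : T => k1 (x - y) * g y).
  by apply: measurable_funM; [exact: measurable_k1|exact: mg].
apply: (@Rintegral_dominated _ T R mu (fun y : V => k1 (x - y) * g y)
  (fun y : V => B * G * near_mass s 1 (x - y)) _ mF).
- by apply: measurable_funM; [exact: measurable_cst|exact: measurable_near_mass].
- move=> y; rewrite normrM; have [z1|z1] := ltP `|x - y| 1.
    rewrite mulrAC; apply: ler_pM => //; first exact: k1_bound.
    exact: gG.
  by rewrite k1_supp// normr0 mul0r !mulr_ge0 ?near_mass_ge0.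
under eq_integral do rewrite EFinM.
rewrite ge0_integralZl_EFin; last 4 first.
- exact: measurableT.
- by move=> y _; rewrite lee_fin near_mass_ge0.
- by apply/measurable_EFinP; exact: measurable_near_mass.
- exact: mulr_ge0.
apply: (@le_trans _ _ ((B * G)%:E * (M * 1 `^ (n%:R - 2 * s))%:E)%E).
  by rewrite lee_wpmul2l ?lee_fin ?mulr_ge0//; exact: HM.
by rewrite powR1 mulr1 -EFinM lee_fin mulrAC.
Qed.

(** [M] does not depend on [g], which enters only through its bound [G] near [x]: this makes the
    estimate applicable to increments of a function in place of [g]. *)
Lemma conv_k1_modulus : exists2 M, 0 <= M & forall (g : V -> R) (x h : V) G,
  measurable_fun [set: T] (g : T -> R) -> 0 <= G -> `|h| <= 1 ->
  (forall y : V, `|x - y| < 2 -> `|g y| <= G) ->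
  `|conv k1 g (x + h) - conv k1 g x| <= M * G * `|h| `^ beta.
Proof.
have [M M0 HM] := near_mass_integral.
have [C C0 HC] := @k1_modulus R n s N s0.
have [M1 M10 HM1] := conv_k1_bound.
exists (2 * C * M + C * 4 ^+ n); first by rewrite addr_ge0// !mulr_ge0.
move=> g x h G mg G0 h1 gG.
have [->|h0] := eqVneq h 0.
  by rewrite addr0 subrr normr0 !mulr_ge0 ?powR_ge0// addr_ge0 ?mulr_ge0 ?exprn_ge0.
have hn0 : 0 < `|h| by rewrite normr_gt0.
pose rho := `|h| `^ (n%:R + 2)^-1.
have r0 : 0 < rho by rewrite powR_gt0.
have r1 : rho <= 1.
  have ni : 0 <= (n%:R + 2)^-1 :> R by rewrite invr_ge0 ltW.
  by have := ge0_ler_powR ni; move=> /(_ `|h| 1); rewrite !nnegrE powR1; apply.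
have i1 : mu.-integrable [set: T] (EFin \o (fun y => k1 (x - y) * g y)).
  have [] // := HM1 g x G mg G0.
  by move=> y xy; apply: gG; rewrite (lt_trans xy)// ltr1n.
have i2 : mu.-integrable [set: T] (EFin \o (fun y => k1 (x + h - y) * g y)).
  have [] // := HM1 g (x + h) G mg G0.
  move=> y xy; apply: gG; rewrite -(addrK h (x - y)) (le_lt_trans (ler_normB _ _))//.
  by rewrite addrAC (_ : 2 = 1 + 1)// ltr_leD.
rewrite /conv -(RintegralB measurableT i2 i1).
pose I := fun y : V => if `|x - y| < 2 then 1 else 0 : R.
have IE : (fun y : V => (I y)%:E) = (fun y : V => (\1_[set y : V | `|x - y| < 2] y)%:E).
  apply/funext => y; rewrite indicE /I; case: ifPn => h'; first by rewrite mem_set.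
  by rewrite memNset//=; exact/negP.
have mI : measurable_fun [set: T] (fun y : T => (I y)%:E).
  by rewrite IE; apply/measurable_EFinP/measurable_indic; exact: measurable_ball_Rn.
pose a := C * G; have a0 : 0 <= a by rewrite mulr_ge0.
pose b := a * rho `^ (- (2 * s + 2)) * `|h|.
have b0 : 0 <= b by rewrite !mulr_ge0 ?powR_ge0.
refine (proj2 (@Rintegral_dominated _ T R mu
  (fun y : V => k1 (x + h - y) * g y - k1 (x - y) * g y)
  (fun y : V => a * near_mass s rho (x + h - y) + a * near_mass s rho (x - y) + b * I y)
  ((2 * C * M + C * 4 ^+ n) * G * `|h| `^ beta) _ _ _ _)).
- by apply: measurable_funB; apply: measurable_funM; [exact: measurable_k1|exact: mg|exact: measurable_k1|exact: mg].
- apply: measurable_funD; first apply: measurable_funD.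
  + by apply: measurable_funM; [exact: measurable_cst|exact: measurable_near_mass].
  + by apply: measurable_funM; [exact: measurable_cst|exact: measurable_near_mass].
  + by apply: measurable_funM; [exact: measurable_cst|exact/measurable_EFinP].
- move=> y; rewrite -mulrBl normrM (_ : x + h - y = (x - y) + h); last by rewrite addrAC.
  have [z2|z2] := ltP `|x - y| 2.
    rewrite mulrC; apply: (le_trans (ler_pM _ _ (gG y z2) (HC rho (x - y) h r0 r1 h1))) => //.
    rewrite /b /a /I z2; move: (near_mass _ _ _) (near_mass _ _ _) (_ `^ _) (`|h|) => p q r' t.
    by rewrite le_eqVlt; apply/orP; left; apply/eqP; ring.
  have zh1 : 1 <= `|x - y + h| by have := lerB_normD (x - y) h; lra.
  rewrite !k1_supp//; last by rewrite (le_trans _ z2)// ler1n.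
  rewrite subrr normr0 mul0r; apply: addr_ge0.
    by apply: addr_ge0; apply: mulr_ge0; rewrite ?near_mass_ge0.
  by apply: mulr_ge0; rewrite // /I; case: ifP.
have na (z : V) : (0 <= \int[mu]_y (a * near_mass s rho (z - y))%:E <= (a * (M * rho `^ (n%:R - 2 * s)))%:E)%E.
  apply/andP; split.
    by apply: integral_ge0 => y _; rewrite lee_fin mulr_ge0 ?near_mass_ge0.
  under eq_integral do rewrite EFinM.
  rewrite ge0_integralZl_EFin; last 4 first.
  - exact: measurableT.
  - by move=> y _; rewrite lee_fin near_mass_ge0.
  - by apply/measurable_EFinP; exact: measurable_near_mass.
  - exact: a0.
  by rewrite (EFinM a); apply: lee_wpmul2l; [rewrite lee_fin|exact: HM].
have mna (z : V) : measurable_fun [set: T] (fun y : T => (a * near_mass s rho (z - y))%:E).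
  apply/measurable_EFinP; apply: measurable_funM; first exact: measurable_cst.
  exact: measurable_near_mass.
under eq_integral do rewrite !EFinD.
rewrite ge0_integralD; last 5 first.
- exact: measurableT.
- by move=> y _; rewrite -EFinD lee_fin addr_ge0// mulr_ge0 ?near_mass_ge0.
- by apply: emeasurable_funD; exact: mna.
- by move=> y _; rewrite lee_fin mulr_ge0// /I; case: ifP.
- by under eq_fun do rewrite EFinM; apply: emeasurable_funM; [exact: measurable_cst|exact: mI].
rewrite ge0_integralD; last 5 first.
- exact: measurableT.
- by move=> y _; rewrite lee_fin mulr_ge0 ?near_mass_ge0.
- exact: mna.
- by move=> y _; rewrite lee_fin mulr_ge0 ?near_mass_ge0.
- exact: mna.
have /andP[_ n1] := na (x + h); have /andP[_ n2'] := na x.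
have n3 : (\int[mu]_y (b * I y)%:E <= (b * 4 ^+ n)%:E)%E.
  under eq_integral do rewrite EFinM.
  rewrite ge0_integralZl_EFin; last 4 first.
  - exact: measurableT.
  - by move=> y _; rewrite lee_fin /I; case: ifP.
  - exact: mI.
  - exact: b0.
  rewrite (EFinM b); apply: lee_wpmul2l; first by rewrite lee_fin.
  rewrite IE integral_indic//; last exact: measurable_ball_Rn.
  rewrite setIT (_ : 4 = 2 * 2 :> R); last by lra.
  by apply: lebesgue_Rn_ball.
apply: (le_trans (leeD (leeD n1 n2') n3)).
rewrite -!EFinD lee_fin le_eqVlt; apply/orP; left; apply/eqP.
have e1 : rho `^ (n%:R - 2 * s) = `|h| `^ beta by rewrite /rho -powRrM mulrC.
(* The balance of exponents: [1 - (2s + 2)/(n + 2) = (n - 2s)/(n + 2)]. *)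
have e2 : rho `^ (- (2 * s + 2)) * `|h| = `|h| `^ beta.
  rewrite /rho -powRrM -[X in _ * X]powRr1// -powRDr//; congr powR.
  by rewrite /hoelder_gain; field; rewrite gt_eqF.
by rewrite /b -(mulrA a) e1 e2 /a; ring.
Qed.

End singular_convolution.

(** * Functional inequalities solved along dyadic scales *)

Section dyadic_scales.
Context (R : realType).
Notation hf := (2^-1 : R).

Let hf_gt0 : 0 < hf. Proof. by rewrite invr_gt0. Qed.
Let hf_ge0 : 0 <= hf. Proof. by rewrite invr_ge0. Qed.
Let hf_lt1 : hf < 1. Proof. by rewrite invf_lt1// ltr1n. Qed.

Lemma dyadic_scale (t : R) : 0 < t -> t <= 1 -> exists j, hf ^+ j.+1 < t <= hf ^+ j.
Proof.
move=> t0 t1; have [m Hm] : exists m, t^-1 < 2 ^+ m by apply: exprn_unbounded; rewrite ltr1n.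
have ex : exists m, t^-1 < 2 ^+ m by exists m.
case: (ex_minnP ex) => -[|j] Hj min.
  by move: Hj; rewrite expr0 invf_lt1// ltNge t1.
exists j; rewrite !exprVn invf_plt ?posrE ?exprn_gt0// Hj/=.
rewrite -[leLHS]invrK lef_pV2 ?posrE ?exprn_gt0 ?invr_gt0// leNgt.
by apply/negP => /min; rewrite ltnn.
Qed.

Lemma le_add_geometric (x a K rho : R) : 0 <= rho -> rho < 1 ->
  (forall m, x <= a + K * rho ^+ m) -> x <= a.
Proof.
move=> r0 r1 H; rewrite leNgt; apply/negP => ax.
have K0 : 0 < K.
  by have := H 0%N; rewrite expr0 mulr1; lra.
have [rho0|rho0] := eqVneq rho 0.
  by have := H 1%N; rewrite rho0 expr1 mulr0; lra.
have rp : 0 < rho by rewrite lt_def rho0.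
have [m Hm] : exists m, K / (x - a) < rho^-1 ^+ m.
  by apply: exprn_unbounded; rewrite invf_gt1.
have := H m; apply/negP; rewrite -ltNge -ltrBrDl mulrC -ltr_pdivlMl ?exprn_gt0//.
by move: Hm; rewrite ltr_pdivrMr ?subr_gt0// exprVn.
Qed.

(** With [A = C / (1 - rho)], every [a i - A rho^i] lies below every [a j + A rho^j], so the
    supremum of the former is within the claimed distance of each [a j]. *)
Lemma geometric_limit (a : nat -> R) (C rho : R) : 0 <= rho -> rho < 1 ->
  (forall j, `|a j.+1 - a j| <= C * rho ^+ j) ->
  exists d, forall j, `|a j - d| <= C / (1 - rho) * rho ^+ j.
Proof.
move=> r0 r1 H; have r1' : 0 < 1 - rho by rewrite subr_gt0.
have tele j m : `|a (j + m)%N - a j| <= C / (1 - rho) * (rho ^+ j - rho ^+ (j + m)).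
  elim: m => [|m IH]; first by rewrite addn0 !subrr normr0 mulr0.
  rewrite addnS -(subrKA (a (j + m)%N)) (le_trans (ler_normD _ _))//.
  apply: (le_trans (lerD (H _) IH)); rewrite le_eqVlt; apply/orP; left; apply/eqP.
  by rewrite exprSr; field; rewrite gt_eqF.
have C0 : 0 <= C by have := H 0%N; rewrite mulr1; exact: le_trans.
pose A := C / (1 - rho); have A0 : 0 <= A by rewrite divr_ge0// ltW.
have bc i j : a i - A * rho ^+ i <= a j + A * rho ^+ j.
  have p0 k : 0 <= A * rho ^+ k by rewrite mulr_ge0// exprn_ge0.
  have /orP[ij|ij] := leq_total i j.
    have := tele i (j - i)%N; rewrite subnKC// -/A mulrBr ler_norml.
    have := p0 j; lra.
  have := tele j (i - j)%N; rewrite subnKC// -/A mulrBr ler_norml.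
  have := p0 i; lra.
pose S := range (fun j => a j - A * rho ^+ j).
have S0 : S !=set0 by exists (a 0%N - A * rho ^+ 0), 0%N.
exists (sup S) => j; rewrite -/A ler_distl; apply/andP; split.
  by rewrite lerBlDr; apply: ge_sup => // _ [i _ <-]; exact: bc.
rewrite -lerBlDr; have ubS : has_ubound S by exists (a j + A * rho ^+ j) => _ [i _ <-].
by apply: (ub_le_sup ubS); exists j.
Qed.

(* Each halving costs a factor [1/2], which beats [2^-s] because [s < 1]. *)
Lemma dyadic_holder (V : normedModType R) (D : V -> R) (B C s : R) : 0 < s -> s < 1 -> 0 <= C ->
  (forall h, `|h| <= 1 -> `|D h| <= B) ->
  (forall h, `|h| <= 1 -> `|D (2 *: h) - 2 * D h| <= C * `|h| `^ s) ->
  forall h, `|h| <= 1 ->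
    `|D h| <= Num.max B (C * hf `^ s / (2 * hf `^ s - 1)) / hf `^ s * `|h| `^ s.
Proof.
move=> s0 s1 C0 DB D2; set th := hf `^ s.
have th0 : 0 < th by exact: powR_gt0.
have th2 : hf < th.
  by rewrite -[ltLHS]powRr1 ?ltW// /th /powR gt_eqF// ltr_expR ltr_nM2r// ln_lt0// hf_gt0.
have t1 : 0 < 2 * th - 1 by have := th2; lra.
(* [B] starts the induction on scales; the other entry gives [A + C th <= 2 A th], which closes the
   step from [2h] to [h]. *)
set A := Num.max B _.
have AC : C * th <= A * (2 * th - 1).
  by rewrite -ler_pdivrMr// le_max lexx orbT.
have A0 : 0 <= A by rewrite le_max; apply/orP; right; rewrite !mulr_ge0// ?invr_ge0 ltW.
have key j h : `|h| <= hf ^+ j -> `|D h| <= A * th ^+ j.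
  elim: j h => [|j IH] h hj; first by rewrite mulr1 le_max DB.
  have h1 : `|h| <= 1.
    by rewrite (le_trans hj)// exprn_ile1// ltW.
  have h2 : `|2 *: h| <= hf ^+ j.
    rewrite normrZ ger0_norm// -ler_pdivlMl//.
    by rewrite -exprS.
  have H1 := IH _ h2; have H2 := D2 h h1.
  have H3 : `|h| `^ s <= th ^+ j.+1.
    rewrite -powR_exprl ?hf_ge0//; apply: (ge0_ler_powR (ltW s0));
      by rewrite ?nnegrE ?exprn_ge0 ?hf_ge0.
  have H4 : 2 * `|D h| <= `|D (2 *: h)| + `|D (2 *: h) - 2 * D h|.
    rewrite -[2 in X in X <= _](@ger0_norm _ 2)// -normrM distrC.
    by rewrite -{1}[2 * D h](subrK (D (2 *: h))) addrC (le_trans (ler_normD _ _)).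
  have H5 : C * `|h| `^ s <= C * th ^+ j.+1 by rewrite ler_wpM2l.
  have H6 : 0 <= th ^+ j by rewrite exprn_ge0// ltW.
  have := ler_wpM2r H6 AC; rewrite exprS in H5 *; nra.
have D0 : D 0 = 0.
  have := D2 0; rewrite normr0 scaler0 powR0 ?gt_eqF// mulr0 => /(_ ler01).
  by rewrite normr_le0 mulr2n mulrDl mul1r opprD addrA subrr sub0r oppr_eq0 => /eqP.
move=> h h1; have [->|h0] := eqVneq h 0.
  by rewrite D0 !normr0 powR0 ?mulr0// gt_eqF.
have hn0 : 0 < `|h| by rewrite normr_gt0.
have [j /andP[j1 j2]] := dyadic_scale hn0 h1.
apply: (le_trans (key j h j2)); rewrite -mulrA ler_wpM2l// ler_pdivlMl//.
rewrite -exprS -powR_exprl ?hf_ge0//; by apply: (ge0_ler_powR (ltW s0)); rewrite ?nnegrE ?exprn_ge0 ?hf_ge0 ?(ltW j1).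
Qed.

(* Here [s > 1]: the difference quotients along [2^-j] converge geometrically,
   and a general [t] is reached by peeling off its binary digits. *)
Lemma approximately_additive (D : R -> R) (B C b c : R) :
  0 < b -> b <= 1 -> 0 <= c -> 1 < b + c -> 0 <= C ->
  (forall t, `|t| <= 1 -> `|D t| <= B * `|t| `^ b) ->
  (forall t t', `|t| <= 1 -> `|t'| <= 1 ->
    `|D (t + t') - D t - D t'| <= C * `|t| `^ b * `|t'| `^ c) ->
  let th := hf `^ (b + c) in
  exists d, forall t, `|t| <= 1 ->
    `|D t - t * d| <= 2 * (C / (1 - 2 * th) + 2 * C) / th * `|t| `^ (b + c).
Proof.
move=> b0 b1 c0 bc C0 DB DD th.
have bc0 : 0 < b + c by lra.
have th0 : 0 < th by exact: powR_gt0.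
have th2 : 2 * th < 1.
  rewrite mulrC -ltr_pdivlMr// mul1r -[ltRHS]powRr1 ?ltW//.
  by rewrite /th /powR gt_eqF// ltr_expR ltr_nM2r// ln_lt0// hf_gt0.
have B0 : 0 <= B.
  by have := DB 1; rewrite normr1 powR1 mulr1 => /(_ (lexx _)); apply: le_trans.
have D0 : D 0 = 0.
  by have := DB 0; rewrite normr0 powR0 ?gt_eqF// mulr0 => /(_ ler01); rewrite normr_le0 => /eqP.
have hf1 j : hf ^+ j <= 1 by rewrite exprn_ile1// ltW.
have hf0 j : 0 <= hf ^+ j by rewrite exprn_ge0// ltW.
have thj j : 0 <= th ^+ j by rewrite exprn_ge0// ltW.
have DDj j t t' : `|t| <= hf ^+ j -> `|t'| <= hf ^+ j -> `|D (t + t') - D t - D t'| <= C * th ^+ j.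
  move=> tj tj'; apply: (le_trans (DD _ _ (le_trans tj (hf1 j)) (le_trans tj' (hf1 j)))).
  rewrite -mulrA ler_wpM2l// -powR_exprl ?hf_ge0// powRDr ?exprn_gt0//.
  by apply: ler_pM; rewrite ?powR_ge0//; [apply: (ge0_ler_powR (ltW b0))|apply: (ge0_ler_powR c0)];
    rewrite ?nnegrE.
have hfD j : hf ^+ j = hf ^+ j.+1 + hf ^+ j.+1.
  by rewrite exprS; field.
have step j : `|2 ^+ j.+1 * D (hf ^+ j.+1) - 2 ^+ j * D (hf ^+ j)| <= C * (2 * th) ^+ j.
  have -> : 2 ^+ j.+1 * D (hf ^+ j.+1) - 2 ^+ j * D (hf ^+ j) =
      - (2 ^+ j * (D (hf ^+ j.+1 + hf ^+ j.+1) - D (hf ^+ j.+1) - D (hf ^+ j.+1))).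
    by rewrite -hfD exprS; ring.
  rewrite normrN normrM ger0_norm ?exprn_ge0// exprMn mulrCA ler_wpM2l ?exprn_ge0//.
  have hn := hf0 j.+1.
  apply: (le_trans (DDj j.+1 _ _ _ _)); rewrite ?ger0_norm//.
  by rewrite ler_wpM2l// exprS ler_piMl//; lra.
have r0 : 0 <= 2 * th by rewrite mulr_ge0// ltW.
have [d Hd] := geometric_limit r0 th2 step.
exists d; pose E t := D t - t * d.
set C1 := C / (1 - 2 * th); have C10 : 0 <= C1 by rewrite divr_ge0// subr_ge0 ltW.
have E0 : E 0 = 0 by rewrite /E D0 mul0r subrr.
have EE j t t' : `|t| <= hf ^+ j -> `|t'| <= hf ^+ j -> `|E (t + t') - E t - E t'| <= C * th ^+ j.
  move=> tj tj'; rewrite (_ : _ - _ = D (t + t') - D t - D t'); first exact: DDj.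
  by rewrite /E; ring.
have Ej j : `|E (hf ^+ j)| <= C1 * th ^+ j.
  have h2 : hf ^+ j * 2 ^+ j = 1 by rewrite -exprMn mulVf ?expr1n// pnatr_eq0.
  have -> : E (hf ^+ j) = hf ^+ j * (2 ^+ j * D (hf ^+ j) - d).
    by rewrite mulrBr mulrA h2 mul1r.
  rewrite normrM ger0_norm// (le_trans (ler_wpM2l (hf0 j) (Hd j)))//.
  by rewrite -/C1 exprMn mulrCA (mulrA (hf ^+ j)) h2 mul1r lexx.
have ENj j : `|E (- hf ^+ j)| <= (C1 + C) * th ^+ j.
  have hn : `|hf ^+ j| <= hf ^+ j by rewrite ger0_norm.
  have := @EE j (hf ^+ j) (- hf ^+ j) hn; rewrite normrN => /(_ hn).
  by rewrite subrr E0; have := Ej j; rewrite !ler_norml mulrDl; lra.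
(* The cost of removing one digit: at most [C1 + C] for the value at plus or minus a dyadic number,
   and [C] for additivity. *)
pose C2 := C1 + 2 * C.
have peel j t : `|t| <= hf ^+ j -> exists2 t', `|t'| <= hf ^+ j.+1 & `|E t - E t'| <= C2 * th ^+ j.
  move=> tj; have Cth : 0 <= C * th ^+ j by rewrite mulr_ge0.
  have C1th : 0 <= C1 * th ^+ j by rewrite mulr_ge0.
  have hj := hfD j; have h0 := hf0 j.+1.
  have hn : `|hf ^+ j| <= hf ^+ j by rewrite ger0_norm.
  have hn' : `|- hf ^+ j| <= hf ^+ j by rewrite normrN.
  have C2E : C2 * th ^+ j = C1 * th ^+ j + C * th ^+ j + C * th ^+ j by rewrite /C2; ring.
  have [tle|tgt] := leP t (hf ^+ j.+1); last first.
    have t'j : `|t - hf ^+ j| <= hf ^+ j.+1.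
      by move: tj; rewrite !ler_norml; lra.
    exists (t - hf ^+ j) => //.
    have := @EE j _ _ (le_trans t'j _) hn; rewrite subrK => /(_ ltac:(lra)).
    have := Ej j; rewrite C2E !ler_norml; lra.
  have [tge|tlt] := leP (- hf ^+ j.+1) t.
    exists t; first by rewrite ler_norml tge.
    by rewrite subrr normr0 C2E !addr_ge0.
  have t'j : `|t + hf ^+ j| <= hf ^+ j.+1.
    by move: tj; rewrite !ler_norml; lra.
  exists (t + hf ^+ j) => //.
  have := @EE j _ _ (le_trans t'j _) hn'; rewrite addrK => /(_ ltac:(lra)).
  have := ENj j; rewrite C2E !ler_norml mulrDl; lra.
(* As [2 th < 1], each cost [C2 th^j] is at most [2 C2 (th^j - th^(j+1))], and these differences
   telescope. *)
have peels m : forall j t, `|t| <= hf ^+ j -> exists2 t', `|t'| <= hf ^+ (j + m) &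
    `|E t - E t'| <= 2 * C2 * (th ^+ j - th ^+ (j + m)).
  have C20 : 0 <= C2 by rewrite /C2 addr_ge0// mulr_ge0.
  elim: m => [|m IH] j t tj; first by exists t; rewrite addn0 ?subrr ?normr0 ?mulr0.
  have [t' t'j Ht'] := peel j t tj; have [t'' t''j Ht''] := IH _ _ t'j.
  exists t''; first by rewrite addnS -addSn.
  rewrite -(subrKA (E t')) (le_trans (ler_normD _ _))//.
  apply: (le_trans (lerD Ht' Ht'')); rewrite addSnnS.
  have : C2 * (2 * th * th ^+ j) <= C2 * th ^+ j by rewrite ler_wpM2l// ler_piMl// ltW.
  have -> : C2 * (2 * th * th ^+ j) = 2 * C2 * th ^+ j.+1.
    by rewrite exprS; ring.
  by rewrite !mulrBr; lra.
(* The a priori Hoelder bound with exponent [b] makes the value at the remaining digits tend to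
   [0]. *)
have Et j t : `|t| <= hf ^+ j -> `|E t| <= 2 * C2 * th ^+ j.
  move=> tj; pose rho := hf `^ b.
  have rho1 : rho < 1 by exact: powR_lt1.
  apply: (@le_add_geometric _ _ (B + `|d|) rho); rewrite ?powR_ge0// => m.
  have [t' t'j Ht'] := peels m j t tj.
  have t'1 : `|t'| <= 1 by rewrite (le_trans t'j).
  have tb : `|t'| `^ b <= rho ^+ m.
    apply: (@le_trans _ _ (rho ^+ (j + m))); last first.
      by rewrite exprD ler_piMl ?exprn_ge0 ?exprn_ile1 ?powR_ge0// ltW.
    by rewrite -powR_exprl ?hf_ge0//; apply: (ge0_ler_powR (ltW b0)); rewrite ?nnegrE.
  have tb' : `|t'| <= `|t'| `^ b.
    have [->|t'0] := eqVneq t' 0; first by rewrite normr0 powR_ge0.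
    by rewrite -[leLHS]powRr1//; apply: ger_powR => //; rewrite normr_gt0 t'0.
  have Et' : `|E t'| <= (B + `|d|) * rho ^+ m.
    rewrite mulrDl (le_trans (ler_normB _ _))// lerD//.
      by rewrite (le_trans (DB _ t'1))// ler_wpM2l.
    by rewrite normrM mulrC ler_wpM2l// (le_trans tb').
  rewrite -(subrK (E t') (E t)) (le_trans (ler_normD _ _))// lerD//.
  by rewrite (le_trans Ht')// ler_wpM2l ?gerBl ?thj// /C2 mulr_ge0// addr_ge0// mulr_ge0.
move=> t t1; rewrite -/(E t); have [->|t0] := eqVneq t 0.
  by rewrite E0 normr0 powR0 ?mulr0// gt_eqF.
have tn0 : 0 < `|t| by rewrite normr_gt0.
have [j /andP[j1 j2]] := dyadic_scale tn0 t1.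
apply: (le_trans (Et j t j2)); rewrite -[leRHS]mulrA -/C1 -/C2.
have C20 : 0 <= 2 * C2 by rewrite mulr_ge0// addr_ge0// mulr_ge0.
rewrite ler_wpM2l// ler_pdivlMl//.
rewrite -exprS -powR_exprl ?hf_ge0//; by apply: (ge0_ler_powR (ltW bc0)); rewrite ?nnegrE ?exprn_ge0 ?hf_ge0 ?(ltW j1).
Qed.

End dyadic_scales.

(** * From mixed second differences to Hoelder and differentiable functions *)

Section mixed_differences.
Context (R : realType) (n : nat).
Notation V := 'rV[R]_n.
Notation e_ i := (@basis_vector R n i).
Implicit Types (F : V -> R) (b c : R).

Definition SD b c F := forall r : R, exists2 C, 0 <= C & forall x h k : V,
  `|x| <= r -> `|h| <= 1 -> `|k| <= 1 ->
  `|F (x + h + k) - F (x + h) - F (x + k) + F x| <= C * `|h| `^ b * `|k| `^ c.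

Lemma powRD_norm b c (h : V) : b != 0 -> b + c != 0 ->
  `|h| `^ b * `|h| `^ c = `|h| `^ (b + c).
Proof.
move=> b0 bc0; have [->|h0] := eqVneq h 0; first by rewrite normr0 (powR0 b0) (powR0 bc0) mul0r.
by rewrite powRDr// normr_gt0.
Qed.

(** With equal increments the mixed difference is [D (2h) - 2 D h] for [D h = F (x + h) - F x]. *)
Lemma SD_LH b c F : 0 < b -> 0 <= c -> b + c < 1 -> LH b F -> SD b c F -> LH (b + c) F.
Proof.
move=> b0 c0 bc Fb Fbc r; have [C C0 HC] := Fbc r; have [B B0 HB] := LH_bound Fb r.
have bc0 : 0 < b + c by rewrite ltr_pwDl.
pose A := Num.max B (C * 2^-1 `^ (b + c) / (2 * 2^-1 `^ (b + c) - 1)) / 2^-1 `^ (b + c).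
exists (Num.max B A) => x xr; have [Fx Hx] := HB x xr; split; first by rewrite le_max Fx.
move=> h h1; apply: (@le_trans _ _ (A * `|h| `^ (b + c))); last first.
  by rewrite ler_wpM2r ?powR_ge0// le_max lexx orbT.
apply: (@dyadic_holder R V (fun h => F (x + h) - F x) B C) => // {h1}h h1.
  rewrite (le_trans (Hx h h1))// ler_piMr//.
  by have := ge0_ler_powR (ltW b0); move=> /(_ `|h| 1); rewrite !nnegrE powR1; apply.
have := HC x h h xr h1 h1; rewrite -mulrA powRD_norm ?gt_eqF//.
rewrite scaler_nat mulr2n addrA; congr (`|_| <= _); ring.
Qed.

(** Along [e_ i] the mixed difference is the defect of additivity of [t |-> F (x + t e_i) - F x],
    which is thus linear up to order [b + c > 1]. *)
Lemma SD_derive b c F r i : 0 < b -> b <= 1 -> 0 <= c -> 1 < b + c -> LH b F -> SD b c F ->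
  exists2 A, 0 <= A & forall x : V, `|x| <= r -> derivable F x (e_ i) /\
    forall t : R, `|t| <= 1 ->
      `|F (x + t *: e_ i) - F x - t * 'D_(e_ i) F x| <= A * `|t| `^ (b + c).
Proof.
move=> b0 b1 c0 bc Fb Fbc; have [C C0 HC] := Fbc r; have [B B0 HB] := LH_bound Fb r.
pose th := 2^-1 `^ (b + c) : R.
pose A := 2 * (C / (1 - 2 * th) + 2 * C) / th.
have H x : `|x| <= r -> exists d, forall t, `|t| <= 1 ->
    `|F (x + t *: e_ i) - F x - t * d| <= A * `|t| `^ (b + c).
  move=> xr; have [Fx Hx] := HB x xr.
  have te (t : R) : `|t *: e_ i| <= `|t| by rewrite normrZ ler_piMr// norm_basis_vector.
  apply: (@approximately_additive R (fun t => F (x + t *: e_ i) - F x) B C) => //.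
    move=> t t1; apply: (le_trans (Hx _ (le_trans (te t) t1))).
    by rewrite ler_wpM2l//; apply: (ge0_ler_powR (ltW b0)); rewrite ?nnegrE.
  move=> t t' t1 t1'.
  have := HC x _ _ xr (le_trans (te t) t1) (le_trans (te t') t1').
  rewrite scalerDl addrA (_ : _ - _ - _ + _ = F (x + t *: e_ i + t' *: e_ i) - F x -
    (F (x + t *: e_ i) - F x) - (F (x + t' *: e_ i) - F x)); last by ring.
  move/le_trans; apply; rewrite -!mulrA ler_wpM2l//.
  apply: ler_pM; rewrite ?powR_ge0//; [apply: (ge0_ler_powR (ltW b0))|apply: (ge0_ler_powR c0)];
    by rewrite ?nnegrE.
exists `|A| => // x xr; have [d Hd] := H x xr.
have [] : is_derive x (e_ i) F d.
  apply: (@is_derive_modulus _ _ _ _ _ _ A (b + c - 1)); first by rewrite subr_gt0.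
  move=> t t1; apply: (le_trans (Hd t t1)); rewrite le_eqVlt; apply/orP; left; apply/eqP.
  rewrite -mulrA; congr (_ * _); have [->|t0] := eqVneq t 0.
    by rewrite normr0 mulr0 powR0// gt_eqF// (lt_trans _ bc).
  rewrite -[X in _ = _ * X]powRr1// -powRDr ?normr_gt0//; congr powR; ring.
move=> Fd dE; split => // t t1; rewrite dE (le_trans (Hd t t1))// ler_wpM2r ?powR_ge0//.
exact: ler_norm.
Qed.

(** The derivatives at [x] and [x + h] are both probed with the step [|h|] along [e_ i]: [|h|] times
    their difference is a mixed difference plus two remainders, all of order [|h|^(b+c)]. The step
    [t = 1] bounds the derivative itself. *)
Lemma SD_Reg1 b c F : 0 < b -> b <= 1 -> 0 <= c -> c <= 1 -> 1 < b + c ->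
  LH b F -> SD b c F -> Reg (LH (b + c - 1)) 1 F.
Proof.
move=> b0 b1 c0 c1 bc Fb Fbc; split.
- by apply: LH_le Fb; lra.
- move=> i x; have [A _ HA] := SD_derive `|x| i b0 b1 c0 bc Fb Fbc.
  by have [] := HA x (lexx _).
move=> i r; have [A A0 HA] := SD_derive (r + 1) i b0 b1 c0 bc Fb Fbc.
have [B B0 HB] := LH_bound Fb r; have [C C0 HC] := Fbc r.
exists (A + A + B + C) => x xr; have [Fx Hx] := HB x xr.
have xr1 : `|x| <= r + 1 by rewrite (le_trans xr)// lerDl.
have [_ Dx] := HA x xr1; split.
  have := Dx 1; rewrite normr1 powR1 scale1r mul1r mulr1 => /(_ (lexx _)).
  have := Hx (e_ i) (norm_basis_vector _ i).
  have : B * `|e_ i| `^ b <= B.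
    rewrite ler_piMr//; have := ge0_ler_powR (ltW b0).
    by move=> /(_ `|e_ i| 1); rewrite !nnegrE powR1; apply => //; exact: norm_basis_vector.
  rewrite !ler_norml; lra.
move=> h h1; have [->|h0] := eqVneq h 0.
  by rewrite addr0 subrr normr0 mulr_ge0 ?powR_ge0// !addr_ge0.
have hn0 : 0 < `|h| by rewrite normr_gt0.
have xhr : `|x + h| <= r + 1 by rewrite (le_trans (ler_normD _ _))// lerD.
have [_ Dxh] := HA (x + h) xhr.
have hh : `| `|h| | <= 1 by rewrite ger0_norm.
rewrite -(ler_pM2l hn0) -{1}[`|h|]ger0_norm// -normrM mulrBr.
have -> : `|h| * ((A + A + B + C) * `|h| `^ (b + c - 1)) =
    A * `|h| `^ (b + c) + A * `|h| `^ (b + c) + B * `|h| `^ (b + c) + C * `|h| `^ (b + c).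
  rewrite (_ : `|h| `^ (b + c) = `|h| `^ (b + c - 1) * `|h|); first by ring.
  by rewrite -[X in _ = _ * X]powRr1// -powRDr//; congr powR; ring.
have := Dx _ hh; have := Dxh _ hh.
have te : `| `|h| *: e_ i| <= `|h|.
  by rewrite normrZ ger0_norm// ler_piMr// norm_basis_vector.
have := HC x h (`|h| *: e_ i) xr h1 (le_trans te h1).
have := ler_wpM2l C0 (ler_pM (powR_ge0 `|h| b) (powR_ge0 _ c) (lexx _)
   (ge0_ler_powR c0 (normr_ge0 _) (normr_ge0 _) te)).
rewrite powRD_norm ?gt_eqF//; last by rewrite (lt_trans _ bc).
rewrite mulrA [`| `|h| |]ger0_norm// => H1 /le_trans/(_ H1){H1}.
have : 0 <= B * `|h| `^ (b + c) by rewrite mulr_ge0// powR_ge0.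
rewrite !ler_norml.
move: (`|h| `^ (b + c)) => p.
lra.
Qed.

End mixed_differences.

(** * Regularity gained under convolution with the singular kernel *)

Section singular_regularity.
Context (R : realType) (n : nat).
Notation V := 'rV[R]_n.
Notation T := (lebesgue_space R n).
Notation mu := (lebesgue_Rn R n).
Notation e_ i := (@basis_vector R n i).
Context (s : R) (N : nat).
Hypothesis s0 : 0 < s.
Hypothesis sn : 2 * s < n%:R.
Notation T1 := (conv (@k1 R n s N)).
Notation beta := (@hoelder_gain R n s).
Implicit Types (f g : V -> R) (b c : R).

Lemma conv_k1_LH g : measurable_fun [set: T] (g : T -> R) ->
  (forall r, exists G, forall y : V, `|y| <= r -> `|g y| <= G) -> LH beta (T1 g).
Proof.
move=> mg bg r; have [G HG] := bg (r + 2).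
have [M1 M10 HM1] := @conv_k1_bound R n s N s0 sn.
have [M M0 HM] := @conv_k1_modulus R n s N s0 sn.
pose G' := Num.max G 0; have G0 : 0 <= G' by rewrite le_max lexx orbT.
have gG (x y : V) : `|x| <= r -> `|x - y| < 2 -> `|g y| <= G'.
  move=> xr xy; rewrite le_max HG// -(subKr x y) (le_trans (ler_normB _ _))//.
  by rewrite lerD// ltW.
exists (Num.max (M1 * G') (M * G')) => x xr; split.
  rewrite le_max; apply/orP; left; apply: (HM1 g x G' mg G0 _).2 => y xy.
  by apply: gG xr _; rewrite (lt_trans xy)// ltr1n.
move=> h h1; apply: (@le_trans _ _ (M * G' * `|h| `^ beta)).
  by apply: HM => // y; exact: gG.
by rewrite ler_wpM2r ?powR_ge0// le_max lexx orbT.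
Qed.

Lemma LH_measurable c g : 0 < c -> LH c g -> measurable_fun [set: T] (g : T -> R).
Proof. by move=> c0 gc; apply: continuous_measurable_Rn; exact: LH_continuous gc. Qed.

Lemma conv_k1_integrable c g (x : V) : 0 < c -> LH c g ->
  mu.-integrable [set: T] (EFin \o (fun y => @k1 R n s N (x - y) * g y)).
Proof.
move=> c0 gc; have [M1 M10 HM1] := @conv_k1_bound R n s N s0 sn.
have [C C0 HC] := LH_bound gc (`|x| + 1).
have [] // := HM1 g x C (LH_measurable c0 gc) C0 => y xy.
have [] // := HC y; rewrite -(subKr x y) (le_trans (ler_normB _ _))//.
by rewrite lerD// ltW.
Qed.

Lemma LH_shift c g (h : V) : LH c g -> LH c (fun y => g (y + h)).
Proof.
move=> gc r; have [C HC] := gc (r + `|h|); exists C => x xr.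
have [] := HC (x + h); first by rewrite (le_trans (ler_normD _ _))// lerD.
by move=> gx H; split => // k k1; rewrite addrAC; exact: H.
Qed.

Lemma conv_k1_difference c g (x h : V) : 0 < c -> LH c g ->
  T1 g (x + h) - T1 g x = T1 (fun y => g (y + h) - g y) x.
Proof.
move=> c0 gc; rewrite conv_translate; last first.
  apply: measurable_funM; first exact: (@measurable_k1 R n s N s0 (x + h)).
  exact: LH_measurable gc.
rewrite /conv -RintegralB//; [|exact: conv_k1_integrable (LH_shift h gc)|exact: conv_k1_integrable gc].
by apply: eq_Rintegral => y _; rewrite mulrBr.
Qed.

(** The increment [k] is put on [g], where it yields the local bound [C |k|^c]; the increment [h] is
    left to the modulus of the kernel. *)
Lemma conv_k1_SD b c g : 0 < b -> b <= beta -> 0 < c -> LH c g -> SD b c (T1 g).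
Proof.
move=> b0 bb c0 gc r; have [C C0 HC] := LH_bound gc (r + 2).
have [M M0 HM] := @conv_k1_modulus R n s N s0 sn.
exists (M * C) => [|x h k xr h1 k1']; first exact: mulr_ge0.
have gk : LH c (fun y => g (y + k) - g y).
  rewrite (_ : (fun y => _) = (fun y => g (y + k) + (-1) * g y)); last first.
    by apply/funext => y; rewrite mulN1r.
  by apply: LH_add; [exact: LH_shift|apply: LH_mul => //; exact: LH_cst].
rewrite (_ : _ - _ - _ + _ = T1 (fun y => g (y + h + k) - g (y + h) - (g (y + k) - g y)) x); last first.
  rewrite -(conv_k1_difference x h c0 gk) -(conv_k1_difference (x + h) k c0 gc).
  rewrite -(conv_k1_difference x k c0 gc).
  by move: (T1 g x) (T1 g (x + h)) (T1 g (x + k)) (T1 g (x + h + k)) => a a1 a2 a3; ring.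
rewrite -(conv_k1_difference x h c0 gk).
have [->|h0] := eqVneq h 0.
  by rewrite addr0 subrr normr0 !mulr_ge0 ?powR_ge0.
apply: (@le_trans _ _ (M * (C * `|k| `^ c) * `|h| `^ beta)).
  have G0 : 0 <= C * `|k| `^ c by rewrite mulr_ge0 ?powR_ge0.
  apply: (HM (fun y => g (y + k) - g y) x h _ (LH_measurable c0 gk) G0 h1) => y xy.
  have [|_ H] := HC y; last exact: H.
  rewrite -(subKr x y) (le_trans (ler_normB _ _))//.
  by rewrite lerD// ltW.
rewrite -mulrA -[leRHS]mulrA -[leRHS]mulrA ler_wpM2l// -mulrA ler_wpM2l// mulrC.
by rewrite ler_wpM2r ?powR_ge0//; apply: ger_powR => //; rewrite normr_gt0 h0.
Qed.

(** The derivative falls on [g]: its first-order remainder is [O(|t|^(1+c))] uniformly near [x], and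
    convolution with [k1] preserves local bounds. *)
Lemma is_derive_conv_k1 c g i (x : V) : 0 < c -> LH c g ->
  (forall y, derivable g y (e_ i)) -> LH c (fun y => 'D_(e_ i) g y) ->
  is_derive x (e_ i) (T1 g) (T1 (fun y => 'D_(e_ i) g y) x).
Proof.
move=> c0 gc Dg dgc; have [C C0 HC] := LH_bound dgc (`|x| + 1).
have [M M0 HM] := @conv_k1_bound R n s N s0 sn.
apply: (@is_derive_modulus _ _ _ _ _ _ (M * C) c) => // t t1.
pose E y := g (y + t *: e_ i) - g y - t * 'D_(e_ i) g y.
have te (a : R) : `|a *: e_ i| <= `|a| by rewrite normrZ ler_piMr// norm_basis_vector.
have mE : measurable_fun [set: T] (E : T -> R).
  apply: measurable_funB.
    by apply: measurable_funB; [exact: LH_measurable (LH_shift _ gc)|exact: LH_measurable gc].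
  by apply: measurable_funM; [exact: measurable_cst|exact: LH_measurable dgc].
have G0 : 0 <= C * `|t| `^ c * `|t| by rewrite !mulr_ge0 ?powR_ge0.
have [] := HM E x (C * `|t| `^ c * `|t|) mE G0.
  move=> y xy; have [a at_ Ea] := line_mean_value y t Dg.
  rewrite /E Ea -mulrBr normrM mulrC ler_wpM2r//.
  have yr : `|y| <= `|x| + 1.
    by rewrite -(subKr x y) (le_trans (ler_normB _ _))// lerD// ltW.
  have [_ H] := HC y yr; apply: (le_trans (H _ (le_trans (te a) (le_trans at_ t1)))).
  rewrite ler_wpM2l//; apply: (ge0_ler_powR (ltW c0)); rewrite ?nnegrE//.
  exact: le_trans (te a) at_.
rewrite [M * _]mulrA [M * _]mulrA => _; apply: le_trans; rewrite le_eqVlt; apply/orP; left; apply/eqP.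
congr `|_|; transitivity (T1 (fun y => g (y + t *: e_ i) - g y) x - t * T1 (fun y => 'D_(e_ i) g y) x).
  by congr (_ - _); exact: conv_k1_difference gc.
rewrite /conv.
have i1 : mu.-integrable [set: T] (EFin \o (fun y => @k1 R n s N (x - y) * (g (y + t *: e_ i) - g y))).
  have := integrableB measurableT (conv_k1_integrable x c0 (LH_shift (t *: e_ i) gc))
    (conv_k1_integrable x c0 gc).
  by apply: eq_integrable => // y _ /=; rewrite -EFinB mulrBr.
have i2 : mu.-integrable [set: T] (EFin \o (fun y => t * (@k1 R n s N (x - y) * 'D_(e_ i) g y))).
  have := integrableZl measurableT t (conv_k1_integrable x c0 dgc).
  by apply: eq_integrable.
rewrite -RintegralZl//; last exact: conv_k1_integrable dgc.
rewrite -RintegralB//; apply: eq_Rintegral => y _; rewrite /E; ring.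
Qed.

(** Since derivatives pass to [g], a gain of [j] orders for functions that are merely Hoelder is a
    gain of [j] orders at every level [k]. *)
Lemma conv_k1_Reg (P : (V -> R) -> Prop) c j : 0 < c ->
  (forall g, LH c g -> Reg P j (T1 g)) ->
  forall k g, Reg (LH c) k g -> Reg P (k + j) (T1 g).
Proof.
move=> c0 base; elim=> [|k IH] g; first exact: base.
move=> [gc Dg Hg]; have D i x := is_derive_conv_k1 x c0 gc (Dg i) (Reg_base (Hg i)).
split; first exact: Reg_base (base g gc).
  by move=> i x; have [] := D i x.
move=> i; rewrite (_ : (fun x => _) = T1 (fun y => 'D_(e_ i) g y)); first exact: IH (Hg i).
by apply/funext => x; have [_ ->] := D i x.
Qed.

Lemma conv_k1_LH_gain b c g : 0 < b -> b <= beta -> 0 < c -> LH c g -> LH b (T1 g).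
Proof.
move=> b0 bb c0 gc; apply: LH_le bb _; apply: conv_k1_LH; first exact: LH_measurable gc.
by move=> r; have [C HC] := gc r; exists C => y /HC[].
Qed.

Lemma conv_k1_Reg_lt1 b c k g : 0 < b -> b <= beta -> 0 < c -> b + c < 1 ->
  Reg (LH c) k g -> Reg (LH (b + c)) k (T1 g).
Proof.
move=> b0 bb c0 bc; rewrite -{2}[k]addn0; apply: conv_k1_Reg => // {}g gc.
apply: (SD_LH b0 (ltW c0) bc); first exact: conv_k1_LH_gain gc.
exact: conv_k1_SD.
Qed.

Lemma conv_k1_Reg_gt1 b c k g : 0 < b -> b <= beta -> 0 < c -> c <= 1 -> 1 < b + c ->
  Reg (LH c) k g -> Reg (LH (b + c - 1)) k.+1 (T1 g).
Proof.
move=> b0 bb c0 c1 bc; rewrite -addn1; apply: conv_k1_Reg => // {}g gc.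
have b1 : b <= 1 by rewrite (le_trans bb)// ltW// hoelder_gain_lt1.
apply: (SD_Reg1 b0 b1 (ltW c0) c1 bc); first exact: conv_k1_LH_gain gc.
exact: conv_k1_SD.
Qed.

End singular_regularity.

(** * One more derivative at each turn *)

Section bootstrap.
Context (R : realType) (n : nat).
Notation V := 'rV[R]_n.
Context (s p : R) (v : V -> R).
Hypothesis s0 : 0 < s.
Hypothesis sn : 2 * s < n%:R.
Hypothesis v_gt0 : forall x, 0 < v x.
Hypothesis v_eq : forall N, exists2 w, Reg (LH 1) N w &
  v = fun x => conv (@k1 R n s N) (fun y => v y `^ p) x + w x.
Notation beta := (@hoelder_gain R n s).

(* Starting from an exponent [d = 1 / (M + 1/2)], steps of length [d] reach
   [M * d < 1 < (M + 1) * d], so the excluded value [1] is jumped over. *)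
Lemma Reg_bootstrap c k : 0 < c -> Reg (LH c) k v ->
  exists2 c', 0 < c' & Reg (LH c') k.+1 v.
Proof.
move=> c0 vc; have beta0 := @hoelder_gain_gt0 R n s sn.
pose m0 := Num.min c beta; have m00 : 0 < m0 by rewrite lt_min c0.
pose M := (Num.truncn m0^-1).+1; pose d : R := (M%:R + 2^-1)^-1.
have M2 : 0 < M%:R + 2^-1 :> R by rewrite ltr_wpDr// ?invr_ge0// ltr0n.
have d0 : 0 < d by rewrite invr_gt0.
have dM : M%:R * d = 1 - d / 2 by rewrite /d; field; rewrite gt_eqF//; lra.
have dm0 : d <= m0.
  rewrite /d -[leRHS]invrK lef_pV2 ?posrE ?invr_gt0// (le_trans (ltW (truncnS_gt _)))//.
  by rewrite lerDl invr_ge0.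
have [db dc] : d <= beta /\ d <= c by move: dm0; rewrite le_min => /andP[].
have d1 : d < 1 by rewrite (le_lt_trans db)// hoelder_gain_lt1.
(* The kernel is split anew for each [k], as the smoothness of [w] is limited by the Taylor degree
   used in the splitting. *)
have [w wreg vE] := v_eq k.+1.
have wk1 c' : c' <= 1 -> Reg (LH c') k.+1 w.
  by move=> c1; apply: sub_Reg wreg => g; exact: LH_le.
have claim m : (0 < m)%N -> (m <= M)%N -> Reg (LH (m%:R * d)) k v.
  elim: m => // -[|m] IH _ mM.
    by rewrite mul1r; apply: sub_Reg vc => g; exact: LH_le.
  have {}IH := IH isT (ltnW mM).
  have md0 : 0 < m.+1%:R * d by rewrite mulr_gt0.
  have mM' : m.+2%:R * d <= 1 - d / 2 by rewrite -dM ler_wpM2r ?(ltW d0)// ler_nat.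
  have E : m.+2%:R * d = d + m.+1%:R * d by rewrite -[m.+2%:R]natr1; ring.
  rewrite E in mM' *; rewrite vE; apply: RegD; first exact: LH_add.
    apply: conv_k1_Reg_lt1 => //; first by lra.
    exact: Reg_powR.
  by apply/RegW/wk1; lra.
have := claim M isT (leqnn _); rewrite dM => HM.
have d2 : d + (1 - d / 2) - 1 = d / 2 by field.
exists (d / 2); first by rewrite divr_gt0.
rewrite -d2 vE; apply: RegD; first exact: LH_add.
  apply: conv_k1_Reg_gt1 => //; [lra|lra|lra|].
  by apply: Reg_powR => //; lra.
by apply: wk1; lra.
Qed.

End bootstrap.

(** * Splitting of the equation and conclusion *)

Section kernel_splitting.
Context (R : realType) (n : nat).
Notation V := 'rV[R]_n.
Notation T := (lebesgue_space R n).
Notation mu := (lebesgue_Rn R n).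
Context (s p : R) (v : V -> R).
Hypothesis s0 : 0 < s.
Hypothesis sn : s < n%:R.
Hypothesis v_gt0 : forall x, 0 < v x.
Hypothesis mv : measurable_fun [set: T] (v : T -> R).
Hypothesis v_bounded : forall r, exists C, forall x, `|x| <= r -> v x <= C.
Hypothesis v_weight : (\int[mu]_y (v y `^ p * (1 + `|y : V|) `^ (- s))%:E < +oo)%E.
Hypothesis v_eq : forall x : V, v x = \int[mu]_y (v y `^ p * enorm (x - y) `^ (- s)).
Hypothesis p0 : 0 <= p.
Notation g := (fun y : V => v y `^ p).

Let s20 : 0 < s / 2. Proof. by rewrite divr_gt0. Qed.
Let s2n : 2 * (s / 2) < n%:R. Proof. by rewrite mulrCA divff ?mulr1// pnatr_eq0. Qed.

Let mg : measurable_fun [set: T] (g : T -> R).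
Proof. exact: (measurableT_comp (measurable_powR _) mv). Qed.

Let g_bounded r : exists C, forall x : V, `|x| <= r -> `|g x| <= C.
Proof.
have [C HC] := v_bounded r; exists (C `^ p) => x xr.
rewrite ger0_norm ?powR_ge0//; apply: (ge0_ler_powR p0); rewrite ?nnegrE ?HC ?(ltW (v_gt0 x))//.
by rewrite (le_trans (ltW (v_gt0 x)))// HC.
Qed.

Let g_weight : (\int[mu]_y (`|g y| * (1 + `|y : V|) `^ (- s))%:E < +oo)%E.
Proof. by under eq_integral do rewrite ger0_norm ?powR_ge0//. Qed.

Lemma kernel_splitting N : exists2 w, Reg (LH 1) N w &
  v = fun x => conv (@k1 R n (s / 2) N) g x + w x.
Proof.
have Rphi := @Reg_phi R n (s / 2) N s20.
rewrite (_ : - (2 * (s / 2)) = - s) in Rphi; last by field.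
exists (conv (fun z => phi (s / 2) N.+1 (sqn z)) g).
  exact: (Reg_conv_smooth (ltW s0) mg g_weight Rphi).
apply/funext => x; have [M M0 HM] := @conv_k1_bound R n (s / 2) N s20 s2n.
have [C HC] := g_bounded (`|x| + 1).
have i1 : mu.-integrable [set: T] (EFin \o (fun y => @k1 R n (s / 2) N (x - y) * g y)).
  have [] // := HM g x (Num.max C 0) mg; first by rewrite le_max lexx orbT.
  move=> y xy; rewrite le_max HC// -(subKr x y) (le_trans (ler_normB _ _))//.
  by rewrite lerD// ltW.
have [K K0 HK] := Kd_bound (Reg_base Rphi).
have i2 : mu.-integrable [set: T] (EFin \o (fun y => phi (s / 2) N.+1 (sqn (x - y)) * g y)).
  have mphi := measurable_reflect x (Kd_continuous (Reg_base Rphi)).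
  exact: (@conv_weighted R n s g (ltW s0) mg g_weight _ K `|x| x K0 (lexx _) mphi
    (fun z => (HK z).1)).1.
rewrite v_eq /conv -(RintegralD measurableT i1 i2); apply: eq_Rintegral => y _.
by rewrite -mulrDl /k1 /kap subrK mulrC enorm_powR mulNr.
Qed.

Lemma kernel_splitting_smooth : Cinfty v.
Proof.
suff H k : exists2 c, 0 < c & Reg (LH c) k v by move=> k; have [c c0] := H k; exact: Reg_Ck.
elim: k => [|k [c c0 vc]]; last first.
  exact: (@Reg_bootstrap _ _ (s / 2) p v s20 s2n v_gt0 kernel_splitting c).
(* The start: local boundedness of [v] alone gives the singular part the exponent [hoelder_gain],
   and the other part is locally Lipschitz. *)
have [w w1 ->] := kernel_splitting 0.
have b1 := @hoelder_gain_lt1 R n (s / 2) s20.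
exists (hoelder_gain n (s / 2)); first exact: hoelder_gain_gt0.
apply: LH_add; last by apply: LH_le w1; exact: ltW.
exact: conv_k1_LH.
Qed.

End kernel_splitting.

Lemma integral_equation_smooth (R : realType) (n : nat) (s : R)
    (u : lebesgue_space R n -> \bar R) (p := 2 * n%:R / s - 1) :
  (0 < n)%N -> 0 < s -> s < n%:R ->
  measurable_fun [set: lebesgue_space R n] u ->
  (forall x, 0 < u x)%E ->
  (forall r, \int[lebesgue_Rn R n]_(y in [set y : 'rV[R]_n | (`|y| <= r)%R])
    (u y `^ (2 * n%:R / s)) < +oo)%E ->
  (forall x : 'rV[R]_n, u x = \int[lebesgue_Rn R n]_y
    (u y `^ p * (enorm (x - y) `^ (- s))%:E))%E ->
  exists v : 'rV[R]_n -> R, (forall x, u x = (v x)%:E) /\ Cinfty v.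
Proof.
move=> n0 s0 sn mu_ u0 uloc ueq.
have ub := locally_bounded n0 s0 sn mu_ u0 uloc ueq.
have uw := weighted_integral_lty n0 s0 sn mu_ u0 uloc ueq.
pose v x := fine (u x).
have uv x : u x = (v x)%:E.
  have [C HC] := ub _ (normr_ge0 (x : 'rV[R]_n)).
  rewrite fineK// ge0_fin_numE ?(ltW (u0 x))//.
  by rewrite (le_lt_trans (HC x (lexx _)))// ltry.
have v0 x : 0 < v x by rewrite -lte_fin -uv.
have p0 : 0 <= p by rewrite subr_ge0 ler_pdivlMr// mul1r; lra.
exists v; split => //; apply: (@kernel_splitting_smooth R n s p) => //.
- exact: measurableT_comp (fine_measurable measurableT) mu_.
- move=> r; have [r0|r0] := leP 0 r.
    by have [C HC] := ub r r0; exists C => x xr; rewrite -lee_fin -uv HC.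
  by exists 0 => x xr; have := le_trans (normr_ge0 x) xr; rewrite leNgt r0.
- by move: uw; under eq_integral do rewrite uv poweR_EFin -EFinM.
- move=> x; rewrite {1}/v ueq /Rintegral; congr fine.
  by apply: eq_integral => y _; rewrite uv poweR_EFin -EFinM.
Qed.

Unset Implicit Arguments.
Set Strict Implicit.
Set Printing Implicit Defensive.

Theorem theorem1p2 (R : realType) (n : nat) (alpha : R)
    (u : 'rV[R]_n -> \bar R) :
  (1 <= n)%N -> 0 < alpha -> alpha < n%:R ->
  Lploc (2 * n%:R / (n%:R - alpha)) u ->
  (forall x, 0 < u x)%E ->
  (forall x, u x = \int[lebesgue_Rn R n]_y
     (u y `^ ((n%:R + alpha) / (n%:R - alpha)) /
      (enorm (x - y) `^ (n%:R - alpha))%:E))%E ->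
  exists v : 'rV[R]_n -> R, (forall x, u x = (v x)%:E) /\ Cinfty v.
Proof.
move=> n0 a0 an [mu_ uloc] u0 ueq.
have s0 : 0 < n%:R - alpha by rewrite subr_gt0.
have pE : (n%:R + alpha) / (n%:R - alpha) = 2 * n%:R / (n%:R - alpha) - 1.
  by field; rewrite gt_eqF.
apply: (@integral_equation_smooth R n (n%:R - alpha)) => //; first by lra.
  move=> r; have := uloc _ (@compact_norm_le R n r).
  by under eq_integral => y _ do rewrite gee0_abs ?(ltW (u0 y))//.
move=> x; rewrite ueq pE; set s := n%:R - alpha; set p := 2 * n%:R / s - 1.
pose f' (y : 'rV[R]_n) := (u y `^ p * (enorm (x - y) `^ (- s))%:E)%E.
pose f (y : 'rV[R]_n) := (u y `^ p / (enorm (x - y) `^ s)%:E)%E.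
(* At [y = x] the quotient divides by [0] while the negative power is [0] by convention; the two
   integrands need only agree off this null point. *)
have ff' y : y != x -> f y = f' y.
  move=> yx; rewrite /f /f' inver powR_eq0 enorm_eq0 subr_eq0 eq_sym (negbTE yx)/=.
  by rewrite powRN.
have mx : measurable ([set x] : set (lebesgue_space R n)).
  rewrite -[X in measurable X]setCK; apply: measurableC; apply: open_measurable_Rn.
  by apply: closed_openC; exact: accessible_closed_set1 (hausdorff_accessible (@norm_hausdorff _ _)) x.
have mf' : measurable_fun [set: lebesgue_space R n] f'.
  apply: emeasurable_funM; first exact: measurableT_comp (measurable_poweR _) mu_.
  by apply/measurable_EFinP; exact: measurable_enorm_powRr.
have mf : measurable_fun [set: lebesgue_space R n] f.
  rewrite (_ : f = fun y => if y == x then f x else f' y); last first.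
    by apply/funext => y; case: eqVneq => [->//|]; exact: ff'.
  apply: (measurable_fun_ifT _ (@measurable_cst _ _ _ _ _ (f x)) mf').
  apply: (measurable_fun_bool true); rewrite setTI (_ : _ @^-1` _ = [set x])//.
  by apply/seteqP; split => y /= /eqP.
apply: ge0_ae_eq_integral => //.
- by move=> y _; rewrite mule_ge0 ?poweR_ge0// inve_ge0 lee_fin powR_ge0.
- by move=> y _; rewrite mule_ge0 ?poweR_ge0// lee_fin powR_ge0.
exists [set x]; split => //; first exact: lebesgue_Rn_set1.
by move=> y /= H; apply/eqP; apply/negPn/negP => /ff' E; apply: H.
Qed.
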